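(* Let $k$ be a perfect field and $I\subseteq k[x_0,\ldots,x_n]$ a homogeneous unmixed radical ideal of dimension $d$, with $d\ge0$. Then \[h_I(m)\le\deg I\,m^d+{\rm irr}\,I\cdot d\qquad\text{for all } m\ge1.\]
   Context: An ideal is unmixed if all its associated primes have the same dimension. The dimension of a homogeneous ideal is the dimension of the projective variety it defines in $\mathbb P^n(\bar k)$. $h_I(m):=\dim_k(k[x_0,\ldots,x_n]/I)_m$. If $I$ has dimension $d\ge 0$ and Hilbert polynomial with leading term $a_dt^d$, then $\deg I:=d!\,a_d$. ${\rm irr}\,I$ denotes the number of irreducible components of the variety $V(I)\subseteq\mathbb P^n(\bar k)$. *)

(* Defs.v *)
From HB Require Import structures.
From mathcomp Require Import all_boot all_order all_algebra.
From mathcomp Require Import mpoly.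
Set Implicit Arguments. Unset Strict Implicit. Unset Printing Implicit Defensive.
Import Order.TTheory GRing.Theory Num.Theory.
Local Open Scope ring_scope.

Definition perfect_field (k : fieldType) : Prop :=
  forall p : nat, p \in [pchar k] -> forall x : k, exists y : k, y ^+ p = x.

Section Ideals.
Context {N : nat} {R : comNzRingType}.

Definition is_ideal (I : {mpoly R[N]} -> Prop) : Prop :=
  I 0 /\ (forall f g, I f -> I g -> I (f + g)) /\ (forall f g, I g -> I (f * g)).

Definition homog_part (d : nat) (f : {mpoly R[N]}) : {mpoly R[N]} :=
  \sum_(m <- msupp f | mdeg m == d) f@_m *: 'X_[m].

Definition homogeneous_ideal (I : {mpoly R[N]} -> Prop) : Prop :=
  is_ideal I /\ forall f d, I f -> I (homog_part d f).

Definition radical_ideal (I : {mpoly R[N]} -> Prop) : Prop :=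
  is_ideal I /\ forall f (e : nat), I (f ^+ e) -> I f.

Definition prime_ideal (P : {mpoly R[N]} -> Prop) : Prop :=
  is_ideal P /\ ~ P 1 /\ forall f g, P (f * g) -> P f \/ P g.

Definition associated_prime (I P : {mpoly R[N]} -> Prop) : Prop :=
  prime_ideal P /\ exists f, forall g, P g <-> I (g * f).

End Ideals.

Section Hilbert.
Context {N : nat} {k : fieldType}.

Definition indep_mod (I : {mpoly k[N]} -> Prop) (m : nat)
    (s : seq {mpoly k[N]}) : Prop :=
  all (fun p => p \is m.-homog) s /\
  forall c : nat -> k, I (\sum_(i < size s) c i *: s`_i) ->
    forall i, (i < size s)%N -> c i = 0.

(* hilbert_value I m v  <->  v = h_I(m) = dim_k (k[x]/I)_m *)
Definition hilbert_value (I : {mpoly k[N]} -> Prop) (m v : nat) : Prop :=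
  (exists s, size s = v /\ indep_mod I m s) /\
  forall s, indep_mod I m s -> (size s <= v)%N.

Definition is_hilbert_poly (I : {mpoly k[N]} -> Prop) (P : {poly rat}) : Prop :=
  exists m0 : nat, forall m v : nat, (m0 <= m)%N -> hilbert_value I m v ->
    (v%:R : rat) = P.[m%:R].

End Hilbert.

Section Projective.
Context {N : nat} {K : fieldType}.
(* Points of P^{N-1}(K) are represented by nonzero vectors of K^N; all
   closed sets below are cones (zero sets of homogeneous polynomials), so
   this is the pull-back of the Zariski topology of projective space. *)
Definition pset := ('I_N -> K) -> Prop.

Definition nonzero_pt (x : 'I_N -> K) : Prop := exists i, x i != 0.

Definition psubset (C D : pset) : Prop := forall x, C x -> D x.

Definition proper_psubset (C D : pset) : Prop :=
  psubset C D /\ exists x, D x /\ ~ C x.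

Definition proj_closed (C : pset) : Prop :=
  exists J : {mpoly K[N]} -> Prop,
    (forall f, J f -> exists d : nat, f \is d.-homog) /\
    forall x, C x <-> (nonzero_pt x /\ forall f, J f -> f.@[x] = 0).

Definition irreducible_closed (C : pset) : Prop :=
  proj_closed C /\ (exists x, C x) /\
  forall C1 C2, proj_closed C1 -> proj_closed C2 ->
    psubset C (fun x => C1 x \/ C2 x) -> psubset C C1 \/ psubset C C2.

Definition irr_chain (X : pset) (Z : nat -> pset) (r : nat) : Prop :=
  (forall i, (i <= r)%N -> irreducible_closed (Z i) /\ psubset (Z i) X) /\
  (forall i, (i < r)%N -> proper_psubset (Z i) (Z i.+1)).

Definition top_dim (X : pset) (d : nat) : Prop :=
  (exists Z, irr_chain X Z d) /\ forall Z r, irr_chain X Z r -> (r <= d)%N.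

Definition irr_component (X C : pset) : Prop :=
  irreducible_closed C /\ psubset C X /\
  forall C', irreducible_closed C' -> psubset C C' -> psubset C' X -> psubset C' C.

Definition num_components (X : pset) (r : nat) : Prop :=
  exists Cs : nat -> pset,
    (forall i, (i < r)%N -> irr_component X (Cs i)) /\
    (forall i j, (i < r)%N -> (j < r)%N ->
        psubset (Cs i) (Cs j) -> psubset (Cs j) (Cs i) -> i = j) /\
    (forall C, irr_component X C ->
        exists i, (i < r)%N /\ psubset C (Cs i) /\ psubset (Cs i) C).

End Projective.

Section Varieties.
Context {N : nat} {k : fieldType} {K : fieldType} (iota : {rmorphism k -> K}).

Definition proj_zero_set (I : {mpoly k[N]} -> Prop) : @pset N K :=
  fun x => nonzero_pt x /\ forall f, I f -> (map_mpoly iota f).@[x] = 0.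

Definition ideal_dim (I : {mpoly k[N]} -> Prop) (e : int) : Prop :=
  (e = -1 /\ ~ exists x, proj_zero_set I x) \/
  (exists d : nat, e = d%:Z /\ top_dim (proj_zero_set I) d).

Definition unmixed (I : {mpoly k[N]} -> Prop) : Prop :=
  forall P Q e1 e2, associated_prime I P -> associated_prime I Q ->
    ideal_dim P e1 -> ideal_dim Q e2 -> e1 = e2.

Definition irr_num (I : {mpoly k[N]} -> Prop) (r : nat) : Prop :=
  num_components (proj_zero_set I) r.

End Varieties.

(* Main.v *)
(** For a prime Q over K of dimension d, with Noether parameters y_0, .., y_d and
    delta the rank of K[x]/Q over K[y], fix a generic point p of the chart
    y_0 = 1 of P^d and a point xi above it. The norm to K[y] of a form f of
    degree m has degree at most m delta. If the coordinates of f over K[y] vanish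
    at p to order m, and one more linear condition, coming from xi, holds on their
    terms of order m, then the norm vanishes at p to order more than m delta, so
    f lies in Q. Counting these conditions gives
    h_Q(m) <= (delta - 1) C(m+d-1, d) + C(m+d, d) <= delta m^d + d.

    As k is perfect, h_I is bounded by the Hilbert function of the vanishing
    ideal over K of V(I), hence by the sum of those of the components. Every
    component has dimension d because it contracts to an associated prime of I,
    and the leading coefficient of the Hilbert polynomial is at least the sum of
    the delta / d!, because forms separating the components embed the direct sum
    of their coordinate rings. *)

Require Import Defs.
From HB Require Import structures.
From mathcomp Require Import all_boot all_order all_algebra.
From mathcomp Require Import boolp classical_sets.
From mathcomp Require Import mpoly.
From mathcomp Require Import zify ring.
Set Implicit Arguments. Unset Strict Implicit. Unset Printing Implicit Defensive.
Import Order.TTheory GRing.Theory Num.Theory.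
Local Open Scope ring_scope.

(** * Ideals and vanishing ideals *)

(** The condition coming from xi suffices because evaluation at xi is a ring homomorphism: the
    values at xi of a basis of K[x]/Q over K[y] form a left eigenvector of every multiplication
    matrix at p. One equation per term of order m makes the leading matrix singular, where killing
    all coordinates would cost delta equations. The basis generates only after inverting some a, so
    the degree of the norm is controlled up to a constant; high powers of f absorb it. Dimension is
    defined by chains; it is compared with the number of Noether parameters through the growth of
    Hilbert functions. Unmixedness concerns primes over k, and the zero set of a contracted prime
    may have several components, so its dimension has to be passed on to each: variables independent
    over k stay independent modulo the component, because the extended prime has no torsion over
    their polynomial ring. Perfectness enters through a relation of minimal support among forms on
    V(I): it is unique up to scaling, hence the only point of a projective set defined over k, and
    such a point is rational over k. *)

Section IdealTheory.
Context {N : nat} {R : comNzRingType} (I : {mpoly R[N]} -> Prop).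
Hypothesis hI : is_ideal I.
Implicit Types f g : {mpoly R[N]}.

Lemma ideal0 : I 0. Proof. by case: hI. Qed.
Lemma idealD f g : I f -> I g -> I (f + g). Proof. by case: hI => _ [h _]; apply: h. Qed.
Lemma idealMl f g : I g -> I (f * g). Proof. by case: hI => _ [_ h]; apply: h. Qed.
Lemma idealMr f g : I f -> I (f * g). Proof. by rewrite mulrC; apply: idealMl. Qed.
Lemma idealN f : I f -> I (- f). Proof. by rewrite -mulN1r; apply: idealMl. Qed.
Lemma idealB f g : I f -> I g -> I (f - g). Proof. by move=> ? /idealN; apply: idealD. Qed.
Lemma idealBC f g : I (f - g) -> I (g - f). Proof. by move/idealN; rewrite opprB. Qed.
Lemma idealZ c f : I f -> I (c *: f).
Proof. by rewrite -mul_mpolyC; apply: idealMl. Qed.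
Lemma ideal_sum (T : Type) (r : seq T) (P : pred T) (F : T -> {mpoly R[N]}) :
  (forall i, P i -> I (F i)) -> I (\sum_(i <- r | P i) F i).
Proof. by move=> h; elim/big_ind: _ => //; [exact: ideal0|exact: idealD]. Qed.
Lemma ideal_trans f g h : I (f - g) -> I (g - h) -> I (f - h).
Proof. by move=> h1 h2; rewrite -(subrKA g); apply: idealD. Qed.
Lemma idealBl f g : I (f - g) -> I f -> I g.
Proof. by move=> /idealBC h1 h2; rewrite -(subrK f g); apply: idealD. Qed.
Lemma idealBr f g : I (f - g) -> I g -> I f.
Proof. by move=> h1 h2; rewrite -(subrK g f); apply: idealD. Qed.
Lemma ideal_congrM f f' g g' : I (f - f') -> I (g - g') -> I (f * g - f' * g').
Proof.
move=> h1 h2; have ->: f * g - f' * g' = (f - f') * g + f' * (g - g') by ring.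
by apply: idealD; [apply: idealMr|apply: idealMl].
Qed.
Lemma ideal_congrX f g e : I (f - g) -> I (f ^+ e - g ^+ e).
Proof. by move=> h; rewrite subrXX; apply: idealMr. Qed.

Lemma ideal_congr_mmap l (h h' : 'I_l -> {mpoly R[N]}) (p : {mpoly R[l]}) :
  (forall i, I (h i - h' i)) ->
  I (mmap (@mpolyC N R) h p - mmap (@mpolyC N R) h' p).
Proof.
move=> hh; rewrite /mmap -sumrB; apply: ideal_sum => m _; rewrite -mulrBr.
apply: idealMl; rewrite /mmap1.
pose P (u v : {mpoly R[N]}) := I (u - v).
apply: (big_ind2 P); rewrite /P; first by rewrite subrr; exact: ideal0.
- by move=> *; apply: ideal_congrM.
- by move=> i _; apply: ideal_congrX.
Qed.

End IdealTheory.

Section Homogeneous.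
Context {N : nat} {R : comNzRingType}.
Implicit Types f g : {mpoly R[N]}.

Lemma homog_partE d f : homog_part d f = pihomog mdeg d f.
Proof. by []. Qed.

Lemma mcoeff_homog_part d f m :
  (homog_part d f)@_m = if mdeg m == d then f@_m else 0.
Proof.
rewrite homog_partE (pihomogwE _ _ (leqnn _)) raddf_sum /=.
case: (boolP (m \in msupp f)) => mf.
  have hm := msize_mdeg_lt mf.
  case: eqP => [e|e].
    rewrite (bigD1 (BMultinom hm)) /= ?e // mcoeffZ mcoeffX eqxx mulr1.
    rewrite big1 ?addr0 // => m' /andP[_ ne]; rewrite mcoeffZ mcoeffX.
    case: eqP => [e'|]; last by rewrite mulr0.
    by case/negP: ne; apply/eqP/val_inj.
  rewrite big1 // => m' /eqP e'; rewrite mcoeffZ mcoeffX.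
  by case: eqP => [e''|]; [case: e; rewrite -e''|rewrite mulr0].
rewrite (memN_msupp_eq0 mf) if_same big1 // => m' _; rewrite mcoeffZ mcoeffX.
by case: eqP => [->|_]; [rewrite (memN_msupp_eq0 mf) mul0r|rewrite mulr0].
Qed.

Lemma homog_part_homog d f : homog_part d f \is d.-homog.
Proof. exact: pihomogP. Qed.

Lemma homog_part_id d f : f \is d.-homog -> homog_part d f = f.
Proof. exact: pihomog_dE. Qed.

Lemma homog_part_sum f k : (msize f <= k)%N -> f = \sum_(d < k) homog_part d f.
Proof. exact: pihomog_partitionE. Qed.

Lemma homog_partMl d e f g : f \is e.-homog -> homog_part (e + d) (f * g) = f * homog_part d g.
Proof.
move=> hf; rewrite [in LHS](homog_part_sum (leqnn (msize g))) mulr_sumr.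
rewrite homog_partE raddf_sum /=.
have h (i : nat) : pihomog mdeg (e + d) (f * homog_part i g) =
   if i == d then f * homog_part d g else 0.
  case: eqP => [->|/eqP ne].
    by rewrite pihomog_dE //; apply: dhomogM => //; exact: homog_part_homog.
  apply: (pihomog_ne0 (d := (e + i)%N)); first by rewrite eqn_add2l.
  by apply: dhomogM => //; exact: homog_part_homog.
rewrite (eq_bigr (fun i : 'I__ => if i == d :> nat then f * homog_part d g else 0)) => [|i _]; last exact: h.
rewrite -big_mkcond /=.
case: (ltnP d (msize g)) => hd; first by rewrite (big_pred1 (Ordinal hd)).
rewrite big1; last by move=> i /eqP e'; move: (ltn_ord i); rewrite e' ltnNge hd.
suff ->: homog_part d g = 0 by rewrite mulr0.
apply/mpolyP => m; rewrite mcoeff_homog_part mcoeff0; case: eqP => // e'.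
by apply: memN_msupp_eq0; apply: msize_mdeg_ge; rewrite e'.
Qed.

Lemma homogeneous_ideal_parts (I : {mpoly R[N]} -> Prop) f :
  homogeneous_ideal I -> (forall d, I (homog_part d f)) -> I f.
Proof.
move=> [hI _] h; rewrite (homog_part_sum (leqnn (msize f))).
exact: ideal_sum.
Qed.

Lemma meval_scale (x : 'I_N -> R) (c : R) d f :
  f \is d.-homog -> f.@[fun i => c * x i] = c ^+ d * f.@[x].
Proof.
move=> hf; rewrite !mevalE mulr_sumr big_seq [RHS]big_seq; apply: eq_bigr => m hm.
have <-: mdeg m = d by move/dhomogP: hf => /(_ m hm).
rewrite mulrCA; congr (_ * _); rewrite mdegE.
rewrite -prodrXr -big_split /=; apply: eq_bigr => i _.
by rewrite exprMn.
Qed.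
End Homogeneous.

(* The ideal is turned into a boolean predicate in order to use the quotient ring. *)
Lemma prime_ideal_field (F : fieldType) (N : nat) (P : {mpoly F[N]} -> Prop) :
  prime_ideal P -> exists (L : fieldType) (pi : {rmorphism {mpoly F[N]} -> L}),
    forall f, P f <-> pi f = 0.
Proof.
move=> [hI [h1 hM]].
pose S : pred {mpoly F[N]} := fun f => `[< P f >].
have clS : idealr_closed S.
  split; first by apply/asboolP; exact: ideal0.
    by apply/negP => /asboolP.
  move=> a u v /asboolP hu /asboolP hv; apply/asboolP.
  by apply: idealD => //; apply: idealMl.
have prS : prime_idealr_closed S.
  by move=> u v /asboolP /hM [h|h]; apply/orP; [left|right]; apply/asboolP.
pose i1 := isIdealr.Build _ S clS.
pose i2 := isPrimeIdealrClosed.Build _ S prS.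
pose SP : prime_idealr {mpoly F[N]} := HB.pack S i1 i2.
pose Q := {ideal_quot SP}.
have axQ : GRing.integral_domain_axiom Q by exact: Quotient.rquot_IdomainAxiom.
(* Units and inverses of the quotient are chosen classically: the field of fractions is formed over
   an integral domain with a unit structure. *)
pose U : pred Q := fun x => `[< exists y, y * x = 1 >].
pose V (x : Q) : Q := if pselect (exists y, y * x = 1) is left e then projT1 (cid e) else x.
have mulV : {in U, left_inverse 1 V *%R}.
  by move=> x /asboolP e; rewrite /V; case: pselect => // e'; case: cid.
have UP : forall x y : Q, y * x = 1 -> U x by move=> x y e; apply/asboolP; exists y.
have Vout : {in [predC U], V =1 id}.
  by move=> x /negP h; rewrite /V; case: pselect => // e; case: h; apply/asboolP.
pose j1 := GRing.ComNzRing_hasMulInverse.Build Q mulV UP Vout.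
pose QU : comUnitRingType := HB.pack Q j1.
pose j2 := GRing.ComUnitRing_isIntegral.Build QU axQ.
pose QD : idomainType := HB.pack Q j1 j2.
pose f1 : {rmorphism {mpoly F[N]} -> QD} := (\pi_Q)%qT.
exists {fraction QD}, (@fraction.FracField.tofrac QD \o f1) => f /=.
have -> : P f <-> f \in SP by split => [?|/asboolP //]; apply/asboolP.
rewrite -[f in f \in _]subr0 Quotient.idealrBE; split.
  move=> /eqP e.
  have -> : f1 f = 0 by rewrite -(rmorph0 f1).
  by rewrite rmorph0.
by move/eqP; rewrite fraction.tofrac_eq0 => /eqP e; rewrite /f1 /= in e; apply/eqP; rewrite e -(rmorph0 f1).
Qed.

(** Were [p] zero everywhere, p X + 1 would be a nonconstant polynomial without a root. *)
Lemma closed_poly_nonroot (K : closedFieldType) (p : {poly K}) :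
  p != 0 -> exists x, p.[x] != 0.
Proof.
move=> p0; apply: contrapT => h.
have hx x : p.[x] = 0 by apply/eqP; apply: contra_notT h => ?; exists x.
have sz : size (p * 'X + 1%:P) != 1%N.
  by rewrite size_MXaddC (negbTE p0) /= eqSS size_poly_eq0.
have /closed_rootP [x] := sz.
by rewrite /root !hornerE hx mul0r add0r oner_eq0.
Qed.

Lemma expansion_inj D n (a b : 'I_n -> nat) :
  (forall i, a i < D)%N -> (forall i, b i < D)%N ->
  (\sum_i a i * D ^ i = \sum_i b i * D ^ i)%N -> a =1 b.
Proof.
elim: n a b => [|n IH] a b ha hb; first by move=> _ [].
rewrite !big_ord_recl /= !expn0 !muln1.
have h (c : 'I_n.+1 -> nat) : (\sum_(i < n) c (lift ord0 i) * D ^ (lift ord0 i) =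
   (\sum_(i < n) c (lift ord0 i) * D ^ i) * D)%N.
  by rewrite big_distrl /=; apply: eq_bigr => i _; rewrite /bump /= add1n expnSr mulnA.
rewrite !h => e.
have D0 : (0 < D)%N by apply: leq_trans (ha ord0).
have e0 : a ord0 = b ord0.
  by move/(congr1 (modn^~ D)): e; rewrite (addnC (a ord0)) (addnC (b ord0)) !modnMDl !modn_small.
move: e; rewrite e0 => /addnI /eqP; rewrite eqn_pmul2r // => /eqP /IH e1 i.
case: (unliftP ord0 i) => [j|] -> //; exact: e1.
Qed.

(** All exponents in [p] are below [msize p], so their expansions in that base keep distinct
    monomials apart. *)
Lemma kronecker_neq0 (F : fieldType) n (p : {mpoly F[n]}) : p != 0 ->
  mmap polyC (fun i : 'I_n => 'X^(msize p ^ i)) p != 0 :> {poly F}.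
Proof.
move=> p0; have hm := mlead_supp p0; set m0 := mlead p in hm.
apply/eqP => /(congr1 (fun q : {poly F} => q`_(\sum_i m0 i * msize p ^ i)%N)).
rewrite coef0 /mmap coef_sum (bigD1_seq m0) //= ?msupp_uniq //.
have e m : (p@_m)%:P * mmap1 (fun i : 'I_n => 'X^(msize p ^ i)) m
   = p@_m *: 'X^(\sum_i m i * msize p ^ i).
  rewrite mul_polyC /mmap1; congr (_ *: _).
  rewrite -prodrXr; apply: eq_bigr => i _; by rewrite -exprM mulnC.
rewrite e coefZ coefXn eqxx mulr1 big_seq_cond big1 => [|m /andP[hs hne]].
  by rewrite addr0 => /eqP; apply/negP; rewrite -mcoeff_msupp.
rewrite e coefZ coefXn; case: eqP; last by rewrite mulr0.
have hlt m' i : m' \in msupp p -> (m' i < msize p)%N.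
  move=> h'; apply: leq_ltn_trans (msize_mdeg_lt h').
  by rewrite mdegE (bigD1 i) //= leq_addr.
move=> /(expansion_inj (fun i => hlt _ i hm) (fun i => hlt _ i hs)) e'.
by case/eqP: hne; apply/mnmP => i; rewrite e'.
Qed.

Lemma mpoly_nonroot (K : closedFieldType) n (p : {mpoly K[n]}) :
  p != 0 -> exists x, p.@[x] != 0.
Proof.
move=> /kronecker_neq0 /closed_poly_nonroot [x hx].
exists (fun i => x ^+ (msize p ^ i)); move: hx; rewrite mevalE /mmap horner_sum.
congr (_ != 0); apply: eq_bigr => m _; rewrite hornerM hornerC; congr (_ * _).
rewrite /mmap1 horner_prod; apply: eq_bigr => i _.
by rewrite horner_exp hornerXn.
Qed.

Lemma mpoly_nonroot2 (K : closedFieldType) n (p q : {mpoly K[n]}) :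
  p != 0 -> q != 0 -> exists x, p.@[x] != 0 /\ q.@[x] != 0.
Proof.
move=> p0 q0; have /mpoly_nonroot [x] : p * q != 0 by rewrite mulf_neq0.
by rewrite mevalM mulf_eq0 negb_or => /andP [? ?]; exists x.
Qed.

(** Krull's argument with Zorn's lemma: an ideal maximal among those containing [J] and missing [S]
    is prime. *)
Lemma exists_prime_avoiding (F : fieldType) N (J S : {mpoly F[N]} -> Prop) :
  is_ideal J -> S 1 -> (forall f g, S f -> S g -> S (f * g)) ->
  (forall f, J f -> ~ S f) ->
  exists P, [/\ prime_ideal P, forall f, J f -> P f & forall f, P f -> ~ S f].
Proof.
move=> hJ S1 SM JS.
pose good (I : {mpoly F[N]} -> Prop) :=
  [/\ is_ideal I, forall f, J f -> I f & forall f, I f -> ~ S f].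
pose T := {I | good I}.
pose R (A B : T) := `[< forall f, sval A f -> sval B f >].
have gJ : good J by split.
have [||| |[P gP] maxP] := @Zorn T R.
- by move=> t; apply/asboolP.
- by move=> r s t /asboolP h1 /asboolP h2; apply/asboolP => f /h1 /h2.
- move=> [A gA] [B gB] /asboolP h1 /asboolP h2.
  have e : A = B by apply: funext => f; apply: propext; split; [exact: h1|exact: h2].
  by subst B; congr exist; apply: Prop_irrelevance.
- move=> A totA; case: (pselect (exists t, A t)) => [[t0 At0]|nA]; last first.
    by exists (exist _ J gJ) => s As; case: nA; exists s.
  pose U f := exists2 t, A t & sval t f.
  have gU : good U.
    split.
    - split; [|split].
      + by exists t0 => //; case: (svalP t0) => h _ _; apply: ideal0.
      + move=> f g [t At tf] [s As sg].
        have [/asboolP h|/asboolP h] := totA _ _ At As.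
          by exists s => //; case: (svalP s) => hs _ _; apply: idealD => //; apply: h.
        by exists t => //; case: (svalP t) => hs _ _; apply: idealD => //; apply: h.
      + by move=> f g [t At tg]; exists t => //; case: (svalP t) => hs _ _; apply: idealMl.
    - by move=> f Jf; exists t0 => //; case: (svalP t0) => _ h _; apply: h.
    - by move=> f [t _ tf]; case: (svalP t) => _ _ h; apply: h.
  by exists (exist _ U gU) => s As; apply/asboolP => f sf; exists s.
exists P; case: (gP) => hP JP PS; split => //; split => //; split.
  by move=> /PS; apply.
(* By maximality, adding an element outside [P] produces an ideal that meets [S]. If two such
   elements had their product in [P], the product of the two resulting elements of [S] would lie in
   [P]. *)
have ext f : ~ P f -> exists p u, P p /\ S (p + u * f).
  move=> Pf; apply: contrapT => nS.
  pose Q g := exists p u, P p /\ g = p + u * f.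
  have gQ : good Q.
    split.
    - split; [|split].
      + by exists 0, 0; rewrite mul0r addr0; split => //; apply: ideal0.
      + move=> _ _ [p [u [Pp ->]]] [p' [u' [Pp' ->]]]; exists (p + p'), (u + u').
        by split; [apply: idealD|ring].
      + move=> g _ [p [u [Pp ->]]]; exists (g * p), (g * u).
        by split; [apply: idealMl|ring].
    - by move=> g /JP Pg; exists g, 0; rewrite mul0r addr0.
    - by move=> _ [p [u [Pp ->]]] Sg; apply: nS; exists p, u.
  have /maxP [e] : R (exist _ P gP) (exist _ Q gQ).
    by apply/asboolP => g /= Pg; exists g, 0; rewrite mul0r addr0.
  apply: Pf; rewrite -e; exists 0, 1; split; last by rewrite mul1r add0r.
  exact: ideal0.
move=> f g Pfg; apply: contrapT => /not_orP [/ext [p [u [Pp Sp]]] /ext [q [v [Pq Sq]]]].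
apply: (PS _ _ (SM _ _ Sp Sq)).
have -> : (p + u * f) * (q + v * g) = p * (q + v * g) + ((u * f) * q + u * v * (f * g)) by ring.
apply: idealD => //; first exact: idealMr.
by apply: idealD => //; apply: idealMl.
Qed.

(** For an ideal [P] this is the ideal generated by its homogeneous elements. It turns the primes
    supplied by Zorn's lemma into homogeneous ones. *)
Definition homog_core (R : comNzRingType) N (P : {mpoly R[N]} -> Prop) (f : {mpoly R[N]}) :=
  forall d, P (homog_part d f).

(* Setting [x_i -> x_i T] in the quotient by P turns membership in the
   homogeneous core of P into vanishing in a polynomial ring over a field. *)
Lemma homog_core_prime (F : fieldType) N (P : {mpoly F[N]} -> Prop) :
  prime_ideal P -> homogeneous_ideal (homog_core P) /\ prime_ideal (homog_core P).
Proof.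
move=> hP; case: (hP) => [idP [P1 _]].
have [L [pi kerpi]] := prime_ideal_field hP.
pose theta := mmap (polyC \o pi \o @mpolyC N F) (fun i : 'I_N => (pi 'X_i) *: ('X : {poly L})).
have coefE f d : (theta f)`_d = pi (homog_part d f).
  rewrite /theta /mmap /homog_part coef_sum rmorph_sum [RHS]big_mkcond /=.
  apply: eq_bigr => m _.
  have -> : mmap1 (fun i : 'I_N => (pi 'X_i) *: ('X : {poly L})) m = (pi 'X_[m]) *: 'X^(mdeg m).
    rewrite /mmap1 (eq_bigr (fun i : 'I_N => (pi 'X_i ^+ m i) *: 'X^(m i))) => [|i _]; last by rewrite exprZn.
    rewrite scaler_prod prodrXr -mdegE [in RHS]mpolyXE_id rmorph_prod.
    by congr (_ *: _); apply: eq_bigr => i _; rewrite rmorphXn.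
  rewrite mul_polyC scalerA coefZ coefXn -mul_mpolyC rmorphM.
  by rewrite eq_sym; case: eqP; rewrite ?mulr1 ?mulr0.
have ker f : homog_core P f <-> theta f = 0.
  split => [h|h d]; last by apply/kerpi; rewrite -coefE h coef0.
  by apply/polyP => d; rewrite coefE coef0; apply/kerpi/h.
have idC : is_ideal (homog_core P).
  split; [|split].
  - by apply/ker; rewrite /theta rmorph0.
  - by move=> f g /ker hf /ker hg; apply/ker; rewrite /theta rmorphD /= -/(theta f) -/(theta g) hf hg addr0.
  - by move=> f g /ker hg; apply/ker; rewrite /theta rmorphM /= -/(theta f) -/(theta g) hg mulr0.
split; split => //.
  move=> f d hf e; rewrite /homog_core; case: (eqVneq d e) => [<-|ne].
    by rewrite homog_part_id ?homog_part_homog.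
  suff -> : homog_part e (homog_part d f) = 0 by apply: ideal0.
  by apply: (pihomog_ne0 ne); exact: homog_part_homog.
split; first by move=> /(_ 0%N); rewrite homog_part_id // dhomog1.
move=> f g /ker; rewrite /theta rmorphM /= => /eqP; rewrite mulf_eq0.
by case/orP => /eqP h; [left|right]; apply/ker.
Qed.

Lemma homog_core_sub (R : comNzRingType) N (P : {mpoly R[N]} -> Prop) f :
  is_ideal P -> homog_core P f -> P f.
Proof.
by move=> hP h; rewrite (homog_part_sum (leqnn (msize f))); apply: ideal_sum.
Qed.

Lemma sub_homog_core (R : comNzRingType) N (J P : {mpoly R[N]} -> Prop) :
  homogeneous_ideal J -> (forall f, J f -> P f) -> forall f, J f -> homog_core P f.
Proof. by move=> [_ hJ] JP f Jf d; apply/JP/hJ. Qed.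

(** * Vanishing ideals of projective sets *)

Section VanishingIdeal.
Context {N : nat} {K : closedFieldType}.
Implicit Types (Z C : @pset N K) (f g : {mpoly K[N]}).

Definition vI Z f := forall x, Z x -> f.@[x] = 0.

Definition cone Z := forall x c, c != 0 -> Z x -> Z (fun i => c * x i).

(** Restriction to lines through the origin reduces statements about cones to polynomials in one
    variable. *)
Lemma meval_line f x : exists q : {poly K},
  (forall c, q.[c] = f.@[fun i => c * x i]) /\ forall d, q`_d = (homog_part d f).@[x].
Proof.
exists (\poly_(d < msize f) (homog_part d f).@[x]); split => [c|d].
  rewrite horner_poly [in RHS](homog_part_sum (leqnn (msize f))) raddf_sum /=.
  by apply: eq_bigr => i _; rewrite (meval_scale _ _ (homog_part_homog _ _)) mulrC.
rewrite coef_poly; case: ltnP => // hd.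
suff -> : homog_part d f = 0 by rewrite meval0.
apply/mpolyP => m; rewrite mcoeff_homog_part mcoeff0; case: eqP => // e.
by apply: memN_msupp_eq0; apply: msize_mdeg_ge; rewrite e.
Qed.

Lemma meval_line_eq0 f x : (forall c, c != 0 -> f.@[fun i => c * x i] = 0) ->
  forall d, (homog_part d f).@[x] = 0.
Proof.
move=> h d; have [q [hq <-]] := meval_line f x.
(* The factor ['X] covers [c = 0], where the hypothesis says nothing. *)
suff /eqP : q * 'X = 0 by rewrite mulf_eq0 polyX_eq0 orbF => /eqP ->; rewrite coef0.
apply: contrapT => /eqP /closed_poly_nonroot [c]; rewrite hornerM hornerX.
case: (eqVneq c 0) => [->|c0]; first by rewrite mulr0 eqxx.
by rewrite hq h // mul0r eqxx.
Qed.

Lemma vI_ideal Z : is_ideal (vI Z).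
Proof.
split; [|split]; first by move=> x _; rewrite meval0.
  by move=> f g hf hg x Zx; rewrite mevalD hf // hg // addr0.
by move=> f g hg x Zx; rewrite mevalM hg // mulr0.
Qed.

Lemma vI_homog Z : cone Z -> homogeneous_ideal (vI Z).
Proof.
move=> cZ; split; first exact: vI_ideal.
by move=> f d hf x Zx; apply: meval_line_eq0 => c c0; apply/hf/cZ.
Qed.

Lemma closed_cone Z : proj_closed Z -> cone Z.
Proof.
move=> [J [hJ hZ]] x c c0 /hZ [[i xi] hx]; apply/hZ; split.
  by exists i; rewrite mulf_neq0.
move=> f Jf; have [d hd] := hJ _ Jf.
by rewrite (meval_scale _ _ hd) hx // mulr0.
Qed.

Lemma closed_nonzero Z x : proj_closed Z -> Z x -> nonzero_pt x.
Proof. by move=> [J [_ hZ]] /hZ []. Qed.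

Definition vanishing_set (J : {mpoly K[N]} -> Prop) : @pset N K :=
  fun x => nonzero_pt x /\ forall f, J f -> f.@[x] = 0.

Lemma vanishing_set_closed J : homogeneous_ideal J -> proj_closed (vanishing_set J).
Proof.
move=> hJ; exists (fun f => J f /\ exists d : nat, f \is d.-homog); split; first by move=> f [].
move=> x; split => [[nx hx]|[nx hx]]; split => // f.
  by move=> [Jf _]; apply: hx.
move=> Jf; rewrite (homog_part_sum (leqnn (msize f))) raddf_sum big1 //= => d _.
apply: hx; split; first by apply: hJ.2.
by exists d; apply: homog_part_homog.
Qed.

Lemma closed_vanishing Z x : proj_closed Z -> vanishing_set (vI Z) x -> Z x.
Proof.
move=> [J [hJ hZ]] [nx hx]; apply/hZ; split => // f Jf; apply: hx => y /hZ [_]; exact.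
Qed.

(** [f] and [g] need not be homogeneous, while irreducibility speaks of cones, so each is replaced
    by the cone where all its homogeneous parts vanish. On the line through a point of [Z] the
    product of the two restrictions is zero, hence one of them is. *)
Lemma vI_prime Z : irreducible_closed Z -> prime_ideal (vI Z).
Proof.
move=> [cZ [[x0 Zx0] irr]]; split; first exact: vI_ideal; split.
  by move=> /(_ _ Zx0); rewrite meval1 => /eqP; rewrite oner_eq0.
move=> f g hfg; have coneZ := closed_cone cZ.
pose C h : @pset N K := fun x => nonzero_pt x /\ forall d, (homog_part d h).@[x] = 0.
have clC h : proj_closed (C h).
  exists (fun u => exists d, u = homog_part d h); split.
    by move=> _ [d ->]; exists d; apply: homog_part_homog.
  move=> x; split => [[nx hx]|[nx hx]]; split => //; first by move=> _ [d ->].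
  by move=> d; apply: hx; exists d.
have [] := irr _ _ (clC f) (clC g).
- move=> x Zx; have nx := closed_nonzero cZ Zx.
  have [p [hp pc]] := meval_line f x; have [q [hq qc]] := meval_line g x.
  have /eqP : p * q = 0.
    have /eqP : p * q * 'X = 0.
      apply: contrapT => /eqP /closed_poly_nonroot [c]; rewrite !hornerM hornerX.
      case: (eqVneq c 0) => [->|c0]; first by rewrite mulr0 eqxx.
      by rewrite hp hq -mevalM hfg ?mul0r ?eqxx //; apply: coneZ.
    by rewrite mulf_eq0 polyX_eq0 orbF => /eqP.
  rewrite mulf_eq0 => /orP [/eqP e|/eqP e]; [left|right]; split => // d.
    by rewrite -pc e coef0.
  by rewrite -qc e coef0.
- move=> h; left => x /h [_ hx]; rewrite (homog_part_sum (leqnn (msize f))).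
  by rewrite raddf_sum big1 //= => d _; apply: hx.
- move=> h; right => x /h [_ hx]; rewrite (homog_part_sum (leqnn (msize g))).
  by rewrite raddf_sum big1 //= => d _; apply: hx.
Qed.

End VanishingIdeal.

(** * Noether normalization *)

Definition subst (R : comNzRingType) N l (y : 'I_l -> {mpoly R[N]}) (p : {mpoly R[l]}) :
    {mpoly R[N]} :=
  mmap (@mpolyC N R) y p.

Definition alg_indep_mod (R : comNzRingType) N l (Q : {mpoly R[N]} -> Prop)
    (y : 'I_l -> {mpoly R[N]}) :=
  forall p, Q (subst y p) -> p = 0.

Section NoetherNormalization.
Context {N : nat} {K : closedFieldType}.
Implicit Types (f g : {mpoly K[N]}) (Q : {mpoly K[N]} -> Prop).

Lemma subst_homog l (y : 'I_l -> {mpoly K[N]}) e p :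
  (forall i, y i \is 1.-homog) -> p \is e.-homog -> subst y p \is e.-homog.
Proof.
move=> hy hp; rewrite /subst /mmap big_seq; apply: rpred_sum => m hm.
rewrite mul_mpolyC; apply: dhomogZ.
have <-: mdeg m = e by move/dhomogP: hp => /(_ m hm).
rewrite /mmap1 mdegE.
apply: (big_ind2 (fun (u : {mpoly K[N]}) (k : nat) => u \is k.-homog)).
- exact: dhomog1.
- by move=> *; apply: dhomogM.
- by move=> i _; have := dhomogMn (m i) (hy i); rewrite mul1n.
Qed.

Lemma homog_part_subst l (y : 'I_l -> {mpoly K[N]}) e p :
  (forall i, y i \is 1.-homog) -> homog_part e (subst y p) = subst y (homog_part e p).
Proof.
move=> hy; rewrite [in LHS](homog_part_sum (leqnn (msize p))) /subst rmorph_sum /=.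
rewrite homog_partE raddf_sum /=.
have h (i : nat) : pihomog mdeg e (mmap (@mpolyC N K) y (homog_part i p)) =
   if i == e then subst y (homog_part e p) else 0.
  have hh := subst_homog hy (homog_part_homog i p).
  by case: eqP => [<-|/eqP ne]; [rewrite pihomog_dE|rewrite (pihomog_ne0 ne)].
rewrite (eq_bigr (fun i : 'I__ => if i == e :> nat then subst y (homog_part e p) else 0)) => [|i _]; last exact: h.
rewrite -big_mkcond /=; case: (ltnP e (msize p)) => hd; first by rewrite (big_pred1 (Ordinal hd)).
rewrite big1; last by move=> i /eqP e'; move: (ltn_ord i); rewrite e' ltnNge hd.
suff ->: homog_part e p = 0 by rewrite mmap0.
apply/mpolyP => m; rewrite mcoeff_homog_part mcoeff0; case: eqP => // e'.
by apply: memN_msupp_eq0; apply: msize_mdeg_ge; rewrite e'.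
Qed.

Definition add_ideal Q l (y : 'I_l -> {mpoly K[N]}) f :=
  exists g : 'I_l -> {mpoly K[N]}, Q (f - \sum_i g i * y i).

Lemma add_ideal_ideal Q l (y : 'I_l -> {mpoly K[N]}) : is_ideal Q -> is_ideal (add_ideal Q y).
Proof.
move=> hQ; split; [|split].
- by exists (fun=> 0); rewrite big1 ?subr0 => [|i _]; [exact: ideal0|rewrite mul0r].
- move=> f g [u hu] [v hv]; exists (fun i => u i + v i).
  under eq_bigr do rewrite mulrDl.
  by rewrite big_split /= opprD addrACA; apply: idealD.
- move=> f g [u hu]; exists (fun i => f * u i).
  under eq_bigr do rewrite -mulrA.
  by rewrite -mulr_sumr -mulrBr; apply: idealMl.
Qed.

Lemma add_idealQ Q l (y : 'I_l -> {mpoly K[N]}) f : Q f -> add_ideal Q y f.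
Proof. by move=> h; exists (fun=> 0); rewrite big1 ?subr0 // => i _; rewrite mul0r. Qed.

Lemma add_ideal_gen Q l (y : 'I_l -> {mpoly K[N]}) i : is_ideal Q -> add_ideal Q y (y i).
Proof.
move=> hQ; exists (fun j => (j == i)%:R); rewrite (bigD1 i) //= eqxx mul1r big1 ?addr0.
  by rewrite subrr; exact: ideal0.
by move=> j /negbTE ->; rewrite mul0r.
Qed.

(** For homogeneous [Q] and linear forms [y] this says that K[x]/Q is a finite module over K[y]: by
    the graded Nakayama lemma it is enough that K[x]/(Q, y) has finite dimension. *)
Definition integral_mod Q l (y : 'I_l -> {mpoly K[N]}) :=
  forall i, exists D : nat, add_ideal Q y ('X_i ^+ D).

Definition noether_params Q l (y : 'I_l -> {mpoly K[N]}) :=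
  [/\ forall i, y i \is 1.-homog, integral_mod Q y & alg_indep_mod Q y].

Lemma noether_step Q l (y : 'I_l.+1 -> {mpoly K[N]}) p :
  homogeneous_ideal Q -> (forall i, y i \is 1.-homog) -> integral_mod Q y ->
  p != 0 -> Q (subst y p) ->
  exists y' : 'I_l -> {mpoly K[N]}, (forall i, y' i \is 1.-homog) /\ integral_mod Q y'.
Proof.
move=> [hQ hQh] hy fin p0 Qp.
have [e pe0] : exists e, homog_part e p != 0.
  apply: contrapT => h; case/eqP: p0; rewrite (homog_part_sum (leqnn (msize p))).
  by rewrite big1 // => i _; apply: contrapT => /eqP ne; apply: h; exists i.
move: (hQh _ e Qp); rewrite homog_part_subst // => Qpe.
(* A nonzero last coordinate of the point can be scaled to 1, which makes the last of the forms y_i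
   - c_i z zero. *)
have X0 : 'X_ord_max != 0 :> {mpoly K[l.+1]} by rewrite -msize_poly_eq0 msizeX.
have [c0 [pc0]] := mpoly_nonroot2 pe0 X0; rewrite mevalXU => cl.
pose c i := (c0 ord_max)^-1 * c0 i.
have cmax : c ord_max = 1 by rewrite /c mulVf.
have pc : (homog_part e p).@[c] != 0.
  by rewrite (meval_scale _ _ (homog_part_homog _ _)) mulf_neq0 // expf_neq0 // invr_eq0.
set z := y ord_max.
pose y' (i : 'I_l) := y (lift ord_max i) - c (lift ord_max i) *: z.
have hy' i : y' i \is 1.-homog by rewrite /y' rpredB ?hy // dhomogZ ?hy.
exists y'; split => //.
pose B := add_ideal Q y'; have hB : is_ideal B := add_ideal_ideal y' hQ.
have yz i : B (y i - c i *: z).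
  case: (unliftP ord_max i) => [j|] ->; first exact: add_ideal_gen.
  by rewrite cmax scale1r subrr; apply: ideal0.
have Bze : B (z ^+ e).
  have : B ((homog_part e p).@[c] *: z ^+ e).
    have -> : (homog_part e p).@[c] *: z ^+ e = subst (fun i => c i *: z) (homog_part e p).
      rewrite /subst mevalE scaler_suml /mmap big_seq [RHS]big_seq; apply: eq_bigr => m hm.
      rewrite mul_mpolyC -scalerA; congr (_ *: _); rewrite /mmap1.
      under [in RHS]eq_bigr do rewrite exprZn.
      rewrite scaler_prod prodrXr -mdegE.
      by have -> : mdeg m = e by move/dhomogP: (homog_part_homog e p) => /(_ m hm).
    apply: (idealBl hB _ (add_idealQ y' Qpe)).
    exact: ideal_congr_mmap.
  move/(idealZ hB ((homog_part e p).@[c])^-1).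
  by rewrite scalerA mulVf // scale1r.
(* X_i^D is a multiple of z modulo [B], and z^e lies in [B]. *)
move=> i; have [D [g hg]] := fin i; exists (D * e)%N; rewrite exprM.
have h1 : B ('X_i ^+ D - (\sum_j c j *: g j) * z).
  apply: (ideal_trans hB (add_idealQ y' hg)).
  rewrite mulr_suml -sumrB; apply: (ideal_sum hB) => j _.
  have -> : g j * y j - (c j *: g j) * z = g j * (y j - c j *: z).
    by rewrite -!mul_mpolyC; ring.
  exact: idealMl.
apply: (idealBr hB (ideal_congrX hB e h1)).
by rewrite exprMn; apply: idealMl.
Qed.

Lemma noether_normalization Q : homogeneous_ideal Q -> ~ Q 1 ->
  exists l (y : 'I_l -> {mpoly K[N]}), noether_params Q y.
Proof.
move=> hQ Q1.
suff h l (y : 'I_l -> {mpoly K[N]}) : (forall i, y i \is 1.-homog) -> integral_mod Q y ->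
    exists l (y : 'I_l -> {mpoly K[N]}), noether_params Q y.
  apply: (h N (fun i => 'X_i)); first by move=> i; rewrite dhomogX /= mdeg1.
  by move=> i; exists 1%N; rewrite expr1; apply: add_ideal_gen; case: hQ.
elim: l y => [|l IH] y hy fin.
  exists 0%N, y; split => // p; rewrite (nvar0_mpolyC p) /subst mmapC => Qp.
  case: (eqVneq p@_0 0) => [->|p0]; first by rewrite mpolyC0.
  case: Q1; have := idealZ hQ.1 (p@_0)^-1 Qp.
  by rewrite -mul_mpolyC -mpolyCM mulVf // mpolyC1.
case: (pselect (alg_indep_mod Q y)) => [ind|]; first by exists l.+1, y.
move=> /existsNP [p /not_implyP [Qp /eqP p0]].
have [y' [hy' fin']] := noether_step hQ hy fin p0 Qp.
exact: IH hy' fin'.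
Qed.

(** Graded Nakayama lemma: a form of large degree is a combination of the y_i modulo [Q], with forms
    of smaller degree as coefficients. The bound on the degree of [alpha] is what later controls the
    degree of the norm. *)
Lemma module_generators Q l (y : 'I_l -> {mpoly K[N]}) :
  homogeneous_ideal Q -> (forall i, y i \is 1.-homog) -> integral_mod Q y ->
  exists D : nat, forall m f, f \is m.-homog ->
    exists alpha : 'X_{1..N < D} -> {mpoly K[l]},
      (forall b, msize (alpha b) <= m.+1)%N /\
      Q (f - \sum_b subst y (alpha b) * 'X_[b]).
Proof.
move=> [hQ hQh] hy /choice [D0 hD0]; exists (\sum_i D0 i).+1; set D := (\sum_i D0 i).+1.
have hB := add_ideal_ideal y hQ.
have big m f : f \is m.-homog -> (D <= m)%N -> add_ideal Q y f.
  move=> /dhomogP hf Dm; rewrite [f]mpolyE big_seq; apply: (ideal_sum hB) => b /hf hb.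
  apply: idealZ => //.
  have [i hi] : exists i, (D0 i <= b i)%N.
    apply: contrapT => h; move: Dm; rewrite -hb /= mdegE ltnNge => /negP; apply.
    apply: leq_sum => i _; rewrite leqNgt; apply/negP => hi.
    by apply: h; exists i; exact: ltnW.
  have -> : b = (U_(i) *+ D0 i + (b - U_(i) *+ D0 i))%MM.
    apply/mnmP => j; rewrite mnmDE mnmBE mulmnE mnm1E.
    by case: eqP => [<-|]; rewrite ?mul1n ?mul0n ?add0n ?subn0 // subnKC.
  by rewrite mpolyXD -mpolyXn; apply: (idealMr hB).
have small m f : f \is m.-homog -> (m < D)%N -> exists alpha : 'X_{1..N < D} -> {mpoly K[l]},
    (forall b, msize (alpha b) <= m.+1)%N /\ Q (f - \sum_b subst y (alpha b) * 'X_[b]).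
  move=> hf mD; exists (fun b => (f@_b)%:MP); split; first by move=> b; rewrite msizeC; case: eqP.
  have {1}-> : f = \sum_(b : 'X_{1..N < D}) f@_b *: 'X_[b].
    apply: mpolywE; rewrite msizeE; apply/bigmax_leqP_seq => b hb _.
    by move/dhomogP: hf => /(_ _ hb) /= ->.
  rewrite -sumrB; apply: (ideal_sum hQ) => b _.
  by rewrite /subst mmapC mul_mpolyC subrr; exact: ideal0.
elim => [|m IH] f hf; first exact: small.
case: (ltnP m.+1 D) => hm; first exact: small.
have [g hg] := big _ _ hf hm.
(* Only the part of degree m + 1 of the relation is kept, so that the coefficients become forms of
   degree m. *)
have {}hg : Q (f - \sum_i y i * homog_part m (g i)).
  have e : homog_part m.+1 (f - \sum_i g i * y i) = f - \sum_i y i * homog_part m (g i).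
    rewrite homog_partE pihomogD pihomogN (pihomog_dE hf) (raddf_sum (pihomog mdeg m.+1)) /=.
    congr (f - _); apply: eq_bigr => i _.
    by rewrite mulrC -homog_partE -(homog_partMl _ _ (hy i)).
  by rewrite -e; apply: hQh.
have /choice [al hal] i := IH _ (homog_part_homog m (g i)).
exists (fun b => \sum_i 'X_i * al i b); split.
  move=> b; apply: leq_trans (msize_sum _ _ _) _; apply/bigmax_leqP => i _.
  case: (eqVneq (al i b) 0) => [->|n0]; first by rewrite mulr0 msize0.
  by rewrite msizeM ?msizeX ?mdeg1 // -?msize_poly_eq0 ?msizeX //= ltnS (hal i).1.
apply: (ideal_trans hQ hg).
have -> : \sum_b subst y (\sum_i 'X_i * al i b) * 'X_[b] =
    \sum_i y i * (\sum_b subst y (al i b) * 'X_[b]).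
  under eq_bigr do rewrite /subst rmorph_sum /= mulr_suml.
  rewrite exchange_big /=; apply: eq_bigr => i _; rewrite mulr_sumr; apply: eq_bigr => b _.
  by rewrite rmorphM /= mmapX mmap1U mulrA.
rewrite -sumrB; apply: (ideal_sum hQ) => i _; rewrite -mulrBr.
by apply: idealMl => //; case: (hal i).
Qed.

End NoetherNormalization.

(** * Substitution, homogenization and the affine chart *)

Lemma rmorph_mmap n (R S T : comNzRingType) (f : {rmorphism R -> S}) (h : 'I_n -> S)
    (g : {rmorphism S -> T}) p :
  g (mmap f h p) = mmap (g \o f) (g \o h) p.
Proof.
rewrite /mmap rmorph_sum; apply: eq_bigr => m _; rewrite rmorphM; congr (_ * _).
by rewrite /mmap1 rmorph_prod; apply: eq_bigr => i _; rewrite rmorphXn.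
Qed.

Lemma eq_mmap n (R S : nzRingType) (f f' : R -> S) (h h' : 'I_n -> S) p :
  f =1 f' -> h =1 h' -> mmap f h p = mmap f' h' p.
Proof.
move=> ef eh; rewrite /mmap; apply: eq_bigr => m _; rewrite ef; congr (_ * _).
exact: mmap1_eq.
Qed.

Lemma mmap_mpolyX n (R : comNzRingType) (p : {mpoly R[n]}) :
  mmap (@mpolyC n R) (fun i => 'X_i) p = p.
Proof.
rewrite [RHS]mpolyE; apply: eq_bigr => m _; rewrite mul_mpolyC mmap1_id //.
Qed.

Lemma rmorph_mpolyE n (R S : comNzRingType) (g : {rmorphism {mpoly R[n]} -> S}) p :
  g p = mmap (g \o @mpolyC n R) (fun i => g 'X_i) p.
Proof. by rewrite -{1}(mmap_mpolyX p) rmorph_mmap. Qed.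

Lemma subst_const (K : closedFieldType) N l (c : 'I_l -> K) (p : {mpoly K[l]}) :
  subst (fun i => (c i)%:MP_[N]) p = (p.@[c])%:MP.
Proof. by rewrite /subst /meval rmorph_mmap; apply: eq_mmap. Qed.

Lemma meval_subst (K : closedFieldType) N l (y : 'I_l -> {mpoly K[N]}) p x :
  (subst y p).@[x] = p.@[fun i => (y i).@[x]].
Proof.
by rewrite /subst rmorph_mmap; apply: eq_mmap => // c /=; rewrite mevalC.
Qed.

(** The target degree [msize p] is one more than the degree of a nonzero [p]; the surplus factor X_0
    is harmless because X_0 is set to 1 in the end. *)
Definition homogenize (K : closedFieldType) d (p : {mpoly K[d]}) : {mpoly K[d.+1]} :=
  \sum_(m <- msupp p) p@_m *: ('X_ord0 ^+ (msize p - mdeg m) * \prod_i 'X_(lift ord0 i) ^+ m i).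

Lemma homogenize_homog (K : closedFieldType) d (p : {mpoly K[d]}) :
  homogenize p \is (msize p).-homog.
Proof.
rewrite /homogenize big_seq; apply: rpred_sum => m hm; apply: dhomogZ.
have hX (j : 'I_d.+1) : ('X_j : {mpoly K[d.+1]}) \is 1.-homog by rewrite dhomogX /= mdeg1.
rewrite -[X in X.-homog](subnK (ltnW (msize_mdeg_lt hm))); apply: dhomogM.
  by have := dhomogMn (msize p - mdeg m) (hX ord0); rewrite mul1n.
rewrite mdegE; apply: (big_ind2 (fun (u : {mpoly K[d.+1]}) (k : nat) => u \is k.-homog)).
- exact: dhomog1.
- by move=> *; apply: dhomogM.
- by move=> i _; have := dhomogMn (m i) (hX (lift ord0 i)); rewrite mul1n.
Qed.

Lemma homogenize_mmap (K : closedFieldType) d (S : comNzRingType) (f : {rmorphism K -> S})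
    (h : 'I_d.+1 -> S) (p : {mpoly K[d]}) :
  h ord0 = 1 -> mmap f h (homogenize p) = mmap f (h \o lift ord0) p.
Proof.
move=> h0; rewrite /homogenize rmorph_sum /= [RHS]/mmap; apply: eq_bigr => m _.
rewrite mmapZ; congr (_ * _); rewrite rmorphM /= rmorphXn /= mmapX mmap1U h0 expr1n mul1r.
by rewrite /mmap1 rmorph_prod /=; apply: eq_bigr => i _; rewrite rmorphXn /= mmapX mmap1U.
Qed.

Lemma homogenize_eq0 (K : closedFieldType) d (p : {mpoly K[d]}) : homogenize p = 0 -> p = 0.
Proof.
pose h (i : 'I_d.+1) : {mpoly K[d]} := if unlift ord0 i is Some j then 'X_j else 1.
have h0 : h ord0 = 1 by rewrite /h unlift_none.
move=> e; have := homogenize_mmap (@mpolyC d K) p h0.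
rewrite e mmap0 => /esym <-; rewrite -{1}(mmap_mpolyX p).
by apply: eq_mmap => // i; rewrite /h /= liftK.
Qed.

Section Frame.
Context {N d : nat} {K : closedFieldType}.

(* The chart y_0 <> 0: pi0 divides x_i by y_0, and the polynomial ring in
   y_1/y_0, .., y_d/y_0 is embedded in L through phi. *)
Record affine_frame (Q : {mpoly K[N]} -> Prop) (y : 'I_d.+1 -> {mpoly K[N]})
    (L : fieldType) (pi0 : {rmorphism {mpoly K[N]} -> L})
    (phi : {rmorphism {mpoly K[d]} -> L}) (k : nat) (w : 'I_k -> {mpoly K[N]}) : Prop := AffineFrame {
  frame_phi : forall p, phi p = pi0 (subst (y \o lift ord0) p);
  frame_homog : forall m f, f \is m.-homog -> (Q f <-> pi0 f = 0);
  frame_ideal : forall f, Q f -> pi0 f = 0;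
  frame_y0 : pi0 (y ord0) = 1;
  frame_inj : forall p, phi p = 0 -> p = 0;
  frame_w : exists D, forall j, exists2 e : nat, (e <= D)%N & w j \is e.-homog;
  frame_gen : forall m f, f \is m.-homog -> exists alpha : 'I_k -> {mpoly K[d]},
    (forall j, msize (alpha j) <= m.+1)%N /\ pi0 f = \sum_j phi (alpha j) * pi0 (w j) }.

(** Besides [Q] the kernel of [pi0] contains y_0 - 1, so membership in [Q] is tested by [pi0] on
    forms only. The [w] are the monomials that generate K[x]/Q over K[y]; their coefficients are
    dehomogenized by y_0 = 1. *)
Lemma exists_affine_frame (Q : {mpoly K[N]} -> Prop) (y : 'I_d.+1 -> {mpoly K[N]}) :
  homogeneous_ideal Q -> prime_ideal Q -> noether_params Q y ->
  exists (L : fieldType) (pi0 : {rmorphism {mpoly K[N]} -> L})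
    (phi : {rmorphism {mpoly K[d]} -> L}) k (w : 'I_k -> {mpoly K[N]}),
    affine_frame Q y pi0 phi w.
Proof.
move=> hQ pQ [hy fin ind].
have [L [pi ker]] := prime_ideal_field pQ.
have y0 : pi (y ord0) != 0.
  apply/eqP => /ker Qy; have := ind 'X_ord0; rewrite /subst mmapX mmap1U => /(_ Qy).
  by move/eqP; rewrite -msize_poly_eq0 msizeX.
pose kap : {rmorphism K -> L} := pi \o @mpolyC N K.
pose pi0 : {rmorphism {mpoly K[N]} -> L} := mmap kap (fun i => pi 'X_i / pi (y ord0)).
have pi0h m f : f \is m.-homog -> pi0 f = pi f / pi (y ord0) ^+ m.
  move=> /dhomogP hf; rewrite [in RHS]rmorph_mpolyE /pi0 /= /mmap mulr_suml big_seq [RHS]big_seq.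
  apply: eq_bigr => b /hf /= hb; rewrite -mulrA; congr (_ * _).
  rewrite /mmap1 -hb mdegE -prodrXr -prodf_div; apply: eq_bigr => i _.
  by rewrite expr_div_n.
have Fh m f : f \is m.-homog -> (Q f <-> pi0 f = 0).
  move=> /pi0h ->; rewrite ker; split => [->|/eqP]; first by rewrite mul0r.
  by rewrite mulf_eq0 invr_eq0 expf_eq0 (negbTE y0) andbF orbF => /eqP.
have pi0y0 : pi0 (y ord0) = 1 by rewrite (pi0h 1%N) // expr1 divff.
pose tau := y \o lift ord0.
pose phi : {rmorphism {mpoly K[d]} -> L} := pi0 \o mmap (@mpolyC N K) tau.
have [D hD] := module_generators hQ hy fin.
pose w (j : 'I_#|{: 'X_{1..N < D}}|) : {mpoly K[N]} := 'X_[val (enum_val j)].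
exists L, pi0, phi, _, w; split => //.
- move=> f Qf; rewrite (homog_part_sum (leqnn (msize f))) rmorph_sum big1 //= => i _.
  by apply/(Fh i); [exact: homog_part_homog|case: hQ => _; exact].
(* A relation among the quotients y_i / y_0 homogenizes to a relation among the y_i. *)
- move=> p hp; apply: homogenize_eq0; apply: ind.
  apply/(Fh (msize p)); first exact/subst_homog/homogenize_homog.
  rewrite /subst rmorph_mmap homogenize_mmap //= -[RHS]hp /phi /= rmorph_mmap.
  exact: eq_mmap.
- exists D => j; exists (mdeg (val (enum_val j))); last by rewrite dhomogX.
  exact/ltnW/bmdeg.
- move=> m f hf; have [al [al1 al2]] := hD m f hf.
  pose h (i : 'I_d.+1) : {mpoly K[d]} := if unlift ord0 i is Some j then 'X_j else 1.
  exists (fun j => mmap (@mpolyC d K) h (al (enum_val j))); split.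
    move=> j; apply: leq_trans (al1 (enum_val j)); set a := al _.
    rewrite /mmap; apply: leq_trans (msize_sum _ _ _) _; apply/bigmax_leqP_seq => b hb _.
    rewrite mul_mpolyC; apply: leq_trans (mmeasureZ_le _ _ _) _.
    have -> : mmap1 h b = 'X_[ [multinom b (lift ord0 i) | i < d] ].
      rewrite /mmap1 big_ord_recl {1}/h unlift_none expr1n mul1r mpolyXE_id.
      by apply: eq_bigr => i _; rewrite /h liftK mnmE.
    rewrite msizeX; apply: leq_trans (msize_mdeg_lt hb); rewrite ltnS !mdegE.
    rewrite [X in (_ <= X)%N]big_ord_recl; apply: leq_trans (leq_addl _ _).
    by apply: eq_leq; apply: eq_bigr => i _; rewrite mnmE.
  have /eqP : pi0 (f - \sum_b subst y (al b) * 'X_[b]) = 0.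
    rewrite (homog_part_sum (leqnn (msize (f - \sum_b subst y (al b) * 'X_[b])))).
    rewrite rmorph_sum big1 //= => i _.
    by apply/(Fh i); [exact: homog_part_homog|case: hQ => _; exact].
  rewrite rmorphB subr_eq0 => /eqP ->; rewrite rmorph_sum /=.
  rewrite (reindex (fun j : 'I_#|{: 'X_{1..N < D}}| => enum_val j)) /=; last exact: (onW_bij _ (@enum_val_bij _)).
  apply: eq_bigr => j _; rewrite rmorphM; congr (_ * _).
  rewrite /subst !rmorph_mmap; apply: eq_mmap => [c|i] /=; first by rewrite !mmapC /= mmapC.
  rewrite /h; case: (unliftP ord0 i) => [i'|] -> /=; first by rewrite !mmapX !mmap1U.
  by rewrite rmorph1.
Qed.
End Frame.

(** * Nullstellensatz *)

(** Zero columns make the matrix square, with determinant zero. An integral domain is allowed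
    because the entries will be polynomials as well as constants. *)
Lemma exists_left_kernel (R : idomainType) a b (M : 'M[R]_(a, b)) :
  (b < a)%N -> exists2 v : 'rV_a, v != 0 & v *m M = 0.
Proof.
case: a M => // a M hb.
pose M' : 'M[R]_a.+1 := \matrix_(i, j) (if insub (j : nat) is Some j' then M i j' else 0).
have /det0P [v v0 hv] : \det M' == 0.
  rewrite -det_tr; apply/det0P; exists (delta_mx 0 ord_max).
    apply/eqP => /matrixP /(_ 0 ord_max); rewrite !mxE !eqxx.
    by move/eqP; rewrite oner_eq0.
  apply/rowP => j; rewrite -rowE !mxE insubF //=.
  by apply/negbTE; rewrite -leqNgt -ltnS.
exists v => //; apply/rowP => j.
have hj : (j < a.+1)%N by apply: ltn_trans (ltn_ord j) hb.
have := congr1 (fun u : 'rV_a.+1 => u 0 (Ordinal hj)) hv; rewrite !mxE => e0; rewrite -[RHS]e0.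
apply: eq_bigr => i _; rewrite !mxE /=; case: insubP => [j' _ e|]; last by rewrite ltn_ord.
by congr (_ * M _ _); apply: val_inj; rewrite e.
Qed.

Section Points.
Context {N : nat} {K : closedFieldType}.
Implicit Types (J : {mpoly K[N]} -> Prop).

(** When J + (h - r) is the unit ideal, h - r is invertible modulo [J] and can be cancelled from the
    product. If this happened for every factor, [J] would contain 1. *)
Lemma proper_add_root J (h : {mpoly K[N]}) (s : seq K) :
  is_ideal J -> ~ J 1 -> J (\prod_(r <- s) (h - r%:MP)) ->
  exists (r : K) (J' : {mpoly K[N]} -> Prop),
    [/\ is_ideal J', ~ J' 1, forall f, J f -> J' f & J' (h - r%:MP)].
Proof.
move=> hJ J1; elim: s => [|r s IH]; first by rewrite big_nil.
rewrite big_cons => Jp.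
pose J' f := exists u, J (f - u * (h - r%:MP)).
have idJ' : is_ideal J'.
  split; [|split].
  - by exists 0; rewrite mul0r subrr; apply: ideal0.
  - move=> f g [u hu] [v hv]; exists (u + v).
    have -> : f + g - (u + v) * (h - r%:MP) = (f - u * (h - r%:MP)) + (g - v * (h - r%:MP)) by ring.
    exact: idealD.
  - move=> f g [u hu]; exists (f * u).
    by rewrite -mulrA -mulrBr; apply: idealMl.
case: (pselect (J' 1)) => [[u hu]|nJ]; last first.
  exists r, J'; split => //; first by move=> f Jf; exists 0; rewrite mul0r subr0.
  by exists 1; rewrite mul1r subrr; apply: ideal0.
apply: IH; set p := \prod_(r <- s) _ in Jp *.
have -> : p = (1 - u * (h - r%:MP)) * p + u * ((h - r%:MP) * p) by ring.
by apply: idealD => //; [apply: idealMr|apply: idealMl].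
Qed.

(** One variable at a time, [J] grows into a proper ideal containing every X_i - xi_i. Modulo that
    ideal each f equals the constant f(xi), which has to be zero for f in [J]. *)
Lemma proper_has_zero J :
  is_ideal J -> ~ J 1 -> (forall i, exists s : seq K, J (\prod_(r <- s) ('X_i - r%:MP))) ->
  exists xi, forall f, J f -> f.@[xi] = 0.
Proof.
move=> hJ J1 hs.
have [J' [hJ' J'1 JJ' hx]] : exists J' : {mpoly K[N]} -> Prop,
    [/\ is_ideal J', ~ J' 1, forall f, J f -> J' f &
        forall i, i \in enum 'I_N -> exists r : K, J' ('X_i - r%:MP)].
  elim: (enum 'I_N) => [|i s [J' [hJ' J'1 JJ' IH]]]; first by exists J.
  have [r hr] := hs i; have [c [J2 [h1 h2 h3 h4]]] := proper_add_root hJ' J'1 (JJ' _ hr).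
  exists J2; split => // [f /JJ' /h3 //|j]; rewrite inE => /orP [/eqP ->|/IH [c' hc']].
    by exists c.
  by exists c'; apply: h3.
have /choice [xi hxi] i := hx i (mem_enum _ i).
exists xi => f /JJ' Jf; apply: contrapT => /eqP n0.
have e : J' (f.@[xi])%:MP.
  have := ideal_congr_mmap hJ' f hxi.
  rewrite mmap_mpolyX -/(subst _ _) subst_const => h.
  exact: (idealBl hJ' h Jf).
apply: J'1; have := idealMl hJ' ((f.@[xi])^-1)%:MP e.
by rewrite -mpolyCM mulVf // mpolyC1.
Qed.

Lemma mpoly_root_prod J (x : {mpoly K[N]}) k (v : 'I_k -> K) (i0 : 'I_k) : is_ideal J ->
  v i0 != 0 -> J (\sum_i v i *: x ^+ i) -> exists s : seq K, J (\prod_(r <- s) (x - r%:MP)).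
Proof.
move=> hJ vi h; pose p : {poly K} := \poly_(i < k) (if insub i is Some j then v j else 0).
have pE (j : 'I_k) : p`_j = v j by rewrite coef_poly ltn_ord valK.
have p0 : p != 0.
  by apply/eqP => /(congr1 (fun q : {poly K} => q`_i0)); rewrite pE coef0 => /eqP; apply/negP.
have [s es] := closed_field_poly_normal p; exists s.
have lc : lead_coef p != 0 by rewrite lead_coef_eq0.
pose ev (q : {poly K}) := (map_poly (@mpolyC N K) q).[x].
have evp : ev p = \sum_i v i *: x ^+ i.
  rewrite /ev (@horner_coef_wide _ k); last by rewrite size_map_poly; apply: size_poly.
  by apply: eq_bigr => i _; rewrite coef_map /= pE mul_mpolyC.
have evs : ev p = lead_coef p *: \prod_(r <- s) (x - r%:MP).
  rewrite {1}es /ev -mul_polyC rmorphM /= hornerM map_polyC /= hornerC mul_mpolyC; congr (_ *: _).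
  rewrite rmorph_prod horner_prod; apply: eq_bigr => r _.
  by rewrite rmorphB /= map_polyX map_polyC /= hornerXsubC.
have := idealZ hJ (lead_coef p)^-1 h; rewrite -evp evs scalerA mulVf // scale1r //.
Qed.

Lemma frame_gen_all d (Q : {mpoly K[N]} -> Prop) (y : 'I_d.+1 -> {mpoly K[N]})
    (L : fieldType) (pi0 : {rmorphism {mpoly K[N]} -> L})
    (phi : {rmorphism {mpoly K[d]} -> L}) k (w : 'I_k -> {mpoly K[N]}) :
  affine_frame Q y pi0 phi w -> forall f, exists alpha : 'I_k -> {mpoly K[d]},
    pi0 f = \sum_j phi (alpha j) * pi0 (w j).
Proof.
move=> fr f; have /choice [al hal] e := frame_gen fr (homog_part_homog e f).
exists (fun j => \sum_(e < msize f) al e j).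
rewrite [in LHS](homog_part_sum (leqnn (msize f))) rmorph_sum /=.
under [RHS]eq_bigr do rewrite rmorph_sum mulr_suml.
by rewrite exchange_big /=; apply: eq_bigr => e _; case: (hal e).
Qed.

(** Lying over for the point [p] of the chart: the ideal generated by the kernel of [pi0] and the
    y_i - p_i is proper, and modulo it every variable is algebraic over [K]. *)
Lemma frame_point d (Q : {mpoly K[N]} -> Prop) (y : 'I_d.+1 -> {mpoly K[N]})
    (L : fieldType) (pi0 : {rmorphism {mpoly K[N]} -> L})
    (phi : {rmorphism {mpoly K[d]} -> L}) k (w : 'I_k -> {mpoly K[N]}) (p : 'I_d -> K) :
  affine_frame Q y pi0 phi w ->
  exists xi, (forall f, pi0 f = 0 -> f.@[xi] = 0) /\ forall i, (y (lift ord0 i)).@[xi] = p i.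
Proof.
move=> fr; pose tau i := y (lift ord0 i).
pose J f := exists u : 'I_d -> {mpoly K[N]}, pi0 f = \sum_i pi0 (tau i - (p i)%:MP) * pi0 (u i).
have hJ : is_ideal J.
  split; [|split].
  - by exists (fun=> 0); rewrite rmorph0 big1 // => i _; rewrite mulr0.
  - move=> f g [u hu] [v hv]; exists (fun i => u i + v i).
    by rewrite rmorphD hu hv -big_split; apply: eq_bigr => i _ /=; rewrite -mulrDr -rmorphD.
  - move=> f g [u hu]; exists (fun i => f * u i).
    by rewrite rmorphM hu mulr_sumr; apply: eq_bigr => i _; rewrite rmorphM mulrCA.
have Jker f : pi0 f = 0 -> J f.
  by move=> e; exists (fun=> 0); rewrite e big1 // => i _; rewrite rmorph0 mulr0.
have Jtau i : J (tau i - (p i)%:MP).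
  exists (fun j => (j == i)%:R); rewrite (bigD1 i) //= eqxx rmorph1 mulr1 big1 ?addr0 //.
  by move=> j /negbTE ->; rewrite rmorph0 mulr0.
have Jphi q : J (subst tau q - (q.@[p])%:MP).
  by rewrite -(subst_const N); apply: ideal_congr_mmap.
have phiE i : pi0 (tau i - (p i)%:MP) = phi ('X_i - (p i)%:MP).
  by rewrite (frame_phi fr) /subst mmapB mmapX mmap1U mmapC.
(* Nakayama's lemma: if 1 were in [J], multiplication by 1 would have a matrix [M] whose entries
   vanish at [p]. Then det(1 - M) annihilates the generators, so it is zero, although its value at
   [p] is 1. *)
have J1 : ~ J 1.
  move=> [u]; rewrite rmorph1 => hu.
  have /choice [al hal] b : exists al : 'I_d -> 'I_k -> {mpoly K[d]}, forall i,
      pi0 (u i * w b) = \sum_j phi (al i j) * pi0 (w j).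
    by have [al0 h0] := choice (fun i => frame_gen_all fr (u i * w b)); exists al0.
  pose M : 'M[{mpoly K[d]}]_k := \matrix_(b, c) \sum_i ('X_i - (p i)%:MP) * al b i c.
  pose wv : 'cV[L]_k := \col_b pi0 (w b).
  have Mw : map_mx phi (1%:M - M) *m wv = 0.
    rewrite map_mxB map_mx1 mulmxBl mul1mx; apply/eqP; rewrite subr_eq0; apply/eqP/colP => b.
    rewrite !mxE -[LHS]mul1r hu mulr_suml.
    under eq_bigr do rewrite -mulrA -rmorphM hal mulr_sumr.
    rewrite exchange_big /=; apply: eq_bigr => c _; rewrite !mxE rmorph_sum mulr_suml.
    by apply: eq_bigr => i _; rewrite phiE rmorphM mulrA.
  have dw b : phi (\det (1%:M - M)) * pi0 (w b) = 0.
    have : \adj (map_mx phi (1%:M - M)) *m (map_mx phi (1%:M - M) *m wv) = 0 by rewrite Mw mulmx0.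
    by rewrite mulmxA mul_adj_mx mul_scalar_mx det_map_mx => /colP /(_ b); rewrite !mxE.
  have [a1 ha1] := frame_gen_all fr 1.
  have /(frame_inj fr) d0 : phi (\det (1%:M - M)) = 0.
    rewrite -[LHS]mulr1 -[X in _ * X](rmorph1 pi0) ha1 mulr_sumr big1 // => j _.
    by rewrite mulrCA dw mulr0.
  have := congr1 (meval p) d0; rewrite -det_map_mx map_mxB map_mx1 raddf0.
  have -> : map_mx (meval p) M = 0.
    apply/matrixP => b c; rewrite !mxE raddf_sum big1 //= => i _.
    by rewrite mevalM mevalB mevalXU mevalC subrr mul0r.
  by rewrite subr0 det1 => /eqP; rewrite oner_eq0.
have [|xi hxi] := proper_has_zero hJ J1.
  (* Modulo [J] the k elements [w] span over [K], so the k + 1 powers 1, ..., X_i^k are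
     dependent. *)
  move=> i; have /choice [al hal] (j : 'I_k.+1) := frame_gen_all fr ('X_i ^+ j).
  pose M : 'M[K]_(k.+1, k) := \matrix_(j, c) (al j c).@[p].
  have [v v0 vM] := exists_left_kernel M (ltnSn k).
  have [j0 vj0] : exists j, v 0 j != 0.
    apply: contrapT => h; case/eqP: v0; apply/rowP => j; rewrite mxE.
    by apply: contrapT => /eqP ne; apply: h; exists j.
  apply: (mpoly_root_prod hJ vj0).
  have JX (j : 'I_k.+1) : J ('X_i ^+ j - \sum_c (al j c).@[p] *: w c).
    apply: (@ideal_trans _ _ _ hJ _ (\sum_c subst tau (al j c) * w c)).
      apply: Jker; rewrite rmorphB hal rmorph_sum -sumrB big1 // => c _.
      by rewrite rmorphM (frame_phi fr) subrr.
    by rewrite -sumrB; apply: ideal_sum => // c _; rewrite -mul_mpolyC -mulrBl; apply: idealMr.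
  have e0 : \sum_j v 0 j *: (\sum_c (al j c).@[p] *: w c) = 0.
    under eq_bigr do rewrite scaler_sumr.
    rewrite exchange_big big1 //= => c _; under eq_bigr do rewrite scalerA.
    rewrite -scaler_suml; have := congr1 (fun u : 'rV_k => u 0 c) vM; rewrite !mxE.
    by under eq_bigr do rewrite mxE; move=> ->; rewrite scale0r.
  rewrite -[X in J X]subr0 -[X in J (_ - X)]e0 -sumrB.
  by apply: ideal_sum => // j _; rewrite -scalerBr; apply: idealZ.
exists xi; split; first by move=> f /Jker /hxi.
by move=> i; have := hxi _ (Jtau i); rewrite mevalB mevalC => /eqP; rewrite subr_eq0 => /eqP.
Qed.

Lemma noether_params_pos (Q : {mpoly K[N]} -> Prop) :
  homogeneous_ideal Q -> prime_ideal Q -> (exists i, ~ Q 'X_i) ->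
  exists d (y : 'I_d.+1 -> {mpoly K[N]}), noether_params Q y.
Proof.
move=> hQ [idQ [Q1 QM]] [i Qi].
have [[|l] [y hy]] := noether_normalization hQ Q1; last by exists l, y.
case: Qi; case: hy => _ /(_ i) [D [g hg]] _; move: hg; rewrite big_ord0 subr0.
elim: D => [|D IH]; first by rewrite expr0.
by rewrite exprS => /QM [].
Qed.

(** A form F outside [Q] is algebraic over the polynomial ring of the chart. Divided by the lowest
    power of F that occurs, a relation reads v + F u = 0 with v a nonzero polynomial; F is then
    nonzero at a point above any [p] where v does not vanish. *)
Lemma prime_nullstellensatz (Q : {mpoly K[N]} -> Prop) :
  homogeneous_ideal Q -> prime_ideal Q -> (exists i, ~ Q 'X_i) ->
  forall f, vI (vanishing_set Q) f -> Q f.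
Proof.
move=> hQ pQ nQ.
have [d [y hy]] := noether_params_pos hQ pQ nQ.
have [L [pi0 [phi [k [w fr]]]]] := exists_affine_frame hQ pQ hy.
have [y1 _ _] := hy.
suff main e F : F \is e.-homog -> ~ Q F -> exists xi, vanishing_set Q xi /\ F.@[xi] != 0.
  move=> f vf; apply: homogeneous_ideal_parts => // e; apply: contrapT => nQe.
  have [xi [vx]] := main e _ (homog_part_homog e f) nQe.
  have cV : cone (vanishing_set Q) := closed_cone (vanishing_set_closed hQ).
  have -> : (homog_part e f).@[xi] = 0 by apply: ((vI_homog cV).2 _ e vf).
  by rewrite eqxx.
move=> hF QF; have F0 : pi0 F != 0 by apply/eqP => /(frame_homog fr hF).
have /choice [al hal] (j : 'I_k.+1) := frame_gen_all fr (F ^+ j).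
have [v v0 vM] := exists_left_kernel (\matrix_(j, c) al j c) (ltnSn k).
have hv : \sum_j phi (v 0 j) * pi0 F ^+ j = 0.
  under eq_bigr do rewrite -rmorphXn hal mulr_sumr.
  rewrite exchange_big big1 //= => c _; under eq_bigr do rewrite mulrA -rmorphM.
  rewrite -mulr_suml -rmorph_sum; have := congr1 (fun u : 'rV_k => u 0 c) vM; rewrite !mxE.
  by under eq_bigr do rewrite mxE; move=> ->; rewrite rmorph0 mul0r.
have [j1 vj1] : exists j, v 0 j != 0.
  apply: contrapT => h; case/eqP: v0; apply/rowP => j; rewrite mxE.
  by apply: contrapT => /eqP ne; apply: h; exists j.
have [j0 vj0 minj] : exists2 j0 : 'I_k.+1, v 0 j0 != 0 & forall j : 'I_k.+1, v 0 j != 0 -> (j0 <= j)%N.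
  by case: (@arg_minnP _ j1 (fun j => v 0 j != 0) (fun j => j : nat) vj1) => j0 h1 h2; exists j0.
have [p vp] := mpoly_nonroot vj0.
have [xi [kx tx]] := frame_point p fr.
pose tau (i : 'I_d) := y (lift ord0 i).
pose u := \sum_(j : 'I_k.+1 | (j0 < j)%N) subst tau (v 0 j) * F ^+ (j - j0.+1).
have e0 : pi0 (subst tau (v 0 j0) + F * u) = 0.
  have : pi0 F ^+ j0 * pi0 (subst tau (v 0 j0) + F * u) = 0.
    rewrite -[RHS]hv (bigID (fun j : 'I_k.+1 => j0 < j)%N) /= addrC.
    rewrite rmorphD mulrDr -rmorphXn -!rmorphM; congr (_ + _).
      rewrite (bigD1 j0) ?ltnn //= big1 ?addr0; first by rewrite rmorphM rmorphXn mulrC (frame_phi fr).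
      move=> j /andP[h1 h2]; suff -> : v 0 j = 0 by rewrite rmorph0 mul0r.
      apply: contrapT => /eqP /minj h3; case/eqP: h2; apply: val_inj.
      by apply/eqP; rewrite eqn_leq h3 leqNgt h1.
    rewrite /u !mulr_sumr rmorph_sum; apply: eq_bigr => j hj.
    rewrite (frame_phi fr) -rmorphXn -rmorphM; congr (pi0 _).
    have -> : F ^+ j = F ^+ j0 * (F * F ^+ (j - j0.+1)) by rewrite -exprS -exprD addnS -addSn subnKC.
    rewrite -[subst (y \o lift ord0) _]/(subst tau _).
    by move: (subst tau _) (F ^+ j0) (F ^+ (j - j0.+1)) => s0 a b; ring.
  by move/eqP; rewrite mulf_eq0 expf_eq0 (negbTE F0) andbF => /eqP.
have ex := kx _ e0; exists xi; split.
  split; last by move=> f /(frame_ideal fr) /kx.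
  (* [xi] lies in the chart y_0 = 1, hence is a nonzero vector. *)
  have yx : (y ord0).@[xi] = 1.
    have : pi0 (y ord0 - 1) = 0 by rewrite rmorphB rmorph1 (frame_y0 fr) subrr.
    by move/kx; rewrite mevalB meval1 => /eqP; rewrite subr_eq0 => /eqP.
  apply: contrapT => nx; have : (y ord0).@[fun i => 0 * xi i] = 0 * (y ord0).@[xi].
    by rewrite (meval_scale _ _ (y1 ord0)) expr1.
  rewrite (@meval_eq _ _ _ xi); first by rewrite yx mul0r => /eqP; rewrite oner_eq0.
  move=> i; rewrite mul0r; apply: esym; apply: contrapT => /eqP ne.
  by apply: nx; exists i.
apply: contraNneq vp => Fx.
move: ex; rewrite mevalD mevalM Fx mul0r addr0 meval_subst.
by rewrite (meval_eq _ (tx : _ =1 p)) => ->.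
Qed.

(** A prime containing [J] and missing the powers of [G] is replaced by its homogeneous core. The
    condition at 0 prevents the core from containing all variables, in which case its zero set would
    be empty. *)
Lemma nullstellensatz J (G : {mpoly K[N]}) : homogeneous_ideal J -> G.@[fun=> 0] = 0 ->
  vI (vanishing_set J) G -> exists M : nat, J (G ^+ M).
Proof.
move=> hJ G0 vG; apply: contrapT => nM.
have [||||P [pP JP PG]] := @exists_prime_avoiding _ _ J (fun f => exists M : nat, f = G ^+ M).
- by case: hJ.
- by exists 0%N.
- by move=> _ _ [a ->] [b ->]; exists (a + b)%N; rewrite exprD.
- by move=> f Jf [M e]; apply: nM; exists M; rewrite -e.
have [hC pC] := homog_core_prime pP.
have nPG : ~ P G by move=> h; apply: (PG _ h); exists 1%N.
have CG : ~ homog_core P G by move/homog_core_sub => h; apply: nPG; apply: h; case: pP.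
apply: CG; apply: prime_nullstellensatz => //.
  apply: contrapT => h; have hX i : P 'X_i.
    apply: (@homog_core_sub _ _ P); first by case: pP.
    by apply: contrapT => n; apply: h; exists i.
  apply: nPG; case: (pP) => idP _; have := @ideal_congr_mmap _ _ P idP _ (fun i => 'X_i) (fun i => 0%:MP) G.
  rewrite mmap_mpolyX -/(subst _ _) subst_const G0 mpolyC0 subr0; apply => i.
  by rewrite ?mpolyC0 subr0.
move=> x [nx hx]; apply: vG; split => // f Jf; apply: hx.
exact: sub_homog_core Jf.
Qed.

End Points.

(** * Hilbert functions *)

Section HilbertFunction.
Context {N : nat} {k : fieldType}.
Implicit Types (I J : {mpoly k[N]} -> Prop) (f : {mpoly k[N]}) (s : seq {mpoly k[N]}).

Definition hilbert_ge I m v := exists s, size s = v /\ indep_mod I m s.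
Definition hilbert_le I m v := forall s, indep_mod I m s -> (size s <= v)%N.

Lemma indep_mod_row I m s (v : 'rV_(size s)) : indep_mod I m s ->
  I (\sum_i v 0 i *: s`_i) -> v = 0.
Proof.
move=> [_ hs] h; pose c (j : nat) := if insub j is Some i then v 0 i else 0.
have cE (i : 'I_(size s)) : c i = v 0 i by rewrite /c valK.
apply/rowP => i; rewrite mxE -cE; apply: (hs c); last exact: ltn_ord.
by under eq_bigr do rewrite cE.
Qed.

(** With fewer conditions than elements, some nontrivial combination satisfies all of them. [R] is a
    relation and not a function because the coordinates of a form may depend on a choice. *)
Lemma linear_conditions_bound I m s (T : finType)
    (R : {mpoly k[N]} -> (T -> k) -> Prop) :
  indep_mod I m s ->
  (forall f, f \is m.-homog -> exists c, R f c) ->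
  (forall a (F : 'I_a -> {mpoly k[N]}) (C : 'I_a -> T -> k) (v : 'I_a -> k),
     (forall i, R (F i) (C i)) -> (forall t, \sum_i v i * C i t = 0) ->
     I (\sum_i v i *: F i)) ->
  (size s <= #|T|)%N.
Proof.
move=> hs hR hI; rewrite leqNgt; apply/negP => hlt.
have hom (i : 'I_(size s)) : s`_i \is m.-homog.
  by case: hs => /allP h _; apply: h; rewrite mem_nth.
have [C hC] := choice (fun i => hR _ (hom i)).
have [v v0 hv] := exists_left_kernel (\matrix_(i < size s, t < #|T|) C i (enum_val t)) hlt.
case/eqP: v0; apply: (indep_mod_row hs); apply: (hI _ _ _ (v 0) hC) => t.
have := congr1 (fun u : 'rV_#|T| => u 0 (enum_rank t)) hv; rewrite !mxE.
by under eq_bigr do rewrite mxE enum_rankK.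
Qed.

Lemma ideal_sum_conditions I (T : finType) (g : T -> {mpoly k[N]}) a (F : 'I_a -> {mpoly k[N]})
    (C : 'I_a -> T -> k) (v : 'I_a -> k) : is_ideal I ->
  (forall i, I (F i - \sum_t C i t *: g t)) -> (forall t, \sum_i v i * C i t = 0) ->
  I (\sum_i v i *: F i).
Proof.
move=> hI hF hv.
have e0 : \sum_i v i *: (\sum_t C i t *: g t) = 0.
  under eq_bigr do rewrite scaler_sumr.
  rewrite exchange_big big1 //= => t _; under eq_bigr do rewrite scalerA.
  by rewrite -scaler_suml hv scale0r.
rewrite -[X in I X]subr0 -[X in I (_ - X)]e0 -sumrB; apply: ideal_sum => // i _.
by rewrite -scalerBr; apply: idealZ.
Qed.

Lemma spanning_bound I m s (T : finType) (g : T -> {mpoly k[N]}) : is_ideal I ->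
  (forall f, f \is m.-homog -> exists c : T -> k, I (f - \sum_t c t *: g t)) ->
  indep_mod I m s -> (size s <= #|T|)%N.
Proof.
move=> hI hg hs; apply: (linear_conditions_bound hs hg) => a F C v.
exact: ideal_sum_conditions.
Qed.

Lemma hilbert_value_exists I m : is_ideal I -> exists v, hilbert_value I m v.
Proof.
move=> hI; have hb s : indep_mod I m s -> (size s <= #|{: 'X_{1..N < m.+1}}|)%N.
  apply: (@spanning_bound _ _ _ _ (fun b => 'X_[val b])) => // f hf.
  exists (fun b => f@_(val b)).
  rewrite -mpolywE ?subrr; first exact: ideal0.
  by rewrite msizeE; apply/bigmax_leqP_seq => b hb _; move/dhomogP: hf => /(_ _ hb) /= ->.
pose P v := `[< hilbert_ge I m v >].
have P0 : exists v, P v.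
  by exists 0%N; apply/asboolP; exists [::]; split => //; split.
have Pb v : P v -> (v <= #|{: 'X_{1..N < m.+1}}|)%N.
  by move=> /asboolP [s [<-]]; apply: hb.
exists (ex_maxn P0 Pb); case: ex_maxnP => v /asboolP hv hmax; split => // s hs.
by apply: hmax; apply/asboolP; exists s.
Qed.

Lemma hilbert_ge_le I m v w : hilbert_ge I m v -> hilbert_le I m w -> (v <= w)%N.
Proof. by move=> [s [<- hs]]; apply. Qed.

Lemma hilbert_value_le I m v w : hilbert_value I m v -> hilbert_le I m w -> (v <= w)%N.
Proof. by move=> [h _]; apply: hilbert_ge_le. Qed.

Lemma hilbert_value_ge I m v w : hilbert_value I m v -> hilbert_ge I m w -> (w <= v)%N.
Proof. by move=> [_ h] h'; apply: hilbert_ge_le h' h. Qed.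

Lemma hilbert_ge_family I m (T : finType) (g : T -> {mpoly k[N]}) :
  (forall t, g t \is m.-homog) ->
  (forall c : T -> k, I (\sum_t c t *: g t) -> forall t, c t = 0) -> hilbert_ge I m #|T|.
Proof.
move=> hg hi; pose s := [seq g t | t <- enum T].
have sz : size s = #|T| by rewrite size_map -cardE.
exists s; split => //; split; first by apply/allP => _ /mapP [t _ ->].
rewrite sz => c hc i hi'; pose c' (t : T) := c (enum_rank t).
have := hi c' _ (enum_val (Ordinal hi')); rewrite /c' enum_valK; apply.
rewrite (reindex (fun j : 'I_#|T| => enum_val j)) /=; last exact: (onW_bij _ (@enum_val_bij _)).
move: hc; rewrite (eq_bigr (fun j : 'I_#|T| => c (enum_rank (enum_val j)) *: g (enum_val j))) //.
move=> j _; rewrite enum_valK (nth_map (enum_val j)) -?cardE //.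
by rewrite -(enum_val_nth (enum_val j) j).
Qed.

Lemma hilbert_basis I m v : is_ideal I -> hilbert_value I m v -> exists g : 'I_v -> {mpoly k[N]},
  [/\ forall t, g t \is m.-homog,
      forall c : 'I_v -> k, I (\sum_t c t *: g t) -> forall t, c t = 0 &
      forall f, f \is m.-homog -> exists c : 'I_v -> k, I (f - \sum_t c t *: g t)].
Proof.
move=> hI [[s [sz hs]] mx]; subst v; exists (fun t => s`_t).
have hom (t : 'I_(size s)) : s`_t \is m.-homog.
  by case: hs => /allP h _; apply: h; rewrite mem_nth.
have ind (c : 'I_(size s) -> k) : I (\sum_t c t *: s`_t) -> forall t, c t = 0.
  move=> h t; have /rowP/(_ t) : \row_t c t = 0.
    by apply: (indep_mod_row hs); under eq_bigr do rewrite mxE.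
  by rewrite !mxE.
split => // f hf; apply: contrapT => nf.
suff /mx : indep_mod I m (rcons s f) by rewrite size_rcons ltnn.
split; first by rewrite all_rcons hf /=; case: hs.
rewrite size_rcons => c; rewrite big_ord_recr /= nth_rcons ltnn eqxx => hc.
have e : \sum_(i < size s) c i *: (rcons s f)`_i = \sum_(i < size s) c i *: s`_i.
  by apply: eq_bigr => i _; rewrite nth_rcons ltn_ord.
rewrite e in hc.
have c0 : c (size s) = 0.
  apply: contrapT => /eqP n0; apply: nf; exists (fun t => - (c (size s))^-1 * c t).
  have := idealZ hI (c (size s))^-1 hc; rewrite scalerDr scalerA mulVf // scale1r addrC.
  rewrite scaler_sumr -sumrN; congr (I (f + _)); apply: eq_bigr => t _.
  by rewrite scalerA mulNr scaleNr opprK.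
move=> i; rewrite ltnS leq_eqVlt => /orP [/eqP -> //|hi].
move: hc; rewrite c0 scale0r addr0 => /(ind (fun t => c t)) /(_ (Ordinal hi)); exact.
Qed.

(** The quotient by the intersection embeds into the product of the two quotients. *)
Lemma hilbert_le_setI I J m v w : is_ideal I -> is_ideal J ->
  hilbert_le I m v -> hilbert_le J m w -> hilbert_le (fun f => I f /\ J f) m (v + w).
Proof.
move=> hI hJ lI lJ.
have [a ha] := hilbert_value_exists m hI; have [b hb] := hilbert_value_exists m hJ.
have [g [_ _ gs]] := hilbert_basis hI ha; have [h [_ _ hs]] := hilbert_basis hJ hb.
move=> s ss; apply: leq_trans (leq_add (hilbert_value_le ha lI) (hilbert_value_le hb lJ)).
have <- : #|{: 'I_a + 'I_b}| = (a + b)%N by rewrite card_sum !card_ord.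
pose R f (c : 'I_a + 'I_b -> k) :=
  I (f - \sum_t c (inl t) *: g t) /\ J (f - \sum_t c (inr t) *: h t).
apply: (linear_conditions_bound (R := R) ss).
  move=> f hf; have [c1 h1] := gs _ hf; have [c2 h2] := hs _ hf.
  by exists (fun t => match t with inl t => c1 t | inr t => c2 t end).
move=> n F C u hF hu; split.
  by apply: (ideal_sum_conditions (g := g) (C := fun i t => C i (inl t)) hI _ (fun t => hu (inl t))) => i; case: (hF i).
by apply: (ideal_sum_conditions (g := h) (C := fun i t => C i (inr t)) hJ _ (fun t => hu (inr t))) => i; case: (hF i).
Qed.

End HilbertFunction.

(** * Counting monomials *)

Section CountingMonomials.

(** One more variable fills a monomial of degree at most m up to degree exactly m. *)
Lemma card_bmultinom d m : #|{: 'X_{1..d < m.+1}}| = 'C(m + d, d).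
Proof.
pose h (b : 'X_{1..d < m.+1}) : 'X_{1..d.+1} :=
  [multinom if unlift ord0 i is Some j then val b j else (m - mdeg (val b))%N | i < d.+1].
have h0 b : h b ord0 = (m - mdeg (val b))%N by rewrite mnmE unlift_none.
have hS b j : h b (lift ord0 j) = val b j by rewrite mnmE liftK.
have hdeg b : mdeg (h b) = m.
  rewrite mdegE big_ord_recl h0.
  under eq_bigr do rewrite hS.
  by rewrite -mdegE subnK // -ltnS bmdeg.
have inj : injective h.
  by move=> b c e; apply/val_inj/mnmP => j; rewrite -hS e hS.
rewrite -[X in 'C(X, _)]/(m + d)%N -bin_sub ?leq_addl // addnK.
rewrite -(size_basis d m) cardE -(size_map h).
apply/perm_size/uniq_perm.
- by rewrite map_inj_uniq // enum_uniq.
- exact: uniq_basis.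
move=> c; rewrite -basis_cover; apply/mapP/eqP => [[b _ ->] //|hc].
have hlt : (mdeg [multinom c (lift ord0 j) | j < d] < m.+1)%N.
  rewrite ltnS -hc !mdegE [X in (_ <= X)%N]big_ord_recl.
  by apply: leq_trans (leq_addl _ _); apply: eq_leq; apply: eq_bigr => j _; rewrite mnmE.
exists (BMultinom hlt); rewrite ?mem_enum //; apply/mnmP => i.
case: (unliftP ord0 i) => [j|] ->; first by rewrite hS mnmE.
rewrite h0 /= -hc !mdegE big_ord_recl.
under [X in (_ - X)%N]eq_bigr do rewrite mnmE.
by rewrite addnK.
Qed.

Lemma card_multinom_deg d m :
  #|[pred b : 'X_{1..d < m.+1} | mdeg (val b) == m]| = ('C(m + d, d) - #|{: 'X_{1..d < m}}|)%N.
Proof.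
rewrite -card_bmultinom -(cardC [pred b : 'X_{1..d < m.+1} | mdeg (val b) == m]).
suff -> : #|{: 'X_{1..d < m}}| = #|[predC [pred b : 'X_{1..d < m.+1} | mdeg (val b) == m]]|.
  by rewrite addnK.
pose h (b : 'X_{1..d < m}) : 'X_{1..d < m.+1} := BMultinom (ltnW (bmdeg b) : (mdeg (val b) < m.+1)%N).
have inj : injective h by move=> b c /(congr1 val) e; apply: val_inj.
rewrite -(card_image inj); apply: eq_card => c; apply/idP/idP => [/mapP [b _ ->]|].
  by rewrite !inE /= neq_ltn bmdeg.
rewrite !inE => hc; have hlt : (mdeg (val c) < m)%N by rewrite ltn_neqAle hc -ltnS bmdeg.
by apply/mapP; exists (BMultinom hlt); [rewrite mem_enum|apply: val_inj].
Qed.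

Lemma bin_le_expn d m : ('C(m + d, d) <= m.+1 ^ d)%N.
Proof.
elim: d => [|d IH]; first by rewrite bin0.
have e := mul_bin_diag (m + d).+1 d; rewrite /= -addnS in e.
have h : (d.+1 * 'C(m + d.+1, d.+1) <= d.+1 * m.+1 ^ d.+1)%N.
  rewrite -e addnS expnS mulnA; apply: leq_mul IH; nia.
by move: h; rewrite leq_pmul2l.
Qed.

(** This is the origin of the summand d in the final bound; there is equality for m = 1. *)
Lemma bin_le_expn_add d m : (0 < m)%N -> ('C(m + d, d) <= m ^ d + d)%N.
Proof.
move=> m0; case: d => [|d]; first by rewrite bin0.
elim: d => [|d IH]; first by rewrite bin1 expn1.
have e := mul_bin_diag (m + d.+1).+1 d.+1; rewrite /= -addnS in e.
have h : (d.+2 * 'C(m + d.+2, d.+2) <= d.+2 * (m ^ d.+2 + d.+2))%N.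
  rewrite -e addnS; apply: (leq_trans (leq_mul (leqnn _) IH)).
  rewrite (expnS m d.+1).
  have q0 : (0 < m ^ d.+1)%N by rewrite expn_gt0 m0.
  case: m m0 q0 {e IH} => [//|[|m]] _; first by rewrite exp1n; lia.
  move: (m.+2 ^ d.+1)%N => [//|q] _.
  (* q + 1 stands for the power of m in the induction hypothesis; the last summand is the slack of
     the induction step. *)
  have -> : (d.+2 * (m.+2 * q.+1 + d.+2) = (m.+2 + d.+2) * (q.+1 + d.+1) + q * (d * m + d + m))%N by ring.
  by rewrite -addnS leq_addr.
by move: h; rewrite leq_pmul2l.
Qed.

Lemma expn_le_fact_bin d m : (m ^ d <= d`! * 'C(m + d, d))%N.
Proof.
elim: d => [|d IH]; first by rewrite bin0.
have e := mul_bin_diag (m + d).+1 d; rewrite /= -addnS in e.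
rewrite factS (mulnC d.+1) -mulnA -e addnS expnS mulnCA.
by apply: leq_mul => //; lia.
Qed.

End CountingMonomials.

Lemma msizeM_le n (R : idomainType) (p q : {mpoly R[n]}) : (msize (p * q) <= msize p + msize q)%N.
Proof.
case: (eqVneq p 0) => [->|p0]; first by rewrite mul0r msize0.
case: (eqVneq q 0) => [->|q0]; first by rewrite mulr0 msize0.
by rewrite msizeM // leq_pred.
Qed.

Lemma msize_sum_le n (R : nzRingType) (T : finType) (F : T -> {mpoly R[n]}) B :
  (forall t, msize (F t) <= B)%N -> (msize (\sum_t F t) <= B)%N.
Proof. by move=> h; apply: leq_trans (msize_sum _ _ _) _; apply/bigmax_leqP. Qed.

Lemma size_det_le (R : idomainType) n (M : 'M[{poly R}]_n) B :
  (forall i j, size (M i j) <= B.+1)%N -> (size (\det M) <= (n * B).+1)%N.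
Proof.
move=> h; rewrite /determinant; apply: leq_trans (size_sum _ _ _) _; apply/bigmax_leqP => s _.
rewrite size_Msign; apply: leq_trans (size_poly_prod_leq _ _) _.
rewrite leq_subLR; apply: (@leq_trans (\sum_(i < n) B.+1).+1).
  by rewrite ltnS; apply: leq_sum => i _; apply: h.
by rewrite sum_nat_const card_ord mulnS addnS.
Qed.

Section MaximalIndependent.
Context {A : idomainType} {L : fieldType} (phi : {rmorphism A -> L}).

(** [delta] is the rank of the span of the [w]. A maximal independent subfamily need not generate
    this span; [a] is a common denominator for all the [w j]. *)
Lemma exists_rank_basis k (w : 'I_k -> L) : exists delta (io : 'I_delta -> 'I_k) (a : A),
  [/\ a != 0,
   forall c : 'I_delta -> A, \sum_i phi (c i) * w (io i) = 0 -> forall i, c i = 0 &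
   forall j, exists c : 'I_delta -> A, phi a * w j = \sum_i phi (c i) * w (io i)].
Proof.
elim: k w => [|k IH] w.
  exists 0%N, (fun i => i), 1; split; first exact: oner_neq0.
    by move=> c _ [].
  by move=> [].
have [delta [io [a [a0 ind gen]]]] := IH (fun i => w (lift ord_max i)).
case: (pselect (exists (b : A) (c : 'I_delta -> A), b != 0 /\
    phi b * w ord_max = \sum_i phi (c i) * w (lift ord_max (io i)))).
  move=> [b [c [b0 hb]]]; exists delta, (fun i => lift ord_max (io i)), (a * b); split => //.
    by rewrite mulf_neq0.
  move=> j; case: (unliftP ord_max j) => [j'|] ->.
    have [c' hc'] := gen j'; exists (fun i => b * c' i).
    by rewrite rmorphM mulrAC hc' mulr_suml; apply: eq_bigr => i _; rewrite rmorphM; ring.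
  exists (fun i => a * c i).
  by rewrite rmorphM -mulrA hb mulr_sumr; apply: eq_bigr => i _; rewrite rmorphM mulrA.
move=> nd; pose io' (i : 'I_delta.+1) := if unlift ord_max i is Some j then lift ord_max (io j) else ord_max.
exists delta.+1, io', a.
have ioM : io' ord_max = ord_max by rewrite /io' unlift_none.
have ioL i : io' (lift ord_max i) = lift ord_max (io i) by rewrite /io' liftK.
have sumE (c : 'I_delta.+1 -> A) : \sum_i phi (c i) * w (io' i) =
    \sum_i phi (c (lift ord_max i)) * w (lift ord_max (io i)) + phi (c ord_max) * w ord_max.
  rewrite (bigD1_ord ord_max) //= ioM addrC; congr (_ + _).
  by apply: eq_bigr => i _; rewrite ioL.
split => //.
  move=> c; rewrite sumE => h.
  have cM : c ord_max = 0.
    apply: contrapT => /eqP n0; apply: nd; exists (c ord_max), (fun i => - c (lift ord_max i)).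
    split => //; move/eqP: h; rewrite addrC addr_eq0 => /eqP ->.
    by rewrite -sumrN; apply: eq_bigr => i _; rewrite rmorphN mulNr.
  move: h; rewrite cM rmorph0 mul0r addr0 => /(ind (fun i => c (lift ord_max i))) h i.
  by case: (unliftP ord_max i) => [j|] ->.
move=> j; case: (unliftP ord_max j) => [j'|] ->.
  have [c hc] := gen j'.
  exists (fun i => if unlift ord_max i is Some i' then c i' else 0).
  rewrite sumE unlift_none rmorph0 mul0r addr0 hc; apply: eq_bigr => i _.
  by rewrite liftK.
exists (fun i => if unlift ord_max i is Some i' then 0 else a).
rewrite sumE unlift_none big1 ?add0r // => i _.
by rewrite liftK rmorph0 mul0r.
Qed.
End MaximalIndependent.

(** * The bound for a prime ideal *)

Section MainBound.
Context {N d : nat} {K : closedFieldType}.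
Variables (Q : {mpoly K[N]} -> Prop) (y : 'I_d.+1 -> {mpoly K[N]}).
Variables (L : fieldType) (pi0 : {rmorphism {mpoly K[N]} -> L})
  (phi : {rmorphism {mpoly K[d]} -> L}) (k : nat) (w : 'I_k -> {mpoly K[N]}).
Hypothesis fr : affine_frame Q y pi0 phi w.
Variables (delta : nat) (io : 'I_delta -> 'I_k) (a : {mpoly K[d]}).
Hypothesis a0 : a != 0.
Local Notation g := (fun i : 'I_delta => w (io i)).
Hypothesis ind : forall c : 'I_delta -> {mpoly K[d]},
  \sum_i phi (c i) * pi0 (w (io i)) = 0 -> forall i, c i = 0.
Hypothesis gen : forall j, exists c : 'I_delta -> {mpoly K[d]},
  phi a * pi0 (w j) = \sum_i phi (c i) * pi0 (w (io i)).

Lemma phi_lin_inj (c c' : 'I_delta -> {mpoly K[d]}) :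
  \sum_i phi (c i) * pi0 (g i) = \sum_i phi (c' i) * pi0 (g i) -> c =1 c'.
Proof.
move=> e i; apply/eqP; rewrite -subr_eq0; apply/eqP.
apply: (ind (c := fun i => c i - c' i)).
under eq_bigr do rewrite rmorphB mulrBl.
by rewrite sumrB e subrr.
Qed.

Lemma rank_repr : exists c0 : nat, forall m f, f \is m.-homog ->
  exists al : 'I_delta -> {mpoly K[d]}, (forall i, msize (al i) <= m + c0)%N /\
    phi a * pi0 f = \sum_i phi (al i) * pi0 (g i).
Proof.
have [e he] := choice gen.
exists (\sum_j \sum_i msize (e j i)).+1 => m f hf.
have [al [al1 al2]] := frame_gen fr hf.
exists (fun i => \sum_j al j * e j i); split.
  move=> i; apply: msize_sum_le => j; apply: leq_trans (msizeM_le _ _) _.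
  rewrite addnS -addSn; apply: leq_add; first exact: al1.
  by rewrite (bigD1 j) //= (bigD1 i) //= -addnA leq_addr.
rewrite al2 mulr_sumr; under [RHS]eq_bigr do rewrite rmorph_sum mulr_suml.
rewrite exchange_big /=; apply: eq_bigr => j _.
by rewrite mulrCA he mulr_sumr; apply: eq_bigr => i _; rewrite rmorphM mulrA.
Qed.

(** [M] is a times the matrix of multiplication by f, so its determinant is the norm up to a power
    of a. The excess [c1] of the degree is independent of f. *)
Lemma rank_matrix : exists c1 : nat, forall m f, f \is m.-homog ->
  exists M : 'M[{mpoly K[d]}]_delta, (forall i j, msize (M i j) <= m + c1)%N /\
    forall j, phi a * (pi0 f * pi0 (g j)) = \sum_i phi (M i j) * pi0 (g i).
Proof.
have [c0 hc0] := rank_repr; have [D hD] := frame_w fr.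
exists (D + c0)%N => m f hf.
have h j : exists al : 'I_delta -> {mpoly K[d]}, (forall i, msize (al i) <= m + (D + c0))%N /\
    phi a * (pi0 f * pi0 (g j)) = \sum_i phi (al i) * pi0 (g i).
  have [e eD we] := hD (io j); have [al [al1 al2]] := hc0 _ _ (dhomogM hf we).
  exists al; split; last by rewrite -rmorphM.
  by move=> i; apply: leq_trans (al1 i) _; rewrite addnA leq_add2r leq_add2l.
have [al hal] := choice h.
exists (\matrix_(i, j) al j i); split; first by move=> i j; rewrite mxE; case: (hal j).
by move=> j; under eq_bigr do rewrite mxE; case: (hal j).
Qed.

Variables (p : 'I_d -> K) (xi : 'I_N -> K).
Hypotheses (ap : a.@[p] != 0) (kxi : forall f, pi0 f = 0 -> f.@[xi] = 0)
  (txi : forall i, (y (lift ord0 i)).@[xi] = p i).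

(** Evaluation at [xi] factors through [pi0] and sends phi(q) to q(p), so relations in [L]
    specialize to relations in [K]. *)
Lemma phi_relation_at_point (q : {mpoly K[d]}) (f : {mpoly K[N]}) (c : 'I_delta -> {mpoly K[d]}) :
  phi q * pi0 f = \sum_i phi (c i) * pi0 (g i) ->
  q.@[p] * f.@[xi] = \sum_i (c i).@[p] * (g i).@[xi].
Proof.
have ev (r : {mpoly K[d]}) : (subst (y \o lift ord0) r).@[xi] = r.@[p].
  by rewrite meval_subst; apply: meval_eq => i; rewrite /= txi.
move=> e; have /kxi : pi0 (subst (y \o lift ord0) q * f - \sum_i subst (y \o lift ord0) (c i) * g i) = 0.
  apply/eqP; rewrite rmorphB subr_eq0 rmorphM -(frame_phi fr) e rmorph_sum; apply/eqP.
  by apply: eq_bigr => i _; rewrite rmorphM -(frame_phi fr).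
move/eqP; rewrite mevalB subr_eq0 mevalM ev raddf_sum /= => /eqP ->.
by apply: eq_bigr => i _; rewrite mevalM ev.
Qed.

Definition shift : {mpoly K[d]} -> {mpoly K[d]} :=
  mmap (@mpolyC d K) (fun i => 'X_i + (p i)%:MP).

HB.instance Definition _ := GRing.RMorphism.on shift.

(** Vanishing at [p] to a given order is tested on the lines through [p], where it becomes
    divisibility by a power of X. *)
Definition along (t : 'I_d -> K) : {mpoly K[d]} -> {poly K} :=
  mmap polyC (fun i => (p i)%:P + t i *: 'X).

HB.instance Definition _ t := GRing.RMorphism.on (along t).

Lemma along_horner t q c : (along t q).[c] = q.@[fun i => p i + t i * c].
Proof.
rewrite -[LHS]/(horner_eval c (along t q)) /along rmorph_mmap.
by apply: eq_mmap => [b|i] /=; rewrite horner_evalE ?hornerC // hornerD hornerC hornerZ hornerX.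
Qed.

Lemma along_shift t q j : (along t q)`_j = (homog_part j (shift q)).@[t].
Proof.
have -> : along t q = mmap polyC (fun i => t i *: 'X) (shift q).
  rewrite /shift rmorph_mmap; apply: eq_mmap => [b|i] /=; first by rewrite mmapC.
  by rewrite mmapD mmapX mmap1U mmapC addrC.
have -> : (homog_part j (shift q)).@[t] =
    \sum_(b <- msupp (shift q) | mdeg b == j) (shift q)@_b * \prod_i t i ^+ b i.
  rewrite /homog_part (raddf_sum (meval t)); apply: eq_bigr => b _.
  by rewrite /= mevalZ mevalX.
rewrite [in LHS]/mmap coef_sum [RHS]big_mkcond; apply: eq_bigr => b _.
rewrite mul_polyC coefZ /mmap1 (eq_bigr (fun i => (t i ^+ b i) *: 'X^(b i))) => [|i _]; last by rewrite exprZn.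
rewrite scaler_prod prodrXr -mdegE coefZ coefXn eq_sym.
by case: eqP; rewrite ?mulr1 ?mulr0.
Qed.

Lemma size_along t q : (size (along t q) <= msize q)%N.
Proof.
rewrite /along /mmap; apply: leq_trans (size_sum _ _ _) _.
rewrite big_seq; apply/bigmax_leqP_seq => b _ hb; rewrite mul_polyC.
apply: leq_trans (size_scale_leq _ _) _; apply: leq_trans (msize_mdeg_lt hb).
rewrite /mmap1 mdegE.
apply: (big_ind2 (fun (u : {poly K}) (n : nat) => (size u <= n.+1)%N)).
- by rewrite size_poly1.
- move=> u m v n hu hv; apply: leq_trans (size_polyMleq _ _) _.
  by rewrite -ltnS; move: (leq_add hu hv); case: (size u + size v)%N => // l; rewrite addSn addnS.
move=> i _; apply: leq_trans (size_poly_exp_leq _ _) _; rewrite ltnS.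
rewrite -[X in (_ <= X)%N]mul1n leq_mul2r -subn1 leq_subLR; apply/orP; right.
apply: leq_trans (size_polyD _ _) _; rewrite geq_max (leq_trans (size_polyC_leq1 _)) //.
by apply: leq_trans (size_scale_leq _ _) _; rewrite size_polyX.
Qed.

(* The norm of [f] (the determinant of multiplication by [f]) vanishes at the
   point [p] to order more than [m * delta], whereas its degree is at most
   [m * delta]. The latter only holds up to denominators [a], which are made
   negligible by passing to high powers of [f]. *)
Lemma vanishing_order_eq0 m f (al : 'I_delta -> {mpoly K[d]}) :
  f \is m.-homog -> phi a * pi0 f = \sum_i phi (al i) * pi0 (g i) ->
  (forall i b, (mdeg b < m)%N -> (shift (al i))@_b = 0) ->
  (forall b, mdeg b = m -> \sum_i (g i).@[xi] * (shift (al i))@_b = 0) ->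
  pi0 f = 0.
Proof.
move=> hf hal low top.
have [c1 hM] := rank_matrix.
have hfs (s : nat) : f ^+ s.+1 \is (m * s.+1).-homog by apply: dhomogMn.
have [Ms hMs] := choice (fun s => hM _ _ (hfs s)).
pose M := Ms 0%N.
have hMf j : phi a * (pi0 f * pi0 (g j)) = \sum_i phi (M i j) * pi0 (g i).
  by rewrite -(proj2 (hMs 0%N)) expr1.
(* [Ms s] belongs to f^(s+1). Each matrix carries one factor a, so the product of two of them is a
   times the matrix of the product. *)
have detMs t s : along t a ^+ delta * along t (\det (Ms s.+1)) = along t (\det M) * along t (\det (Ms s)).
  rewrite -rmorphXn -!rmorphM /= -detZ -det_mulmx; congr (along t (\det _)).
  apply/matrixP => i j; rewrite !mxE; move: i.
  apply: phi_lin_inj; transitivity (phi a * (phi a * (pi0 (f ^+ s.+2) * pi0 (g j)))).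
    rewrite (proj2 (hMs s.+1)) mulr_sumr; apply: eq_bigr => i _.
    by rewrite rmorphM mulrA.
  transitivity (\sum_l phi (Ms s l j) * \sum_i phi (M i l) * pi0 (g i)); last first.
    under eq_bigr do rewrite mulr_sumr; rewrite exchange_big /=; apply: eq_bigr => i _.
    rewrite rmorph_sum mulr_suml; apply: eq_bigr => l _.
    by rewrite rmorphM mulrA [phi (M i l) * _]mulrC.
  under [RHS]eq_bigr do rewrite -hMf.
  have -> : phi a * (phi a * (pi0 (f ^+ s.+2) * pi0 (g j))) =
     phi a * pi0 f * (phi a * (pi0 (f ^+ s.+1) * pi0 (g j))).
    by rewrite (exprS f) rmorphM; ring.
  by rewrite (proj2 (hMs s)) mulr_sumr; apply: eq_bigr => l _; ring.
have hg l : exists e : nat, g l \is e.-homog.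
  by have [D hD] := frame_w fr; have [e _ he] := hD (io l); exists e.
have [e hw] := choice hg.
have [C hC] := choice (fun l => hM _ _ (hw l)).
(* [C l] is a times multiplication by g_l, and a f is the sum of the al_l g_l. *)
have aM i j : a * M i j = \sum_l al l * C l i j.
  move: i; apply: phi_lin_inj; transitivity (phi a * (phi a * (pi0 f * pi0 (g j)))).
    by rewrite hMf mulr_sumr; apply: eq_bigr => i _; rewrite rmorphM mulrA.
  transitivity (\sum_l phi (al l) * \sum_i phi (C l i j) * pi0 (g i)); last first.
    under eq_bigr do rewrite mulr_sumr; rewrite exchange_big /=; apply: eq_bigr => i _.
    by rewrite rmorph_sum mulr_suml; apply: eq_bigr => l _; rewrite rmorphM mulrA.
  under [RHS]eq_bigr do rewrite -(proj2 (hC _)).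
  have -> : phi a * (phi a * (pi0 f * pi0 (g j))) = (phi a * pi0 f) * (phi a * pi0 (g j)) by ring.
  by rewrite hal mulr_suml; apply: eq_bigr => l _; ring.
(* a(p) is a combination of the g_i(xi), by expanding a times 1, and it is nonzero. *)
have beta0 : exists i, (g i).@[xi] != 0.
  have [c hc] := rank_repr; have [ep [_ hep]] := hc 0%N 1 (dhomog1 _ _).
  have := phi_relation_at_point hep; rewrite meval1 mulr1 => e1.
  apply: contrapT => h; case/eqP: ap; rewrite e1 big1 // => i _.
  suff -> : (w (io i)).@[xi] = 0 by rewrite mulr0.
  by apply: contrapT => /eqP ne; apply: h; exists i.
(* On the line in direction t the coordinates of f are X^m A_l, so a M = X^m E and a^delta det M =
   X^(m delta) det E. One further factor X comes from E being singular at 0. *)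
have key (t : 'I_d -> K) : dvdp 'X^((m * delta).+1) (along t (\det M)).
  have hA l : exists A : {poly K}, along t (al l) = 'X^m * A.
    have : dvdp 'X^m (along t (al l)).
      apply/dvdpP; exists (\poly_(i < size (along t (al l))) (along t (al l))`_(i + m)).
      apply/polyP => i; rewrite coefMXn; case: ltnP => hi.
        rewrite along_shift (_ : homog_part i _ = 0) ?meval0 //.
        by apply/mpolyP => b; rewrite mcoeff_homog_part mcoeff0; case: eqP => // hb; rewrite low // hb.
      rewrite coef_poly subnK //; case: ltnP => // h2; apply: nth_default.
      by apply: leq_trans h2 (leq_subr _ _).
    by move=> /dvdpP [A ->]; exists A; rewrite mulrC.
  have [A hA'] := choice hA.
  pose E : 'M[{poly K}]_delta := \matrix_(i, j) \sum_l A l * along t (C l i j).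
  have eE : along t a *: map_mx (along t) M = 'X^m *: E.
    apply/matrixP => i j; rewrite !mxE -rmorphM /= aM rmorph_sum mulr_sumr.
    by apply: eq_bigr => l _; rewrite rmorphM /= hA' mulrA.
  have detE : along t a ^+ delta * along t (\det M) = 'X^(m * delta) * \det E.
    by rewrite -det_map_mx -detZ eE detZ -exprM.
  have Al0 l : (A l).[0] = (along t (al l))`_m.
    by rewrite hA' coefXnM ltnn subnn horner_coef0.
  have al0 q : (along t q).[0] = q.@[p].
    by rewrite along_horner; apply: meval_eq => i; rewrite mulr0 addr0.
  (* The row of the g_i(xi) is a left eigenvector of each C_l(p) with eigenvalue a(p) g_l(xi). Its
     product with E(0) therefore contains the factor sum of the g_l(xi) A_l(0), which is zero by
     [top]. *)
  have E0 : \det (map_mx (horner_eval 0) E) == 0.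
    apply/det0P; exists (\row_i (g i).@[xi]).
      have [i hi] := beta0; apply/eqP => /rowP /(_ i); rewrite !mxE => h.
      by rewrite h eqxx in hi.
    apply/rowP => j; rewrite !mxE.
    transitivity (\sum_l (A l).[0] * (a.@[p] * ((g l).@[xi] * (g j).@[xi]))).
      under eq_bigr do rewrite !mxE horner_evalE horner_sum mulr_sumr.
      rewrite exchange_big /=; apply: eq_bigr => l _.
      rewrite -mevalM (phi_relation_at_point (c := fun i => C l i j)); last first.
        by rewrite rmorphM (proj2 (hC l)).
      by rewrite mulr_sumr; apply: eq_bigr => i _; rewrite hornerM al0; ring.
    have -> : \sum_l (A l).[0] * (a.@[p] * ((g l).@[xi] * (g j).@[xi])) =
      (\sum_l (g l).@[xi] * (A l).[0]) * (a.@[p] * (g j).@[xi]).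
      by rewrite mulr_suml; apply: eq_bigr => l _; ring.
    suff -> : \sum_l (g l).@[xi] * (A l).[0] = 0 by rewrite mul0r.
    have -> : \sum_l (g l).@[xi] * (A l).[0] =
        (homog_part m (\sum_l (g l).@[xi] *: shift (al l))).@[t].
      rewrite homog_partE (raddf_sum (pihomog mdeg m)) (raddf_sum (meval t)) /=; apply: eq_bigr => l _.
      by rewrite Al0 along_shift linearZ mevalZ.
    rewrite (_ : homog_part m _ = 0) ?meval0 //; apply/mpolyP => b.
    rewrite mcoeff_homog_part mcoeff0; case: eqP => // hb; rewrite raddf_sum -[RHS](top b hb).
    by apply: eq_bigr => l _; rewrite /= mcoeffZ.
  have XE : dvdp 'X (\det E).
    rewrite -['X]subr0 -(polyC0 K) dvdp_XsubCl /root -horner_evalE.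
    by move: E0; rewrite det_map_mx.
  have : dvdp 'X^((m * delta).+1) (along t a ^+ delta * along t (\det M)).
    by rewrite detE exprSr dvdp_mul.
  (* The restriction of a has the nonzero value a(p) at 0, so it is prime to X and can be
     cancelled. *)
  rewrite Gauss_dvdpr //; apply: coprimep_expl; apply: coprimep_expr.
  by rewrite -['X]subr0 -(polyC0 K) coprimep_sym coprimep_XsubC /root al0.
have ata t : along t a != 0.
  apply/eqP => h; move: ap; rewrite -(meval_eq _ (v1 := fun i => p i + t i * 0)).
    by rewrite -along_horner h horner0 eqxx.
  by move=> i; rewrite mulr0 addr0.
(* The second part carries a vanishing determinant for a power of f back to f itself. *)
have powers (t : 'I_d -> K) s : dvdp 'X^((m * delta).+1 * s.+1) (along t (\det (Ms s))) /\
    (along t (\det (Ms s)) = 0 -> along t (\det M) = 0).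
  elim: s => [|s [IH1 IH2]]; first by rewrite muln1; split.
  split; last first.
    move=> h; have := detMs t s; rewrite h mulr0 => /esym /eqP; rewrite mulf_eq0.
    by case/orP => /eqP h'; [exact: h'|exact: IH2 h'].
  have : dvdp 'X^((m * delta).+1 * s.+2) (along t a ^+ delta * along t (\det (Ms s.+1))).
    by rewrite detMs mulnS exprD; apply: dvdp_mul; [exact: key|exact: IH1].
  rewrite Gauss_dvdpr //; apply: coprimep_expl; apply: coprimep_expr.
  rewrite -['X]subr0 -(polyC0 K) coprimep_sym coprimep_XsubC /root along_horner.
  by rewrite (meval_eq (v2 := p)) // => i; rewrite mulr0 addr0.
have dM t : along t (\det M) = 0.
  (* Each factor f contributes m delta + 1 to the order of vanishing, while the degree is at most m
     delta per factor plus delta c1 in total. With delta c1 + 1 factors the order exceeds the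
     degree. *)
  have [h1 h2] := powers t (delta * c1)%N; apply: h2; apply: contrapT => /eqP n0.
  have := leq_trans (dvdp_leq n0 h1) (leqnn _); rewrite size_polyXn => h.
  have sz : (size (along t (\det (Ms (delta * c1)%N))) <= (delta * (m * (delta * c1).+1 + c1)).+1)%N.
    rewrite -det_map_mx; apply: size_det_le => i j; rewrite mxE.
    by apply: leq_trans (size_along _ _) _; apply: leqW; case: (hMs (delta * c1)%N).
  have e1 : ((m * delta).+1 * (delta * c1).+1 = (delta * (m * (delta * c1).+1 + c1)).+1)%N by ring.
  by move: (leq_trans h sz); rewrite e1 ltnn.
have detM : \det M = 0.
  apply: contrapT => /eqP /mpoly_nonroot [x].
  have := along_horner (fun i => x i - p i) (\det M) 1; rewrite dM horner0.
  rewrite (meval_eq (v2 := x)) => [<-|i]; first by rewrite eqxx.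
  by rewrite mulr1 addrC subrK.
have : \det M^T == 0 by rewrite det_tr detM.
(* A kernel vector gives a combination of the g_i annihilated by a f. It is nonzero by independence,
   so f is zero in the field [L]. *)
move=> /det0P [v v0 hv].
have e0 : phi a * pi0 f * (\sum_j phi (v 0 j) * pi0 (g j)) = 0.
  transitivity (\sum_j phi (v 0 j) * \sum_i phi (M i j) * pi0 (g i)).
    by rewrite mulr_sumr; apply: eq_bigr => j _; rewrite -hMf; ring.
  under eq_bigr do rewrite mulr_sumr; rewrite exchange_big big1 //= => i _.
  under eq_bigr do rewrite mulrA -rmorphM; rewrite -mulr_suml -rmorph_sum.
  have := congr1 (fun u : 'rV_delta => u 0 i) hv; rewrite !mxE.
  by under eq_bigr do rewrite mxE; move=> ->; rewrite rmorph0 mul0r.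
move/eqP: e0; rewrite mulf_eq0 => /orP [|/eqP h]; last first.
  by case/eqP: v0; apply/rowP => j; rewrite mxE; apply: ind h j.
rewrite mulf_eq0 => /orP [/eqP /(frame_inj fr) h|/eqP //].
by move: a0; rewrite h eqxx.
Qed.
End MainBound.

(** The same [delta] occurs in both bounds, which later allows the sum of the ranks to be compared
    with the degree of I. The lower bound multiplies the independent elements by monomials in the
    y_i. *)
Theorem prime_hilbert_bounds N d (K : closedFieldType) (Q : {mpoly K[N]} -> Prop)
    (y : 'I_d.+1 -> {mpoly K[N]}) :
  homogeneous_ideal Q -> prime_ideal Q -> noether_params Q y ->
  exists delta D, (forall m, 0 < m -> hilbert_le Q m (delta * m ^ d + d))%N /\
    forall M, hilbert_ge Q (D + M) (delta * 'C(M + d, d)).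
Proof.
move=> hQ pQ hy; have [L [pi0 [phi [k [w fr]]]]] := exists_affine_frame hQ pQ hy.
have [delta [io [a [a0 ind gen]]]] := @exists_rank_basis _ _ phi _ (fun j => pi0 (w j)).
have [D hD] := frame_w fr; exists delta, D; split.
  have [p ap] := mpoly_nonroot a0; have [xi [kxi txi]] := frame_point p fr.
  have [c0 hc0] := rank_repr fr gen.
  (* a times 1 is a nonzero combination of the independent elements, so there is at least one. The
     count below contains delta - 1. *)
  have d0 : (0 < delta)%N.
    rewrite lt0n; apply/eqP => e; have [al [_ h]] := hc0 0%N 1 (dhomog1 _ _).
    move/eqP: h; rewrite rmorph1 mulr1 big1 => [/eqP /(frame_inj fr) h|]; first by rewrite h eqxx in a0.
    by move=> i; exfalso; move: (ltn_ord i); rewrite [X in (_ < X)%N]e.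
  case=> // m _ s hs.
  (* For a form of degree m + 1: the Taylor coefficients at [p] of order at most m of all delta
     coordinates, and one combined coefficient for every monomial of degree m + 1. *)
  pose T := (('I_delta * 'X_{1..d < m.+1}) + {b : 'X_{1..d < m.+2} | mdeg (val b) == m.+1})%type.
  pose R f (c : T -> K) := f \is m.+1.-homog /\ exists al : 'I_delta -> {mpoly K[d]},
    [/\ phi a * pi0 f = \sum_i phi (al i) * pi0 (w (io i)),
        forall i b, c (inl (i, b)) = (shift p (al i))@_(val b) &
        forall b, c (inr b) = \sum_i (w (io i)).@[xi] * (shift p (al i))@_(val (val b))].
  have hb : (size s <= #|{: T}|)%N.
    apply: (linear_conditions_bound (R := R) hs) => [f hf|n F C v hF hv].
      have [al [_ hal]] := hc0 _ _ hf.
      exists (fun t => match t with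
        | inl u => (shift p (al u.1))@_(val u.2)
        | inr b => \sum_i (w (io i)).@[xi] * (shift p (al i))@_(val (val b)) end).
      by split=> //; exists al.
    have hom : \sum_i v i *: F i \is m.+1.-homog.
      by apply: rpred_sum => i _; apply: dhomogZ; case: (hF i).
    have [al hal] := choice (fun i => proj2 (hF i)).
    have shE i : shift p (\sum_j (v j)%:MP * al j i) = \sum_j v j *: shift p (al j i).
      rewrite rmorph_sum; apply: eq_bigr => j _.
      by rewrite rmorphM /= /shift mmapC mul_mpolyC.
    apply/(frame_homog fr hom).
    apply: (@vanishing_order_eq0 _ _ _ _ _ _ _ _ _ _ fr _ _ _ a0 ind gen p xi ap kxi txi
      m.+1 _ (fun i => \sum_j (v j)%:MP * al j i) hom).
    - rewrite rmorph_sum mulr_sumr; under [RHS]eq_bigr do rewrite rmorph_sum mulr_suml.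
      rewrite exchange_big /=; apply: eq_bigr => j _.
      rewrite -mul_mpolyC rmorphM mulrCA; case: (hal j) => -> _ _; rewrite mulr_sumr.
      apply: eq_bigr => i _; rewrite rmorphM mulrA; congr (_ * _ * _).
      by rewrite (frame_phi fr) /subst mmapC.
    - move=> i b hb; rewrite shE raddf_sum -[RHS](hv (inl (i, BMultinom hb))).
      by apply: eq_bigr => j _; rewrite /= mcoeffZ; case: (hal j) => _ -> _.
    - move=> b hb; have hb' : (mdeg b < m.+2)%N by rewrite hb.
      pose b' : {b : 'X_{1..d < m.+2} | mdeg (val b) == m.+1} := exist _ (BMultinom hb') (introT eqP hb).
      rewrite -[RHS](hv (inr b')).
      under eq_bigr do rewrite shE raddf_sum mulr_sumr.
      rewrite exchange_big /=; apply: eq_bigr => j _; case: (hal j) => _ _ ->.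
      by rewrite mulr_sumr; apply: eq_bigr => i _; rewrite /= mcoeffZ mulrCA.
  apply: leq_trans hb _; rewrite card_sum card_prod card_ord card_sig card_multinom_deg.
  rewrite card_bmultinom.
  (* The count is delta X + (C - X) = (delta - 1) X + C with [X] and [C] the two binomials named
     below, where X <= E and C <= E + d. *)
  have h1 := bin_le_expn d m; have h2 := @bin_le_expn_add d m.+1 isT.
  case: delta d0 {io ind gen hc0 T R} => // delta _.
  set X := 'C(m + d, d) in h1 *; set C := 'C(m.+1 + d, d) in h2 *; set E := (m.+1 ^ d)%N in h1 h2 *.
  have h3 : (delta * X <= delta * E)%N by rewrite leq_mul2l h1 orbT.
  rewrite !mulSn; lia.
move=> M.
have [e he] : exists e : 'I_delta -> nat, forall i, (e i <= D)%N /\ w (io i) \is (e i).-homog.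
  have h i : exists e : nat, (e <= D)%N /\ w (io i) \is e.-homog.
    by have [e e1 e2] := hD (io i); exists e.
  by have [e h'] := choice h; exists e.
have [y1 _ _] := hy.
(* The power of y_0 brings all products to the same degree D + M, and [pi0] sends it to 1. *)
pose F (t : 'I_delta * 'X_{1..d < M.+1}) : {mpoly K[N]} :=
  y ord0 ^+ (M - mdeg (val t.2) + (D - e t.1)) *
  (subst (y \o lift ord0) 'X_[val t.2] * w (io t.1)).
have homF t : F t \is (D + M).-homog.
  have hb : (mdeg (val t.2) <= M)%N by rewrite -ltnS bmdeg.
  have -> : (D + M = 1 * (M - mdeg (val t.2) + (D - e t.1)) + (mdeg (val t.2) + e t.1))%N.
    by have := (he t.1).1; lia.
  apply: dhomogM; first exact: dhomogMn.
  apply: dhomogM; last by case: (he t.1).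
  by apply: subst_homog => [i|]; [exact: y1|rewrite dhomogX].
have piF t : pi0 (F t) = phi 'X_[val t.2] * pi0 (w (io t.1)).
  by rewrite /F !rmorphM rmorphXn (frame_y0 fr) expr1n mul1r (frame_phi fr).
have <- : #|{: 'I_delta * 'X_{1..d < M.+1}}| = (delta * 'C(M + d, d))%N.
  by rewrite card_prod card_ord card_bmultinom.
apply: (hilbert_ge_family homF) => c /(frame_ideal fr) hc [i b].
pose q (j : 'I_delta) : {mpoly K[d]} := \sum_(b : 'X_{1..d < M.+1}) c (j, b) *: 'X_[val b].
have q0 : q i = 0.
  apply: ind; rewrite -[RHS]hc rmorph_sum.
  rewrite (eq_bigr (fun t => pi0 (c (t.1, t.2) *: F (t.1, t.2)))); last by case.
  rewrite -(pair_bigA _ (fun j b => pi0 (c (j, b) *: F (j, b)))) /=; apply: eq_bigr => j _.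
  rewrite rmorph_sum mulr_suml; apply: eq_bigr => b' _.
  rewrite -!mul_mpolyC (rmorphM pi0) piF mulrA (rmorphM phi); congr (_ * _ * _).
  by rewrite (frame_phi fr) /subst mmapC.
have := congr1 (mcoeff (val b)) q0; rewrite mcoeff0 raddf_sum (bigD1 b) //= mcoeffZ mcoeffX eqxx mulr1.
rewrite big1 ?addr0 // => b' ne; rewrite mcoeffZ mcoeffX.
by case: eqP => [/val_inj e'|]; [case/eqP: ne|rewrite mulr0].
Qed.

(** * Growth and dimension *)

Section Growth.
Context {N : nat} {k : fieldType}.
Implicit Types (I J Q : {mpoly k[N]} -> Prop).

Lemma hilbert_ge_elim I m v : hilbert_ge I m v -> exists g : 'I_v -> {mpoly k[N]},
  (forall t, g t \is m.-homog) /\ (forall c : 'I_v -> k, I (\sum_t c t *: g t) -> forall t, c t = 0).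
Proof.
move=> [s [sz hs]]; subst v; exists (fun t => s`_t); split.
  by move=> t; case: hs => /allP h _; apply: h; rewrite mem_nth.
move=> c h t; have /rowP/(_ t) : \row_t c t = 0.
  by apply: (indep_mod_row hs); under eq_bigr do rewrite mxE.
by rewrite !mxE.
Qed.

(** A measure of dimension that needs no Hilbert polynomial: growth of order b along an arithmetic
    progression. The shift [e.+1] keeps the degree positive, as the upper bounds hold in positive
    degrees. *)
Definition growth_ge I b := exists c e, forall M, hilbert_ge I (c * M + e.+1) (M ^ b).

Lemma growth_ge_bound I b d A B : growth_ge I b ->
  (forall m, 0 < m -> hilbert_le I m (A * m ^ d + B))%N -> (b <= d)%N.
Proof.
move=> [c [e hc]] hA; rewrite leqNgt; apply/negP => hlt.
(* For M >= 1 the upper bound in degree c M + e + 1 is at most C M^d, and M^(d+1) exceeds this as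
   soon as M > C. *)
pose C := (A * (c + e.+1) ^ d + B)%N; pose M := C.+1.
have h1 : (M ^ b <= A * (c * M + e.+1) ^ d + B)%N.
  by apply: (hilbert_ge_le (hc M)); apply: hA; rewrite addnS.
have h2 : (A * (c * M + e.+1) ^ d + B <= C * M ^ d)%N.
  rewrite mulnDl leq_add //; last by rewrite leq_pmulr // expn_gt0.
  have mono u v n : (u <= v)%N -> (u ^ n <= v ^ n)%N by case: n => // n h; rewrite leq_exp2r.
  rewrite -mulnA leq_mul2l -expnMn mono ?orbT // mulnDl leq_add2l.
  by rewrite leq_pmulr.
have h3 : (M ^ d.+1 <= M ^ b)%N by rewrite leq_pexp2l.
have := leq_trans h3 (leq_trans h1 h2); rewrite expnS leq_pmul2r ?expn_gt0 //.
by rewrite ltnn.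
Qed.

(** The elements g^j F_t, filled up to equal degree by powers of X_i, are independent modulo [Q0]:
    in a relation, divide by the lowest power of g that occurs and reduce modulo [Q1], which
    contains g. *)
Lemma growth_ge_step Q0 Q1 (g : {mpoly k[N]}) e0 i b :
  prime_ideal Q0 -> prime_ideal Q1 -> (forall f, Q0 f -> Q1 f) -> ~ Q1 'X_i ->
  g \is e0.-homog -> Q1 g -> ~ Q0 g -> growth_ge Q1 b -> growth_ge Q0 b.+1.
Proof.
move=> p0 p1 sub Xi hg Qg nQg [c [e hc]]; exists (c + e0)%N, e => M.
have [F [homF indF]] := hilbert_ge_elim (hc M).
have [id0 [_ pr0]] := p0; have [id1 [_ pr1]] := p1.
have -> : (M ^ b.+1)%N = #|{: 'I_M * 'I_(M ^ b)}| by rewrite card_prod !card_ord expnS.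
pose H (t : 'I_M * 'I_(M ^ b)) := g ^+ t.1 * ('X_i ^+ (e0 * (M - t.1)) * F t.2).
apply: (@hilbert_ge_family _ _ _ _ _ H).
  move=> [j t]; rewrite /H /=.
  have -> : ((c + e0) * M + e.+1 = e0 * j + (1 * (e0 * (M - j)) + (c * M + e.+1)))%N.
    rewrite mul1n addnA -mulnDr subnKC; last exact: ltnW.
    by rewrite mulnDl addnA [(c * M + _)%N]addnC.
  apply: dhomogM; first exact: dhomogMn.
  apply: dhomogM; last exact: homF.
  by apply: dhomogMn; rewrite dhomogX /= mdeg1.
move=> u hu.
pose G (j : 'I_M) : {mpoly k[N]} := 'X_i ^+ (e0 * (M - j)) * \sum_t u (j, t) *: F t.
have hG : Q0 (\sum_(j < M) g ^+ j * G j).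
  move: hu; rewrite (eq_bigr (fun t => u (t.1, t.2) *: H (t.1, t.2))); last by case.
  rewrite -(pair_bigA _ (fun j t => u (j, t) *: H (j, t))) /=.
  congr Q0; apply: eq_bigr => j _; rewrite /G !mulr_sumr; apply: eq_bigr => t _.
  by rewrite /H /= -!scalerAr.
have Qpow f n : Q0 (g ^+ n * f) -> Q0 f.
  by elim: n => [|n IH]; rewrite ?expr0 ?mul1r // exprS -mulrA => /pr0 [].
have Xpow f n : Q1 ('X_i ^+ n * f) -> Q1 f.
  by elim: n => [|n IH]; rewrite ?expr0 ?mul1r // exprS -mulrA => /pr1 [].
suff main n : forall j : 'I_M, (j < n)%N -> forall t, u (j, t) = 0.
  by move=> [j t]; apply: (main M).
elim: n => // n IH j; rewrite ltnS leq_eqVlt => /orP [/eqP ej|]; last exact: IH.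
apply: indF; apply: Xpow (e0 * (M - j))%N _; rewrite -/(G j).
have hz (l : 'I_M) : (l < j)%N -> g ^+ l * G l = 0.
  rewrite ej => hl; rewrite /G big1 ?mulr0 // => t _.
  by rewrite (IH l hl) scale0r.
have {}hG : Q0 (G j + g * \sum_(l < M | (j < l)%N) g ^+ (l - j.+1) * G l).
  apply: (Qpow _ j); move: hG; congr Q0.
  rewrite (bigID (fun l : 'I_M => l <= j)%N) /= mulrDr; congr (_ + _).
    rewrite (bigD1 j) //= big1 ?addr0 // => l /andP [h1 h2]; apply: hz.
    by rewrite ltn_neqAle h1 andbT; apply: contra h2 => /eqP h2; apply/eqP/val_inj.
  rewrite !mulr_sumr; apply: eq_big => [l|l]; first by rewrite -ltnNge.
  rewrite -ltnNge => hl; move: (G l) => Gl.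
  by rewrite [g * _]mulrA [g ^+ j * _]mulrA -exprS -exprD addnS -addSn subnKC.
have /(idealB id1) h := sub _ hG.
have := h _ (idealMr id1 (\sum_(l < M | (j < l)%N) g ^+ (l - j.+1) * G l) Qg).
by rewrite addrK.
Qed.

End Growth.

Section Dimension.
Context {N : nat} {K : closedFieldType}.
Implicit Types (Z C X : @pset N K) (Q J : {mpoly K[N]} -> Prop).

Lemma vI_sub Z C : psubset Z C -> forall f, vI C f -> vI Z f.
Proof. by move=> h f hf x /h /hf. Qed.

Lemma closed_sub_vI Z C : proj_closed Z -> proj_closed C ->
  (forall f, vI C f -> vI Z f) -> psubset Z C.
Proof.
move=> cZ cC h x Zx; apply: closed_vanishing => //; split; first exact: closed_nonzero Zx.
by move=> f /h; apply.
Qed.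

Lemma vI_nonirrelevant Z : proj_closed Z -> (exists x, Z x) -> exists i, ~ vI Z 'X_i.
Proof.
move=> cZ [x Zx]; have [i xi] := closed_nonzero cZ Zx; exists i => /(_ _ Zx).
by rewrite mevalXU => e; rewrite e eqxx in xi.
Qed.

(** Each step up the chain makes the vanishing prime strictly smaller, which raises the order of
    growth by one. *)
Lemma chain_growth X (Z : nat -> @pset N K) r : irr_chain X Z r -> growth_ge (vI (Z r)) r.
Proof.
move=> [hZ hlt]; suff main n : (n <= r)%N -> growth_ge (vI (Z n)) n by exact: main.
elim: n => [|n IH] hn.
  have [[cZ [nZ _]] _] := hZ 0%N isT; have [i hi] := vI_nonirrelevant cZ nZ.
  exists 0%N, 0%N => M; rewrite mul0n add0n; have -> : (M ^ 0 = #|{: 'I_1}|)%N by rewrite card_ord.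
  apply: (@hilbert_ge_family _ _ _ _ _ (fun=> 'X_i)) => [t|c]; first by rewrite dhomogX /= mdeg1.
  rewrite big_ord1 => hc t; rewrite (ord1 t); apply: contrapT => /eqP n0; apply: hi.
  by have h := idealZ (vI_ideal _) (c 0)^-1 hc; rewrite scalerA mulVf ?scale1r in h.
have [irr1 _] := hZ _ (ltnW hn); have [irr0 _] := hZ _ hn.
have [s [x [Z0x Z1x]]] := hlt _ hn.
have [cZ1 [nZ1 _]] := irr1; have [cZ0 _] := irr0; have [i hi] := vI_nonirrelevant cZ1 nZ1.
have [g [g1 g2]] : exists g, vI (Z n) g /\ ~ vI (Z n.+1) g.
  apply: contrapT => h; apply: Z1x; apply: (closed_sub_vI cZ0 cZ1) Z0x => f hf.
  by apply: contrapT => nf; apply: h; exists f.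
have [e he] : exists e, ~ vI (Z n.+1) (homog_part e g).
  apply: contrapT => h; apply: g2; apply: homogeneous_ideal_parts (vI_homog (closed_cone cZ0)) _ => e.
  by apply: contrapT => nf; apply: h; exists e.
apply: (growth_ge_step (vI_prime irr0) (vI_prime irr1) (vI_sub s) hi (homog_part_homog e g)) => //.
  exact: (vI_homog (closed_cone cZ1)).2.
exact: IH (ltnW hn).
Qed.

Lemma irreducible_vanishing_set Q : homogeneous_ideal Q -> prime_ideal Q ->
  (exists i, ~ Q 'X_i) -> irreducible_closed (vanishing_set Q).
Proof.
move=> hQ pQ nQ; have NS := prime_nullstellensatz hQ pQ nQ.
have [idQ [Q1 prQ]] := pQ.
split; first exact: vanishing_set_closed.
split.
  apply: contrapT => h; apply: Q1; apply: NS => x Vx; case: h; by exists x.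
move=> C1 C2 [J1 [h1 e1]] [J2 [h2 e2]] hC; apply: contrapT => /not_orP [n1 n2].
have find C J : (forall x, C x <-> nonzero_pt x /\ forall f, J f -> f.@[x] = 0) ->
    ~ psubset (vanishing_set Q) C -> exists2 f, J f & ~ Q f.
  move=> e n; apply: contrapT => h; apply: n => x [nx hx]; apply/e; split => // f Jf.
  by apply: hx; apply: contrapT => nf; apply: h; exists f.
have [f1 J1f nf1] := find _ _ e1 n1; have [f2 J2f nf2] := find _ _ e2 n2.
have : Q (f1 * f2).
  apply: NS => x /hC [/e1 [_ h]|/e2 [_ h]]; rewrite mevalM; first by rewrite h // mul0r.
  by rewrite [f2.@[x]]h // mulr0.
by case/prQ.
Qed.

Lemma noether_params_nonirrelevant Q d (y : 'I_d.+1 -> {mpoly K[N]}) :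
  is_ideal Q -> noether_params Q y -> exists i, ~ Q 'X_i.
Proof.
move=> idQ [hy _ ind]; apply: contrapT => h.
have hX i : Q ('X_i - 0%:MP) by rewrite mpolyC0 subr0; apply: contrapT => n; apply: h; exists i.
have := @ideal_congr_mmap _ _ Q idQ _ (fun i => 'X_i) (fun i => 0%:MP) (y ord0) hX.
rewrite mmap_mpolyX -/(subst _ _) subst_const.
have -> : (y ord0).@[fun=> 0] = 0.
  have := meval_scale (fun=> 0) 0 (hy ord0); by rewrite expr1 !mul0r.
rewrite mpolyC0 subr0 => Qy; have := ind 'X_ord0; rewrite /subst mmapX mmap1U => /(_ Qy).
by move/eqP; rewrite -msize_poly_eq0 msizeX.
Qed.

(* Lying over the prime (Y_d) of the ring of Noether parameters. *)
Lemma noether_section Q d (y : 'I_d.+2 -> {mpoly K[N]}) :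
  homogeneous_ideal Q -> prime_ideal Q -> noether_params Q y ->
  exists Q1, [/\ homogeneous_ideal Q1, prime_ideal Q1, forall f, Q f -> Q1 f,
    Q1 (y ord_max) & noether_params Q1 (fun i : 'I_d.+1 => y (lift ord_max i))].
Proof.
move=> hQ pQ hy; have [y1 fin ind] := hy; have [idQ _] := pQ.
have [D hD] := module_generators hQ y1 fin.
have [L [pi ker]] := prime_ideal_field pQ.
have [phi phiE] : exists phi : {rmorphism {mpoly K[d.+2]} -> L}, forall p, phi p = pi (subst y p).
  by exists (pi \o mmap (@mpolyC N K) y).
have phi_inj p : phi p = 0 -> p = 0 by rewrite phiE => /ker; apply: ind.
pose k := #|{: 'X_{1..N < D}}|.
pose w (j : 'I_k) : L := pi 'X_[val (enum_val j)].
have gen f : exists al : 'I_k -> {mpoly K[d.+2]}, pi f = \sum_j phi (al j) * w j.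
  have [al hal] := choice (fun e => hD e _ (homog_part_homog e f)).
  exists (fun j => \sum_(e < msize f) al e (enum_val j)).
  rewrite [in LHS](homog_part_sum (leqnn (msize f))) rmorph_sum /=.
  under [RHS]eq_bigr do rewrite rmorph_sum mulr_suml.
  rewrite exchange_big /=; apply: eq_bigr => e _.
  case: (hal e) => _ /ker /eqP; rewrite rmorphB subr_eq0 => /eqP ->; rewrite rmorph_sum /=.
  rewrite (reindex (fun j : 'I_k => enum_val j)) /=; last exact: (onW_bij _ (@enum_val_bij _)).
  by apply: eq_bigr => j _; rewrite rmorphM phiE.
pose y' (i : 'I_d.+1) := y (lift ord_max i).
pose J := add_ideal Q (fun _ : 'I_1 => y ord_max).
pose S f := exists p : {mpoly K[d.+1]}, p != 0 /\ f = subst y' p.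
(* If p(y') is y_max g modulo [Q], a matrix of multiplication by g makes the determinant of p -
   X_max times that matrix zero. Setting X_max = 0 leaves a power of p, so p = 0. *)
have disj f : J f -> ~ S f.
  move=> [g]; rewrite big_ord1 => Qf [p [p0 ef]]; case/eqP: p0; rewrite {}ef in Qf.
  pose pt : {mpoly K[d.+2]} := mmap (@mpolyC _ K) (fun i => 'X_(lift ord_max i)) p.
  have ept : phi pt = phi 'X_ord_max * pi (g 0).
    have -> : phi pt = pi (subst y' p).
      rewrite phiE /pt /subst; congr (pi _); rewrite rmorph_mmap; apply: eq_mmap => [c|i] /=.
        by rewrite mmapC.
      by rewrite mmapX mmap1U.
    move/ker/eqP: Qf; rewrite rmorphB subr_eq0 => /eqP ->.
    by rewrite rmorphM mulrC phiE /subst mmapX mmap1U.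
  have gen' b : exists al : 'I_k -> {mpoly K[d.+2]}, pi (g 0) * w b = \sum_j phi (al j) * w j.
    by rewrite /w -rmorphM; apply: gen.
  have [al hal] := choice gen'.
  pose M : 'M[{mpoly K[d.+2]}]_k := pt%:M - 'X_ord_max *: \matrix_(b, c) al b c.
  pose wv : 'cV[L]_k := \col_b w b.
  have Mw : map_mx phi M *m wv = 0.
    rewrite map_mxB mulmxBl; apply/eqP; rewrite subr_eq0; apply/eqP.
    rewrite map_scalar_mx mul_scalar_mx; apply/colP => b; rewrite !mxE ept -mulrA hal mulr_sumr.
    by apply: eq_bigr => c _; rewrite !mxE mulrA; congr (_ * _); exact: esym (rmorphM phi _ _).
  have dw b : phi (\det M) * w b = 0.
    have : \adj (map_mx phi M) *m (map_mx phi M *m wv) = 0 by rewrite Mw mulmx0.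
    by rewrite mulmxA mul_adj_mx mul_scalar_mx det_map_mx => /colP /(_ b); rewrite !mxE.
  have [a1 ha1] := gen 1.
  have /phi_inj d0 : phi (\det M) = 0.
    rewrite -[LHS]mulr1 -[X in _ * X](rmorph1 pi) ha1 mulr_sumr big1 // => j _.
    by rewrite mulrCA dw mulr0.
  pose z : {rmorphism {mpoly K[d.+2]} -> {mpoly K[d.+1]}} :=
    mmap (@mpolyC _ K) (fun i => if unlift ord_max i is Some j then 'X_j else 0).
  have zX : z 'X_ord_max = 0 by rewrite /z /= mmapX mmap1U unlift_none.
  have zp : z pt = p.
    rewrite /z /pt /= rmorph_mmap -[RHS](mmap_mpolyX p); apply: eq_mmap => [c|i] /=; first by rewrite mmapC.
    by rewrite mmapX mmap1U liftK.
  have := congr1 z d0; rewrite -det_map_mx map_mxB map_mxZ zX scale0r subr0 map_scalar_mx /= zp.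
  by rewrite det_scalar rmorph0 => /eqP; rewrite expf_eq0 => /andP [_ /eqP].
have sub0 : subst y' 1 = 1 by rewrite /subst rmorph1.
have [||||P [pP JP PS]] := @exists_prime_avoiding _ _ J S.
- exact: add_ideal_ideal.
- by exists 1; rewrite sub0 oner_eq0.
- move=> _ _ [p [p0 ->]] [q [q0 ->]]; exists (p * q); split; first by rewrite mulf_neq0.
  by rewrite /subst rmorphM.
- exact: disj.
have [hC pC] := homog_core_prime pP; have [idP _] := pP; have [idC _] := pC.
have QC : forall f, Q f -> homog_core P f.
  by apply: sub_homog_core => // f Qf; apply/JP/add_idealQ.
exists (homog_core P); split => //.
  move=> e; case: (eqVneq 1%N e) => [<-|ne]; last by rewrite homog_partE (pihomog_ne0 ne) //; apply: ideal0.
  by rewrite homog_part_id //; apply/JP; exact: (add_ideal_gen (fun=> y ord_max) ord0).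
split; first by move=> i; apply: y1.
  (* In the integrality relations the term of y_max may be dropped, since it lies in the new
     ideal. *)
  move=> i; have [e [g hg]] := fin i; exists e, (fun j => g (lift ord_max j)).
  move: (QC _ hg); rewrite (bigD1_ord ord_max) //= opprD addrCA => h.
  apply: (idealBr idC _ (ideal0 idC)); rewrite subr0.
  have Cy : homog_core P (- (g ord_max * y ord_max)).
    apply: (idealN idC); apply: (idealMl idC) => f; case: (eqVneq 1%N f) => [<-|ne].
      by rewrite homog_part_id //; apply/JP; exact: (add_ideal_gen (fun=> y ord_max) ord0).
    by rewrite homog_partE (pihomog_ne0 ne) //; apply: ideal0.
  by have := idealB idC h Cy; rewrite addrAC subrr add0r.
move=> p /(homog_core_sub idP) Pp; apply: contrapT => /eqP p0.
by apply: (PS _ Pp); exists p.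
Qed.

(** Each section by a Noether parameter gives a smaller irreducible set, strictly smaller because
    the parameter is not in [Q]. *)
Lemma exists_chain d Q (y : 'I_d.+1 -> {mpoly K[N]}) :
  homogeneous_ideal Q -> prime_ideal Q -> noether_params Q y ->
  exists Z : nat -> @pset N K, irr_chain (vanishing_set Q) Z d.
Proof.
elim: d Q y => [|d IH] Q y hQ pQ hy; have nQ := noether_params_nonirrelevant hQ.1 hy;
  have irrQ := irreducible_vanishing_set hQ pQ nQ.
  by exists (fun=> vanishing_set Q); split=> [i _|i]; [split|rewrite ltn0].
have [Q1 [hQ1 pQ1 sub Q1y hy1]] := noether_section hQ pQ hy.
have [Z [hZ1 hZ2]] := IH _ _ hQ1 pQ1 hy1.
have subV : psubset (vanishing_set Q1) (vanishing_set Q).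
  by move=> x [nx hx]; split => // f /sub /hx.
exists (fun i => if (i <= d)%N then Z i else vanishing_set Q); split.
  move=> i; case: (leqP i d) => hi _; last by split.
  by have [h1 h2] := hZ1 _ hi; split => // x /h2 /subV.
move=> i; rewrite ltnS => hi; rewrite hi; case: ltnP => hi'; first exact: hZ2.
have ei : i = d by apply/eqP; rewrite eqn_leq hi.
rewrite {}ei in hi hi' *; have [_ h2] := hZ1 d (leqnn d).
split; first by move=> x /h2 /subV.
have nQy : ~ Q (y ord_max).
  have [_ _ ind] := hy => Qy; have := ind 'X_ord_max; rewrite /subst mmapX mmap1U => /(_ Qy).
  by move/eqP; rewrite -msize_poly_eq0 msizeX.
apply: contrapT => h; apply: nQy; apply: prime_nullstellensatz => // x Vx.
apply: contrapT => /eqP n0; apply: h; exists x; split => // /h2 [_ /(_ _ Q1y)] e.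
by rewrite e eqxx in n0.
Qed.

(** The bound on the length of chains takes the place of the Noetherian property: a set that is not
    maximal lets the chain grow by one step. *)
Lemma component_exists X d Z0 : (forall (Z : nat -> @pset N K) r, irr_chain X Z r -> (r <= d)%N) ->
  irreducible_closed Z0 -> psubset Z0 X -> exists C, irr_component X C /\ psubset Z0 C.
Proof.
move=> hd irr0 sub0.
have step (Z : nat -> @pset N K) r : irr_chain X Z r -> ~ irr_component X (Z r) ->
    exists2 Z' : nat -> @pset N K, irr_chain X Z' r.+1 & psubset (Z r) (Z' r.+1).
  move=> [hZ hlt] nc; have [irr sub] := hZ r (leqnn r).
  have [C [irrC [sC [CX nC]]]] :
      exists C, irreducible_closed C /\ (psubset (Z r) C /\ (psubset C X /\ ~ psubset C (Z r))).
    apply: contrapT => h; apply: nc; split => //; split => // C h1 h2 h3.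
    by apply: contrapT => h4; apply: h; exists C.
  exists (fun i => if (i <= r)%N then Z i else C); last by rewrite ltnn.
  split; first by move=> i; case: (leqP i r) => hi _; [exact: hZ|split].
  move=> i; rewrite ltnS => hi; rewrite hi; case: ltnP => hi'; first exact: hlt.
  have -> : i = r by apply/eqP; rewrite eqn_leq hi hi'.
  split => //; apply: contrapT => h; apply: nC => x Cx; apply: contrapT => nx.
  by apply: h; exists x.
suff main n (Z : nat -> @pset N K) r : irr_chain X Z r -> (d < n + r)%N ->
    exists C, irr_component X C /\ psubset (Z r) C.
  by apply: (main d.+1 (fun=> Z0) 0%N); rewrite ?addn0.
elim: n Z r => [|n IH] Z r cZ hr; first by have := hd _ _ cZ; rewrite leqNgt hr.
case: (pselect (irr_component X (Z r))) => [h|/(step _ _ cZ) [Z' cZ' sub]]; first by exists (Z r); split => // x.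
have [C [hC sC]] : exists C, irr_component X C /\ psubset (Z' r.+1) C.
  by apply: IH cZ' _; rewrite addnS.
by exists C; split => // x /sub /sC.
Qed.

(** The homogeneous core of the ideal of the vector [x] is the ideal of the line through it, that
    is, of the projective point. *)
Lemma point_irreducible X x : proj_closed X -> X x ->
  exists Z, [/\ irreducible_closed Z, psubset Z X & Z x].
Proof.
move=> cX Xx; have nx := closed_nonzero cX Xx.
pose P (f : {mpoly K[N]}) := f.@[x] = 0.
have pP : prime_ideal P.
  split; last split.
  - split; [exact: meval0|split => f g]; rewrite /P; first by rewrite mevalD => -> ->; rewrite addr0.
    by rewrite mevalM => ->; rewrite mulr0.
  - by rewrite /P meval1 => /eqP; rewrite oner_eq0.
  - by move=> f g; rewrite /P mevalM => /eqP; rewrite mulf_eq0 => /orP [] /eqP; [left|right].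
have [hC pC] := homog_core_prime pP; have [idP _] := pP.
have nC : exists i, ~ homog_core P 'X_i.
  have [i xi] := nx; exists i => /(homog_core_sub idP); rewrite /P mevalXU => e.
  by rewrite e eqxx in xi.
exists (vanishing_set (homog_core P)); split; first exact: irreducible_vanishing_set.
  move=> z [nz hz]; apply: closed_vanishing => //; split => // f hf; apply: hz => d.
  by apply: (vI_homog (closed_cone cX)).2 => //.
by split => // f /(homog_core_sub idP).
Qed.

Lemma point_in_component X d x : proj_closed X ->
  (forall (Z : nat -> @pset N K) r, irr_chain X Z r -> (r <= d)%N) -> X x -> exists C, irr_component X C /\ C x.
Proof.
move=> cX hd Xx; have [Z [irr ZX Zx]] := point_irreducible cX Xx.
by have [C [hC ZC]] := component_exists hd irr ZX; exists C; split => //; apply: ZC.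
Qed.

End Dimension.

(** * Extension of scalars *)

Section BaseChange.
Context {k : fieldType} {K : closedFieldType} (iota : {rmorphism k -> K}).

(** Finite families of [K] free over [k] play the role of a basis of [K] over [k]: polynomials over
    [K] are compared along them, coefficient by coefficient. *)
Definition kfree (e : seq K) := forall l : nat -> k,
  \sum_(i < size e) iota (l i) * e`_i = 0 -> forall i, (i < size e)%N -> l i = 0.

Definition kspan (e : seq K) x := exists l : nat -> k, x = \sum_(i < size e) iota (l i) * e`_i.

Lemma kspan_cat e e' x : kspan e x -> kspan (e ++ e') x.
Proof.
move=> [l ->]; exists (fun i => if (i < size e)%N then l i else 0).
rewrite size_cat big_split_ord /= [X in _ + X]big1 ?addr0 => [|i _]; last first.
  by rewrite ltnNge leq_addr /= rmorph0 mul0r.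
by apply: eq_bigr => i _; rewrite ltn_ord nth_cat ltn_ord.
Qed.

Lemma kspan_mem e x : x \in e -> kspan e x.
Proof.
move=> hx; exists (fun i => (i == index x e)%:R); move: (hx); rewrite -index_mem => hi.
rewrite (bigD1 (Ordinal hi)) //= eqxx rmorph1 mul1r nth_index // big1 ?addr0 // => i ne.
by rewrite (_ : (_ == _) = false) ?rmorph0 ?mul0r //; apply: contraNF ne => /eqP h; apply/eqP/val_inj.
Qed.

Lemma kfree_rcons e x : kfree e -> ~ kspan e x -> kfree (rcons e x).
Proof.
move=> he nx l; rewrite size_rcons big_ord_recr /= nth_rcons ltnn eqxx.
under eq_bigr do rewrite nth_rcons ltn_ord.
move=> h; have l0 : l (size e) = 0.
  apply: contrapT => /eqP n0; apply: nx; exists (fun i => - (l (size e))^-1 * l i).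
  have n0' : iota (l (size e)) != 0 by rewrite fmorph_eq0.
  apply: (mulfI n0'); move/eqP: h; rewrite addrC addr_eq0 => /eqP ->.
  rewrite mulr_sumr -sumrN; apply: eq_bigr => i _.
  by rewrite rmorphM rmorphN fmorphV; field.
move=> i; rewrite ltnS leq_eqVlt => /orP [/eqP -> //|]; apply: he.
by move: h; rewrite l0 rmorph0 mul0r addr0.
Qed.

Lemma kfree_extend (s e : seq K) : kfree e ->
  exists e', kfree (e ++ e') /\ forall x, x \in s -> kspan (e ++ e') x.
Proof.
elim: s e => [|x s IH] e he; first by exists [::]; rewrite cats0.
case: (pselect (kspan e x)) => hx.
  have [e' [h1 h2]] := IH _ he; exists e'; split => // z; rewrite inE => /orP [/eqP ->|/h2 //].
  exact: kspan_cat.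
have [e' [h1 h2]] := IH _ (kfree_rcons he hx); exists (x :: e'); rewrite -cat_rcons; split => // z.
rewrite inE => /orP [/eqP ->|/h2 //]; apply: kspan_mem.
by rewrite mem_cat mem_rcons inE eqxx.
Qed.

Lemma kfree_nil : kfree [::]. Proof. by []. Qed.

Lemma kfree1 : kfree [:: 1].
Proof.
move=> l; rewrite big_ord1 mulr1 => /eqP; rewrite fmorph_eq0 => /eqP h [|i] //.
Qed.

Context {N : nat}.
Local Notation mapi := (map_mpoly (n := N) iota).

(* The instances inferred in [mcoeff_map_mpoly] do not let [rmorph] lemmas apply. *)
Lemma mcoeff_mapi (f : {mpoly k[N]}) m : (mapi f)@_m = iota f@_m.
Proof. exact: mcoeff_map_mpoly. Qed.

Lemma map_homog d (f : {mpoly k[N]}) : f \is d.-homog -> mapi f \is d.-homog.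
Proof.
move/dhomogP => hf; apply/dhomogP => m; rewrite mcoeff_msupp mcoeff_mapi => h.
by apply: hf; rewrite mcoeff_msupp; apply/eqP => e; case/eqP: h; rewrite e rmorph0.
Qed.

Lemma map_homog_part d (f : {mpoly k[N]}) : homog_part d (mapi f) = mapi (homog_part d f).
Proof.
apply/mpolyP => m; rewrite mcoeff_homog_part !mcoeff_mapi mcoeff_homog_part.
by case: ifP; rewrite ?rmorph0.
Qed.

(** The ideal generated over [K] by an ideal [I]; linear combinations are enough because [I] absorbs
    the monomials. *)
Definition extended (I : {mpoly k[N]} -> Prop) (f : {mpoly K[N]}) :=
  exists T (c : 'I_T -> K) (g : 'I_T -> {mpoly k[N]}),
    (forall t, I (g t)) /\ f = \sum_t c t *: mapi (g t).

Section Extended.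
Variable I : {mpoly k[N]} -> Prop.
Hypothesis hI : is_ideal I.

Lemma extended_base g : I g -> extended I (mapi g).
Proof. by move=> Ig; exists 1%N, (fun=> 1), (fun=> g); split => //; rewrite big_ord1 scale1r. Qed.

Lemma extended_ideal : is_ideal (extended I).
Proof.
have add f g : extended I f -> extended I g -> extended I (f + g).
  move=> [T [c [u [hu ->]]]] [S [c' [v [hv ->]]]].
  exists (T + S)%N, (fun t => match split t with inl i => c i | inr j => c' j end),
    (fun t => match split t with inl i => u i | inr j => v j end).
  split; first by move=> t; case: (split t).
  rewrite big_split_ord /=; congr (_ + _); apply: eq_bigr => t _.
    by rewrite (unsplitK (inl t)).
  by rewrite (unsplitK (inr t)).
have zero : extended I 0.
  by exists 0%N, (fun=> 0), (fun=> 0); split => [t|]; [exact: ideal0|rewrite big_ord0].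
split; [|split] => //.
move=> f g [T [c [u [hu ->]]]]; rewrite [f]mpolyE mulr_suml.
elim/big_ind: _ => // m _; exists T, (fun t => f@_m * c t), (fun t => 'X_[m] * u t); split.
  by move=> t; apply: idealMl.
rewrite mulr_sumr; apply: eq_bigr => t _.
by rewrite rmorphM /= map_mpolyX -scalerAl -scalerAr scalerA.
Qed.

Lemma extended_homog : homogeneous_ideal I -> homogeneous_ideal (extended I).
Proof.
move=> [_ hh]; split; first exact: extended_ideal.
move=> _ d [T [c [u [hu ->]]]]; exists T, c, (fun t => homog_part d (u t)); split.
  by move=> t; apply: hh.
rewrite homog_partE (raddf_sum (pihomog mdeg d)) /=; apply: eq_bigr => t _.
by rewrite linearZ /= -homog_partE map_homog_part.
Qed.

Lemma kfree_mpoly e (h : nat -> {mpoly k[N]}) : kfree e ->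
  \sum_(i < size e) e`_i *: mapi (h i) = 0 -> forall i, (i < size e)%N -> h i = 0.
Proof.
move=> he h0 i hi; apply/mpolyP => m; rewrite mcoeff0; apply: (he (fun i => (h i)@_m)) => //.
have := congr1 (mcoeff m) h0; rewrite mcoeff0 raddf_sum => e0; rewrite -[RHS]e0.
by apply: eq_bigr => j _; rewrite /= mcoeffZ mcoeff_mapi mulrC.
Qed.

(** The family is enlarged until it also spans the coefficients of a representation in the extended
    ideal. Coefficients along a free family are unique, so each [h i] is a combination of elements
    of [I]. *)
Lemma extended_descend e (h : nat -> {mpoly k[N]}) : kfree e ->
  extended I (\sum_(i < size e) e`_i *: mapi (h i)) -> forall i, (i < size e)%N -> I (h i).
Proof.
move=> he [T [c [g [hg eq]]]] i hi.
have [e' [he' hs]] := kfree_extend (codom c) he.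
have [mu hmu] := choice (fun t => hs _ (codom_f c t)).
(* The j-th coefficient of the difference of the two representations; [h] contributes zero beyond
   [e]. *)
pose h' j := (if (j < size e)%N then h j else 0) - \sum_t mu t j *: g t.
have : h' i = 0.
  apply: (@kfree_mpoly _ h' he'); last by rewrite size_cat ltn_addr.
  have -> : \sum_(j < size (e ++ e')) (e ++ e')`_j *: mapi (h' j) =
     \sum_(j < size (e ++ e')) (e ++ e')`_j *: mapi (if (j < size e)%N then h j else 0) -
     \sum_(j < size (e ++ e')) (e ++ e')`_j *: mapi (\sum_t mu t j *: g t).
    by rewrite -sumrB; apply: eq_bigr => j _; rewrite /h' rmorphB scalerBr.
  apply/eqP; rewrite subr_eq0; apply/eqP; transitivity (\sum_(i < size e) e`_i *: mapi (h i)).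
    rewrite size_cat big_split_ord /= [X in _ + X]big1 ?addr0 => [|j _]; last first.
      by rewrite ltnNge leq_addr /= rmorph0 scaler0.
    by apply: eq_bigr => j _; rewrite ltn_ord nth_cat ltn_ord.
  rewrite eq; under [RHS]eq_bigr do rewrite rmorph_sum scaler_sumr.
  rewrite exchange_big /=; apply: eq_bigr => t _; rewrite {1}(hmu t) scaler_suml.
  by apply: eq_bigr => j _; rewrite map_mpolyZ scalerA mulrC.
rewrite /h' hi => /eqP; rewrite subr_eq0 => /eqP ->.
by apply: ideal_sum => // t _; apply: idealZ.
Qed.

Lemma extended_independent v (B : 'I_v -> {mpoly k[N]}) :
  (forall c : 'I_v -> k, I (\sum_t c t *: B t) -> forall t, c t = 0) ->
  forall c : 'I_v -> K, extended I (\sum_t c t *: mapi (B t)) -> forall t, c t = 0.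
Proof.
move=> hB c hc t.
have [e [he hs]] := kfree_extend (codom c) kfree_nil; rewrite cat0s in he hs.
have [mu hmu] := choice (fun t => hs _ (codom_f c t)).
have eq : \sum_t c t *: mapi (B t) = \sum_(j < size e) e`_j *: mapi (\sum_t mu t j *: B t).
  under [RHS]eq_bigr do rewrite rmorph_sum scaler_sumr.
  rewrite exchange_big /=; apply: eq_bigr => i _; rewrite {1}(hmu i) scaler_suml.
  by apply: eq_bigr => j _; rewrite map_mpolyZ scalerA mulrC.
rewrite eq in hc; have h0 := extended_descend (h := fun j => \sum_t mu t j *: B t) he hc.
rewrite (hmu t) big1 // => j _.
by rewrite (hB _ (h0 j (ltn_ord j)) t) rmorph0 mul0r.
Qed.

Lemma extended_descend1 g : extended I (mapi g) -> I g.
Proof.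
move=> h; apply: (@extended_descend [:: 1] (fun=> g) kfree1 _ 0%N) => //.
by rewrite big_ord1 scale1r.
Qed.

End Extended.

Lemma mcoeff_sumX (R : nzRingType) n (s : seq 'X_{1..n}) (E : 'X_{1..n} -> R) m : uniq s ->
  (\sum_(m' <- s) E m' *: 'X_[m'])@_m = if m \in s then E m else 0.
Proof.
move=> us; rewrite raddf_sum /=; case: ifP => hm.
  rewrite (bigD1_seq m) //= mcoeffZ mcoeffX eqxx mulr1 big1 ?addr0 // => m' ne.
  by rewrite mcoeffZ mcoeffX (negbTE ne) mulr0.
rewrite big_seq big1 // => m' hm'; rewrite mcoeffZ mcoeffX.
by case: eqP => [e|]; [rewrite -e hm' in hm|rewrite mulr0].
Qed.

Lemma kfree_decompose_family n (F : 'I_n -> {mpoly K[N]}) :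
  exists e (G : 'I_n -> nat -> {mpoly k[N]}),
  [/\ kfree e, forall j, F j = \sum_(i < size e) e`_i *: mapi (G j i) &
      forall j d, F j \is d.-homog -> forall i, G j i \is d.-homog].
Proof.
pose coefs := flatten [seq [seq (F j)@_m | m <- msupp (F j)] | j <- enum 'I_n].
have [e [he hs]] := kfree_extend coefs kfree_nil; rewrite cat0s in he hs.
have h (u : 'I_n * 'X_{1..N}) : exists l : nat -> k,
    u.2 \in msupp (F u.1) -> (F u.1)@_u.2 = \sum_(i < size e) iota (l i) * e`_i.
  case: u => j m /=; case: (boolP (m \in msupp (F j))) => hm; last by exists (fun=> 0).
  have [|l hl] := hs (F j)@_m; last by exists l.
  by apply/flatten_mapP; exists j; rewrite ?mem_enum //; apply: map_f.
have [l hl] := choice h.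
exists e, (fun j i => \sum_(m <- msupp (F j)) l (j, m) i *: 'X_[m]); split => //.
  move=> j; apply/mpolyP => m; rewrite raddf_sum /=.
  under eq_bigr do rewrite mcoeffZ mcoeff_mapi mcoeff_sumX ?msupp_uniq //.
  case: (boolP (m \in msupp (F j))) => hm; last first.
    by rewrite (memN_msupp_eq0 hm) big1 // => i _; rewrite rmorph0 mulr0.
  by rewrite (hl (j, m)) //; apply: eq_bigr => i _; rewrite mulrC.
move=> j d /dhomogP hF i; rewrite big_seq; apply: rpred_sum => m hm.
by apply: dhomogZ; rewrite dhomogX /=; apply/eqP/hF.
Qed.

Lemma kfree_decompose (F : {mpoly K[N]}) : exists e (G : nat -> {mpoly k[N]}),
  [/\ kfree e, F = \sum_(i < size e) e`_i *: mapi (G i) &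
      forall d, F \is d.-homog -> forall i, G i \is d.-homog].
Proof.
have [e [G [he eF hF]]] := kfree_decompose_family (fun _ : 'I_1 => F).
by exists e, (G ord0); split => // d; apply: hF.
Qed.

Lemma proj_zero_setE (I : {mpoly k[N]} -> Prop) x : is_ideal I ->
  proj_zero_set iota I x <-> vanishing_set (extended I) x.
Proof.
move=> hI; split => [[nx h]|[nx h]]; split => // f.
  move=> [T [c [g [hg ->]]]]; rewrite raddf_sum big1 //= => t _.
  by rewrite mevalZ h // mulr0.
by move=> If; apply/h/extended_base.
Qed.

Lemma proj_zero_set_closed (I : {mpoly k[N]} -> Prop) : homogeneous_ideal I ->
  proj_closed (proj_zero_set iota I).
Proof.
move=> hI; have [J [h1 h2]] := vanishing_set_closed (extended_homog hI.1 hI).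
by exists J; split => // x; rewrite -h2; apply: proj_zero_setE; case: hI.
Qed.

End BaseChange.

(** * Perfect fields *)

Section Perfect.
Context {k : fieldType} {K : closedFieldType} (iota : {rmorphism k -> K}).
Hypothesis perf : perfect_field k.

(** If n is nonzero in [K], the coefficient of degree n - 1 is -n u. Otherwise the characteristic p
    divides n, the polynomial is (X - u^p)^(n/p) evaluated at X^p, and induction gives u^p in [k];
    its p-th root in [k] is u since Frobenius is injective. *)
Lemma perfect_root_descent n : forall u : K, (0 < n)%N ->
  (forall j, exists b, (('X - u%:P) ^+ n)`_j = iota b) -> exists b, u = iota b.
Proof.
elim/ltn_ind: n => n IH u n0 hu.
case: (eqVneq (n%:R : K) 0) => [nz|nz]; last first.
  have [b hb] := hu n.-1; exists (- b / n%:R).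
  have e : (('X - u%:P) ^+ n)`_n.-1 = - (n%:R * u).
    have := @coefPn_prod_XsubC _ (nseq n u); rewrite size_nseq !big_nseq iter_mulr_1 iter_addr_0.
    by rewrite -lt0n n0 mulr_natl => ->.
  by rewrite rmorphM rmorphN -hb e opprK fmorphV rmorph_nat mulrC mulKf.
have [p hp] : exists p, p \in [pchar K] by apply: natf0_pchar n0 _; rewrite nz.
have hpP : p \in [pchar {poly K}] by rewrite pchar_poly.
have hpk : p \in [pchar k] by rewrite -(fmorph_pchar iota).
have p_prime := pcharf_prime hp.
have /dvdnP [n1 en] : (p %| n)%N by rewrite (dvdn_pcharf hp) nz.
have n10 : (0 < n1)%N by move: n0; rewrite en muln_gt0 => /andP [].
have e : ('X - u%:P) ^+ n = (('X - (u ^+ p)%:P) ^+ n1) \Po 'X^p.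
  rewrite rmorphXn /= rmorphB /= comp_polyX comp_polyC en mulnC exprM; congr (_ ^+ _).
  rewrite -(pFrobenius_autE hpP) rmorphB /= !pFrobenius_autE.
  by rewrite rmorphXn.
have [||b hb] := IH n1 _ (u ^+ p) n10.
- by rewrite en ltn_Pmulr // prime_gt1.
- move=> j; have [b hb] := hu (j * p)%N; exists b.
  by rewrite -hb e coef_comp_poly_Xn ?prime_gt0 // dvdn_mull // mulnK ?prime_gt0.
have [c hc] := perf hpk b; exists c; apply/eqP; rewrite -subr_eq0.
have /eqP : (u - iota c) ^+ p = 0.
  rewrite -(pFrobenius_autE hp) rmorphB /= !pFrobenius_autE -rmorphXn hc hb subrr //.
by rewrite expf_eq0 => /andP [].
Qed.

(* The zero set of A is the line through [c]; the Nullstellensatz makes a power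
   of [c_l1 T_l2 - c_l2 T_l1] a combination of polynomials over [k]
   in A, whose gcd over [k] is then a power of [T - c_l2 / c_l1]. *)
Lemma line_rational v (A : {mpoly k[v]} -> Prop) (c : 'I_v -> K) (l1 l2 : 'I_v) :
  homogeneous_ideal A ->
  (forall x, vanishing_set (extended iota A) x -> exists a, forall l, x l = a * c l) ->
  (forall q, A q -> (map_mpoly iota q).@[c] = 0) -> c l1 = 1 -> l2 != l1 ->
  exists b, c l2 = iota b.
Proof.
move=> hA hV Ac c1 ne; set u := c l2.
pose G : {mpoly K[v]} := 'X_l2 - u *: 'X_l1.
have G0 : G.@[fun=> 0] = 0 by rewrite /G mevalB mevalZ !mevalXU mulr0 subrr.
have GV : vI (vanishing_set (extended iota A)) G.
  move=> x /hV [a hx]; rewrite /G mevalB mevalZ !mevalXU !hx c1 mulr1 mulrC subrr //.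
have [M hM] := nullstellensatz (extended_homog iota hA.1 hA) G0 GV.
have [e [H [he eH _]]] := kfree_decompose iota (G ^+ M).
rewrite eH in hM; have AH := extended_descend hA.1 he hM.
(* All variables but T_l1 and T_l2 are set to zero. This leaves G^M unchanged, hence also its
   coefficients H_i along the free family. *)
pose keep (R : comNzRingType) (l : 'I_v) : {mpoly R[v]} :=
  if (l == l1) || (l == l2) then 'X_l else 0.
pose rk : {rmorphism {mpoly k[v]} -> {mpoly k[v]}} := mmap (@mpolyC v k) (@keep k).
pose rK : {rmorphism {mpoly K[v]} -> {mpoly K[v]}} := mmap (@mpolyC v K) (@keep K).
have rKZ a f : rK (a *: f) = a *: rK f by rewrite /rK /= mmapZ mul_mpolyC.
have rKG : rK G = G.
  rewrite /G rmorphB rKZ /rK /= !mmapX !mmap1U /keep !eqxx orbT //.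
have rmap q : rK (map_mpoly iota q) = map_mpoly iota (rk q).
  rewrite /rK /rk /map_mpoly /= !rmorph_mmap; apply: eq_mmap => [b|l] /=; first by rewrite !mmapC.
  by rewrite !mmapX !mmap1U /keep; case: ifP; rewrite ?mmapX ?mmap1U ?rmorph0.
have Hr i : (i < size e)%N -> H i = rk (H i).
  move=> hi; apply/eqP; rewrite -subr_eq0; apply/eqP.
  apply: (@kfree_mpoly _ _ iota _ e (fun i => H i - rk (H i)) he) => //.
  transitivity (G ^+ M - rK (G ^+ M)); last by rewrite rmorphXn rKG subrr.
  rewrite {1 2}eH rmorph_sum -sumrB; apply: eq_bigr => j _.
  by rewrite rKZ rmap rmorphB scalerBr.
(* Dehomogenization by T_l1 = 1, which turns G into X - u. *)
pose ev (R : comNzRingType) (l : 'I_v) : {poly R} := if l == l1 then 1 else if l == l2 then 'X else 0.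
pose ek : {rmorphism {mpoly k[v]} -> {poly k}} := mmap (@polyC k) (@ev k).
pose eK : {rmorphism {mpoly K[v]} -> {poly K}} := mmap (@polyC K) (@ev K).
have emap q : eK (map_mpoly iota q) = map_poly iota (ek q).
  rewrite /eK /ek /map_mpoly /= !rmorph_mmap; apply: eq_mmap => [b|l] /=.
    by rewrite !mmapC map_polyC.
  by rewrite !mmapX !mmap1U /ev; case: ifP; rewrite ?rmorph1 //; case: ifP; rewrite ?map_polyX ?rmorph0.
have eKG : eK (G ^+ M) = ('X - u%:P) ^+ M.
  rewrite rmorphXn; congr (_ ^+ _); rewrite /G rmorphB -mul_mpolyC rmorphM /eK /= mmapC !mmapX !mmap1U.
  by rewrite /ev !eqxx (negbTE ne) mulr1.
have rootH i : (i < size e)%N -> root (map_poly iota (ek (H i))) u.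
  move=> hi; have e1 : (rK (map_mpoly iota (H i))).@[c] = 0.
    by rewrite rmap -(Hr i hi); apply/Ac/AH.
  move: e1; rewrite /rK /= rmorph_mmap => e1.
  rewrite -emap /root -horner_evalE /eK /= rmorph_mmap -[X in _ == X]e1; apply/eqP.
  apply: eq_mmap => [b|l] /=.
    by rewrite horner_evalE hornerC mevalC.
  rewrite horner_evalE /ev /keep; case: eqP => [->|_] /=; first by rewrite hornerC mevalXU c1.
  by case: eqP => [->|_]; rewrite ?hornerX ?mevalXU // horner0 meval0.
(* The gcd has the root u and divides (X - u)^M, so over [K] it is a positive power of X - u up to a
   constant. *)
pose D : {poly k} := \big[@gcdp k/0]_(i <- index_iota 0 (size e)) ek (H i).
have rootD : root (map_poly iota D) u.
  rewrite /D big_seq; elim/big_ind: _ => [|p q hp hq|i].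
  - by rewrite rmorph0 root0.
  - by rewrite gcdp_map root_gcd hp hq.
  - by rewrite mem_index_iota => /rootH.
have Ddvd i : (i < size e)%N -> dvdp D (ek (H i)).
  move=> hi; have: i \in index_iota 0 (size e) by rewrite mem_index_iota.
  rewrite /D; elim: (index_iota 0 (size e)) => // j s IH; rewrite inE big_cons.
  by case/orP => [/eqP ->|/IH]; [exact: dvdp_gcdl|exact: dvdp_trans (dvdp_gcdr _ _)].
have Dall : dvdp (map_poly iota D) (('X - u%:P) ^+ M).
  rewrite -eKG eH rmorph_sum; apply: (big_ind (dvdp (map_poly iota D))) => [|p q|i _]; first exact: dvdp0.
    exact: dvdp_add.
  rewrite -mul_mpolyC rmorphM; apply: dvdp_mull; rewrite emap dvdp_map.
  exact: Ddvd.
have [s _ hs] := dvdp_exp_XsubCP Dall.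
have s0 : (0 < s)%N.
  case: s hs => // hs; move: rootD; rewrite (eqp_root hs) expr0 /root hornerC oner_eq0 //.
apply: (perfect_root_descent s0) => j.
have D0 : lead_coef (map_poly iota D) != 0.
  rewrite lead_coef_eq0; apply: contraTneq Dall => ->.
  by rewrite dvd0p expf_neq0 // polyXsubC_eq0.
exists ((lead_coef D)^-1 * D`_j).
have e1 : ('X - u%:P) ^+ s = (lead_coef (map_poly iota D))^-1 *: map_poly iota D.
  have /eqpP [[a b] /= /andP [a0 b0] hab] := hs.
  have lc : a * lead_coef (map_poly iota D) = b.
    have := congr1 lead_coef hab; rewrite !lead_coefZ.
    by rewrite (eqP (monic_exp s (monicXsubC u))) mulr1.
  apply: (scalerI b0); rewrite -hab scalerA -lc -mulrA mulfV // mulr1 //.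
by rewrite e1 coefZ coef_map lead_coef_map rmorphM fmorphV.
Qed.

End Perfect.

Section PerfectIndependence.
Context {k : fieldType} {K : closedFieldType} (iota : {rmorphism k -> K}) {N : nat}.
Hypothesis perf : perfect_field k.
Local Notation mapi := (map_mpoly (n := N) iota).

Section Family.
Variables (I : {mpoly k[N]} -> Prop) (m v : nat) (B : 'I_v -> {mpoly k[N]}).
Hypotheses (hI : homogeneous_ideal I) (radI : radical_ideal I) (m0 : (0 < m)%N).
Hypothesis homB : forall t, B t \is m.-homog.
Hypothesis indB : forall c : 'I_v -> k, I (\sum_t c t *: B t) -> forall t, c t = 0.

Local Notation X := (vanishing_set (extended iota I)).
Let F (c : 'I_v -> K) : {mpoly K[N]} := \sum_t c t *: mapi (B t).

(** Since the [p j] have coefficients in [k], membership of a power of F(c) in the extended ideal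
    becomes a condition on c defined over [k]. *)
Lemma comb_power_coords E : exists w (Bw : 'I_w -> {mpoly k[N]}) (p : 'I_w -> {mpoly k[v]}),
  (forall c : 'I_w -> k, I (\sum_t c t *: Bw t) -> forall t, c t = 0) /\
  forall c, extended iota I (F c ^+ E - \sum_j (map_mpoly iota (p j)).@[c] *: mapi (Bw j)).
Proof.
have [w hw] := hilbert_value_exists (m * E) hI.1.
have [Bw [_ ind span]] := hilbert_basis hI.1 hw.
have homP (f : {ffun 'I_E -> 'I_v}) : \prod_i B (f i) \is (m * E).-homog.
  have -> : (m * E = \sum_(i < E) m)%N by rewrite sum_nat_const card_ord mulnC.
  apply: (big_ind2 (fun (u : {mpoly k[N]}) (n : nat) => u \is n.-homog)) => //; first exact: dhomog1.
  by move=> *; apply: dhomogM.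
have [ga hga] := choice (fun f => span _ (homP f)).
exists w, Bw, (fun j => \sum_f ga f j *: \prod_i 'X_(f i)); split => // c.
have evp j : (map_mpoly iota (\sum_f ga f j *: \prod_i 'X_(f i))).@[c] =
    \sum_f iota (ga f j) * \prod_i c (f i).
  rewrite (rmorph_sum (map_mpoly iota)) (rmorph_sum (meval c)); apply: eq_bigr => f _.
  rewrite /= map_mpolyZ mevalZ (rmorph_prod (map_mpoly iota)) (rmorph_prod (meval c)) /=; congr (_ * _).
  by apply: eq_bigr => i _; rewrite map_mpolyX mevalXU.
under eq_bigr do rewrite evp scaler_suml.
rewrite exchange_big /=.
have -> : F c ^+ E = \sum_(f : {ffun 'I_E -> 'I_v}) (\prod_i c (f i)) *: mapi (\prod_i B (f i)).
  rewrite -[E in LHS]card_ord -prodr_const bigA_distr_bigA; apply: eq_bigr => f _ /=.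
  by rewrite scaler_prod rmorph_prod.
rewrite -sumrB; apply: ideal_sum => [|f _]; first exact: extended_ideal hI.1.
have -> : (\prod_i c (f i)) *: mapi (\prod_i B (f i)) -
    \sum_j (iota (ga f j) * \prod_i c (f i)) *: mapi (Bw j) =
    (\prod_i c (f i)) *: mapi (\prod_i B (f i) - \sum_j ga f j *: Bw j).
  rewrite rmorphB scalerBr; congr (_ - _); rewrite rmorph_sum scaler_sumr.
  by apply: eq_bigr => j _; rewrite /= map_mpolyZ scalerA mulrC.
apply: idealZ; first exact: extended_ideal hI.1.
exact/extended_base/hga.
Qed.

Let supp (c : 'I_v -> K) := [set t | c t != 0].

(** The relations within the support of c form a set [V] defined over [k]. By minimality [V] lies on
    the line through c, because x - x_l1 c has smaller support; over a perfect field such a line has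
    rational coordinates. *)
Lemma minimal_comb_rational (c : 'I_v -> K) l1 : vI X (F c) -> c l1 = 1 ->
  (forall c', vI X (F c') -> (#|supp c'| < #|supp c|)%N -> forall t, c' t = 0) ->
  forall l2, exists b, c l2 = iota b.
Proof.
move=> Wc c1 minc l2.
case: (eqVneq l2 l1) => [->|ne]; first by exists 1; rewrite c1 rmorph1.
have idE := extended_ideal iota hI.1.
have F0 : (F c).@[fun=> 0] = 0.
  have hF : F c \is m.-homog by apply: rpred_sum => t _; apply/dhomogZ/map_homog.
  have := meval_scale (fun=> 0) 0 hF; by rewrite expr0n (gtn_eqF m0) /= !mul0r.
have [E hE] := nullstellensatz (extended_homog iota hI.1 hI) F0 Wc.
have [w [Bw [p [ind key]]]] := comb_power_coords E.
pose V x := extended iota I (F x ^+ E) /\ forall l, c l = 0 -> x l = 0.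
have coneV : cone V.
  move=> x a a0 [h1 h2]; split; last by move=> l /h2 ->; rewrite mulr0.
  have -> : F (fun i => a * x i) = a *: F x.
    by rewrite /F scaler_sumr; apply: eq_bigr => t _; rewrite scalerA.
  by rewrite exprZn; apply: idealZ.
pose A (q : {mpoly k[v]}) := vI V (map_mpoly iota q).
have hA : homogeneous_ideal A.
  split; last by move=> q d hq; rewrite /A -map_homog_part; apply: (vI_homog coneV).2.
  split; [|split]; first by move=> x _; rewrite rmorph0 meval0.
    by move=> q r hq hr; rewrite /A rmorphD; apply: (idealD (vI_ideal V)).
  by move=> q r hr; rewrite /A rmorphM; apply: (idealMl (vI_ideal V)).
apply: (line_rational perf (A := A) hA _ _ c1 ne); last by move=> q; apply.
move=> x [_ hx].
have hAx q : A q -> (map_mpoly iota q).@[x] = 0 by move=> Aq; apply/hx/extended_base.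
(* [V] is cut out by polynomials over [k], the coordinates of F(x)^E and the variables outside the
   support of c, so it contains every zero of [A]. *)
have Vx : V x.
  split; last first.
    move=> l cl; have /hAx : A 'X_l by move=> z [_ hz]; rewrite map_mpolyX mevalXU hz.
    by rewrite map_mpolyX mevalXU.
  have := key x; rewrite big1 ?subr0 // => j _.
  rewrite hAx ?scale0r // => z [hz _].
  apply: (extended_independent hI.1 ind (c := fun j => (map_mpoly iota (p j)).@[z])).
  have h := idealB idE hz (key z); rewrite opprB addrC subrK in h.
  exact: h.
have Wx : vI X (F x).
  move=> z [nz hz]; have := hz _ Vx.1.
  by rewrite rmorphXn /= => /eqP; rewrite expf_eq0 => /andP [_ /eqP].
exists (x l1) => l; apply/eqP; rewrite -subr_eq0; apply/eqP.
apply: (minc (fun l => x l - x l1 * c l)).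
  have -> : F (fun l => x l - x l1 * c l) = F x - x l1 *: F c.
    by rewrite /F scaler_sumr -sumrB; apply: eq_bigr => t _; rewrite scalerBl scalerA.
  by apply: (idealB (vI_ideal _)) => //; apply: (idealZ (vI_ideal _)).
apply/proper_card/properP; split.
  apply/fintype.subsetP => t; rewrite !inE; apply: contra => /eqP ct.
  by rewrite ct mulr0 subr0 (proj2 Vx).
by exists l1; rewrite !inE c1 ?oner_eq0 // mulr1 subrr eqxx.
Qed.

(** A nonzero relation of minimal support, scaled to have a coordinate 1, would have coefficients in
    [k]. A power of its form then lies in the extended ideal, hence in [I], which is radical.
    Positive degree makes the form vanish at the origin, as the Nullstellensatz requires. *)
Lemma perfect_independence c : vI X (F c) -> forall t, c t = 0.
Proof.
move=> Wc t; apply: contrapT => /eqP ct.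
pose P n := `[< exists c, [/\ vI X (F c), exists t, c t != 0 & #|supp c| = n] >].
have exP : exists n, P n by exists #|supp c|; apply/asboolP; exists c; split => //; exists t.
case: (ex_minnP exP) => n /asboolP [c' [Wc' [l1 cl1] sn]] minn.
pose c2 l := (c' l1)^-1 * c' l.
have supE : supp c2 = supp c'.
  by apply/finset.setP => l; rewrite !inE /c2 mulf_eq0 invr_eq0 (negbTE cl1).
have W2 : vI X (F c2).
  have -> : F c2 = (c' l1)^-1 *: F c'.
    by rewrite /F scaler_sumr; apply: eq_bigr => l _; rewrite scalerA.
  exact: (idealZ (vI_ideal _)).
have c21 : c2 l1 = 1 by rewrite /c2 mulVf.
have min2 c3 : vI X (F c3) -> (#|supp c3| < #|supp c2|)%N -> forall t, c3 t = 0.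
  move=> W3 hlt l; apply: contrapT => /eqP c3l; move: hlt; rewrite supE sn ltnNge minn //.
  by apply/asboolP; exists c3; split => //; exists l.
have [b hb] := choice (minimal_comb_rational W2 c21 min2).
have Fc2 : F c2 = mapi (\sum_l b l *: B l).
  by rewrite rmorph_sum; apply: eq_bigr => l _; rewrite /= map_mpolyZ hb.
have F0 : (F c2).@[fun=> 0] = 0.
  have hF : F c2 \is m.-homog by apply: rpred_sum => l _; apply/dhomogZ/map_homog.
  have := meval_scale (fun=> 0) 0 hF; by rewrite expr0n (gtn_eqF m0) /= !mul0r.
have [E] := nullstellensatz (extended_homog iota hI.1 hI) F0 W2.
rewrite Fc2 -rmorphXn => /(extended_descend1 hI.1) /radI.2 /indB /(_ l1) b0.
by move: c21; rewrite hb b0 rmorph0 => /eqP; rewrite eq_sym oner_eq0.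
Qed.

End Family.

End PerfectIndependence.

(** * Independent variables *)

Section TorsionFree.
Context {k : fieldType} {K : closedFieldType} (iota : {rmorphism k -> K}) {N l : nat}.
Variables (P : {mpoly k[N]} -> Prop) (z : 'I_l -> {mpoly k[N]}).
Hypotheses (pP : prime_ideal P) (indz : alg_indep_mod P z).
Local Notation mapi := (map_mpoly (n := N) iota).
Local Notation zK := (fun i => mapi (z i)).

Lemma map_subst a : mapi (subst z a) = subst zK (map_mpoly iota a).
Proof.
rewrite /subst [in RHS]/map_mpoly !rmorph_mmap /=; apply: eq_mmap => [c|i] /=.
  by rewrite mmapC map_mpolyC.
by rewrite mmapX mmap1U.
Qed.

Lemma independent_extended s (f : 'I_s -> {mpoly k[N]}) :
  (forall a : 'I_s -> {mpoly k[l]}, P (\sum_i subst z (a i) * f i) -> forall i, a i = 0) ->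
  forall b : 'I_s -> {mpoly K[l]}, extended iota P (\sum_i subst zK (b i) * mapi (f i)) ->
    forall i, b i = 0.
Proof.
have [idP _] := pP => ind b hb i.
have [e [G [he eG _]]] := kfree_decompose_family iota b.
have eq : \sum_i subst zK (b i) * mapi (f i) =
    \sum_(t < size e) e`_t *: mapi (\sum_i subst z (G i t) * f i).
  under [RHS]eq_bigr do rewrite rmorph_sum scaler_sumr.
  rewrite exchange_big /=; apply: eq_bigr => j _.
  rewrite [in LHS]eG /subst rmorph_sum mulr_suml; apply: eq_bigr => t _.
  by rewrite rmorphM /= map_subst mmapZ mul_mpolyC -scalerAl.
rewrite eq in hb; have h := extended_descend (h := fun t => \sum_i subst z (G i t) * f i) idP he hb.
rewrite eG big1 // => t _.
by rewrite (ind (fun i => G i t) (h t (ltn_ord t)) i) rmorph0 scaler0.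
Qed.

(* P extended to K[x] has no torsion over K[z]: induction on the length of a
   representation of the torsion element, shortened by any k[z]-linear
   relation between the f_i. *)
Lemma extended_torsion_free_comb s : forall (q : {mpoly K[l]}) (c : 'I_s -> {mpoly K[l]})
    (f : 'I_s -> {mpoly k[N]}), q != 0 ->
  extended iota P (subst zK q * \sum_i subst zK (c i) * mapi (f i)) ->
  extended iota P (\sum_i subst zK (c i) * mapi (f i)).
Proof.
have [idP [P1 prP]] := pP; have idE := extended_ideal iota idP.
elim: s => [|s IH] q c f q0 hq; first by rewrite big_ord0; exact: ideal0.
case: (pselect (forall a : 'I_s.+1 -> {mpoly k[l]}, P (\sum_i subst z (a i) * f i) ->
    forall i, a i = 0)) => [ind|].
  have h : forall i, q * c i = 0.
    apply: (independent_extended (f := f) ind); move: hq; congr (extended iota P _).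
    by rewrite mulr_sumr; apply: eq_bigr => i _; rewrite /subst rmorphM mulrA.
  rewrite big1 => [|i _]; first exact: ideal0.
  have /eqP := h i; rewrite mulf_eq0 (negbTE q0) => /eqP ->.
  by rewrite /subst rmorph0 mul0r.
move=> /existsNP [a /not_implyP [Pa /existsNP [i0 /eqP ai0]]].
pose aK i := map_mpoly iota (a i).
(* The relation among the f_i eliminates f_i0 after multiplication by a_i0. *)
pose c' j := aK i0 * c (lift i0 j) - c i0 * aK (lift i0 j).
set F := \sum_i _ in hq *.
pose F' := \sum_j subst zK (c' j) * mapi (f (lift i0 j)).
have eF : subst zK (aK i0) * F - subst zK (c i0) * mapi (\sum_i subst z (a i) * f i) = F'.
  rewrite rmorph_sum /F !(bigD1_ord i0) //= !mulrDr opprD addrACA.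
  rewrite rmorphM /= map_subst -/(aK i0).
  have -> : subst zK (aK i0) * (subst zK (c i0) * mapi (f i0)) -
    subst zK (c i0) * (subst zK (aK i0) * mapi (f i0)) = 0 by ring.
  rewrite add0r !mulr_sumr -sumrB; apply: eq_bigr => j _.
  rewrite rmorphM /= map_subst -/(aK _) /c' /subst rmorphB !rmorphM /=; ring.
have Pz : extended iota P (mapi (\sum_i subst z (a i) * f i)) by apply: extended_base.
have hF' : extended iota P F'.
  apply: (IH q) => //; rewrite -/F' -eF mulrBr; apply: (idealB idE).
    by rewrite mulrCA; apply: (idealMl idE).
  by do 2 apply: (idealMl idE).
have haF : extended iota P (mapi (subst z (a i0)) * F).
  rewrite map_subst -/(aK i0) -[X in extended _ _ X](subrK (subst zK (c i0) * mapi (\sum_i subst z (a i) * f i))) eF.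
  by apply: (idealD idE) => //; apply: (idealMl idE).
(* As a_i0 has coefficients in [k], it multiplies each coefficient of F along a free family
   separately and can be cancelled there, because [P] is prime. *)
have [e [G [he eG _]]] := kfree_decompose iota F.
rewrite eG mulr_sumr in haF; rewrite eG; apply: (ideal_sum idE) => t _.
apply: (idealZ idE); apply: extended_base.
have h : forall t, (t < size e)%N -> P (subst z (a i0) * G t).
  apply: (extended_descend idP he); move: haF; congr (extended iota P _).
  by apply: eq_bigr => i _; rewrite rmorphM /= -scalerAr.
case: (prP _ _ (h t (ltn_ord t))) => // /indz e0.
by rewrite e0 eqxx in ai0.
Qed.

(** If q(z) lay in [Q] with q nonzero, then q(z) F would lie in the extended ideal of [P], which has
    no torsion over K[z], so F would lie in it too. *)
Lemma extended_alg_indep (Q : {mpoly K[N]} -> Prop) (F : {mpoly K[N]}) :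
  (forall g, Q g -> extended iota P (g * F)) -> ~ extended iota P F -> alg_indep_mod Q zK.
Proof.
move=> hQ nF q Qq; apply: contrapT => /eqP q0; apply: nF.
have [e [G [he eG _]]] := kfree_decompose iota F.
pose c (i : 'I_(size e)) : {mpoly K[l]} := (e`_i)%:MP.
have eF : F = \sum_i subst zK (c i) * mapi (G i).
  by rewrite {1}eG; apply: eq_bigr => i _; rewrite /subst mmapC mul_mpolyC.
rewrite eF; apply: (extended_torsion_free_comb (q := q)) => //; rewrite -eF; exact: hQ.
Qed.

End TorsionFree.

Section AlgIndepGrowth.
Context {N d : nat} {R : fieldType}.

Lemma hilbert_ge_leq (I : {mpoly R[N]} -> Prop) m v w : (w <= v)%N -> hilbert_ge I m v -> hilbert_ge I m w.
Proof.
move=> wv /hilbert_ge_elim [g [hg ind]]; rewrite -(card_ord w).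
apply: (hilbert_ge_family (g := fun t => g (widen_ord wv t))) => // c hc t.
pose c' (i : 'I_v) := if insub (i : nat) is Some j then c j else 0.
have c'E (j : 'I_w) : c' (widen_ord wv j) = c j by rewrite /c' /= valK.
rewrite -c'E; apply: ind; move: hc; congr I.
rewrite [RHS](bigID (fun i : 'I_v => i < w)%N) /= [X in _ + X]big1 => [|i hi]; last first.
  by rewrite /c' insubN // scale0r.
rewrite addr0 (big_ord_narrow wv); apply: eq_bigr => i _; by rewrite c'E.
Qed.

Lemma alg_indep_growth (J : {mpoly R[N]} -> Prop) (z : 'I_d.+1 -> {mpoly R[N]}) :
  (forall i, z i \is 1.-homog) -> alg_indep_mod J z -> growth_ge J d.
Proof.
(* The factor d! in the degree compensates for the denominator of the binomial coefficient. *)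
move=> hz ind; exists d`!, 0%N => M; set D := (d`! * M + 1)%N.
apply: (@hilbert_ge_leq _ _ 'C(D + d, d)).
  have h := expn_le_fact_bin d D; rewrite -(leq_pmul2l (fact_gt0 d)); apply: leq_trans h.
  case: (posnP d) => [->|d0]; first by rewrite !expn0.
  have h1 : (d`! * M ^ d <= (d`! * M) ^ d)%N.
    by rewrite expnMn leq_mul2r -{1}(expn1 d`!) leq_pexp2l ?fact_gt0 ?orbT.
  by apply: leq_trans h1 _; rewrite leq_exp2r // leq_addr.
rewrite -card_bmultinom.
pose h (b : 'X_{1..d < D.+1}) : 'X_{1..d.+1} :=
  [multinom if unlift ord0 i is Some j then val b j else (D - mdeg (val b))%N | i < d.+1].
have h0 b : h b ord0 = (D - mdeg (val b))%N by rewrite mnmE unlift_none.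
have hS b j : h b (lift ord0 j) = val b j by rewrite mnmE liftK.
have hdeg b : mdeg (h b) = D.
  rewrite mdegE big_ord_recl h0.
  under eq_bigr do rewrite hS.
  by rewrite -mdegE subnK // -ltnS bmdeg.
have inj : injective h.
  by move=> b c e; apply/val_inj/mnmP => j; rewrite -hS e hS.
apply: (hilbert_ge_family (g := fun b => subst z 'X_[h b])) => [b|c hc b].
  rewrite /subst mmapX /mmap1 -(hdeg b) mdegE.
  apply: (big_ind2 (fun (u : {mpoly R[N]}) (n : nat) => u \is n.-homog)); first exact: dhomog1.
    by move=> *; apply: dhomogM.
  by move=> i _; have := dhomogMn (h b i) (hz i); rewrite mul1n.
have e0 : \sum_b c b *: 'X_[h b] = 0 :> {mpoly R[d.+1]}.
  apply: ind; move: hc; congr J; rewrite /subst rmorph_sum; apply: eq_bigr => b' _.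
  by rewrite /= mmapZ mul_mpolyC.
have := congr1 (mcoeff (h b)) e0; rewrite mcoeff0 raddf_sum (bigD1 b) //= mcoeffZ mcoeffX eqxx mulr1.
rewrite big1 ?addr0 // => b' ne; rewrite mcoeffZ mcoeffX.
by case: eqP => [/inj e'|]; [case/eqP: ne|rewrite mulr0].
Qed.

End AlgIndepGrowth.

(** * Standard monomials *)

Section StandardMonomials.
Context {N : nat} {k : fieldType}.
Variable J : {mpoly k[N]} -> Prop.
Hypothesis hJ : homogeneous_ideal J.

Definition standard (m : 'X_{1..N}) := ~ exists f, [/\ J f, f != 0 & mlead f = m].

(** Division by leading terms, as well-founded induction on the monomial order. *)
Lemma standard_span_le M (T := {b : 'X_{1..N < M.+1} | `[< standard (val b) >] && (mdeg (val b) == M)}) m :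
  forall f : {mpoly k[N]}, f \is M.-homog -> (forall m', m' \in msupp f -> (m' <= m)%O) ->
  exists c : T -> k, J (f - \sum_b c b *: 'X_[val (val b)]).
Proof.
have idJ := hJ.1.
elim/(well_founded_ind (@ltom_wf N)): m => m IH f hf hm.
have lower g : g \is M.-homog -> (forall m', m' \in msupp g -> (m' < m)%O) ->
    exists c : T -> k, J (g - \sum_b c b *: 'X_[val (val b)]).
  move=> hg hgm; case: (eqVneq g 0) => [->|g0].
    exists (fun=> 0); rewrite big1 ?subrr; first exact: ideal0.
    by move=> b _; rewrite scale0r.
  apply: (IH (mlead g)) => //; first exact/hgm/mlead_supp.
  exact: msupp_le_mlead.
have below g : (forall m', m' \in msupp g -> (m' <= m)%O) -> g@_m = 0 ->
    forall m', m' \in msupp g -> (m' < m)%O.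
  move=> hg g0 m' hm'; rewrite lt_neqAle hg // andbT; apply: contraTneq hm' => ->.
  by rewrite mcoeff_msupp g0 eqxx.
case: (eqVneq f@_m 0) => [fm|fm]; first by apply: lower => //; apply: below.
have hmf : m \in msupp f by rewrite mcoeff_msupp.
have degm : mdeg m = M by move/dhomogP: hf => /(_ _ hmf).
have homX : ('X_[m] : {mpoly k[N]}) \is M.-homog by rewrite dhomogX /= degm.
case: (pselect (standard m)) => [st|].
  have hb : (mdeg m < M.+1)%N by rewrite degm.
  have hb2 : `[< standard (val (BMultinom hb)) >] && (mdeg (val (BMultinom hb)) == M).
    by apply/andP; split; [apply/asboolP|rewrite /= degm].
  pose b0 : T := exist _ (BMultinom hb) hb2.
  have [||c hc] := lower (f - f@_m *: 'X_[m]).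
  - by apply: rpredB => //; apply: dhomogZ.
  - apply: below; last by rewrite mcoeffB mcoeffZ mcoeffX eqxx mulr1 subrr.
    move=> m' /msuppB_le; rewrite mem_cat => /orP [/hm //|/msuppZ_le].
    by rewrite msuppX inE => /eqP ->.
  exists (fun b => c b + (b == b0)%:R * f@_m); move: hc; congr J.
  rewrite -addrA; congr (f + _); rewrite -opprD; congr (- _).
  under [RHS]eq_bigr do rewrite scalerDl.
  rewrite big_split addrC; congr (_ + _); rewrite (bigD1 b0) //= eqxx mul1r big1 ?addr0 // => b ne.
  by rewrite (negbTE ne) mul0r scale0r.
move=> /contrapT [g [Jg g0 lg]].
(* The part of degree M retains the leading term, because m has degree M, and keeps the division
   homogeneous. *)
pose g' := homog_part M g.
have gm : g'@_m = g@_m by rewrite mcoeff_homog_part degm eqxx.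
have gm0 : g@_m != 0 by rewrite -mcoeff_msupp -lg mlead_supp.
have Jg' : J g' by apply: hJ.2.
pose a := f@_m / g@_m.
have [||c hc] := lower (f - a *: g').
- by apply: rpredB => //; apply/dhomogZ/homog_part_homog.
- apply: below; last by rewrite mcoeffB mcoeffZ gm divfK // subrr.
  move=> m' /msuppB_le; rewrite mem_cat => /orP [/hm //|/msuppZ_le].
  rewrite mcoeff_msupp mcoeff_homog_part; case: ifP; rewrite ?eqxx // => _ h.
  by rewrite -lg; apply: msupp_le_mlead; rewrite mcoeff_msupp.
exists c; rewrite -(subrK (a *: g') f) addrAC; apply: idealD => //.
exact: idealZ.
Qed.

Lemma standard_bound M :
  hilbert_le J M #|{: {b : 'X_{1..N < M.+1} | `[< standard (val b) >] && (mdeg (val b) == M)}}|.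
Proof.
move=> s; apply: spanning_bound hJ.1 _ => f hf.
exact: (standard_span_le hf (@msupp_le_mlead _ _ f)).
Qed.

Lemma standard_divisor m m' : (m <= m')%MM -> standard m' -> standard m.
Proof.
move=> h st [f [Jf f0 lf]]; apply: st; exists (f * 'X_[m' - m]); split.
- by apply: idealMr => //; case: hJ.
- by rewrite mulf_neq0 // -msize_poly_eq0 msizeX.
- rewrite mleadM //; last by rewrite -msize_poly_eq0 msizeX.
  by rewrite mleadXm lf addmC submK.
Qed.

(* Unless the chosen variables are independent mod J, a standard monomial
   cannot have large exponents in all of them. *)
Lemma dependent_vars_bound l (sg : 'I_l -> 'I_N) : injective sg ->
  ~ alg_indep_mod J (fun j => 'X_(sg j)) ->
  exists D, forall m, standard m -> exists j, (m (sg j) < D)%N.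
Proof.
move=> inj /existsNP [p /not_implyP [Jp /eqP p0]].
set f := subst _ p in Jp.
have f0 : f != 0.
  pose z : {rmorphism {mpoly k[N]} -> {mpoly k[l]}} :=
    mmap (@mpolyC l k) (fun i => if [pick j | sg j == i] is Some j then 'X_j else 0).
  apply: contraNneq p0 => f0; have := rmorph0 z; rewrite -f0 /f /subst /z /= rmorph_mmap => <-.
  rewrite -[X in X == _](mmap_mpolyX p); apply/eqP/eq_mmap => [c|j] /=; first by rewrite mmapC.
  rewrite mmapX mmap1U; case: pickP => [j' /eqP /inj -> //|/(_ j)]; by rewrite eqxx.
have supp0 : mlead f \in msupp f by apply: mlead_supp.
have out i : (forall j, sg j != i) -> mlead f i = 0%N.
  move=> hi; move: supp0; rewrite {1}/f /subst /mmap => /msupp_sum_le /flatten_mapP [b _].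
  rewrite mul_mpolyC => /msuppZ_le.
  have -> : mmap1 (fun j => 'X_(sg j)) b = 'X_[\sum_j (U_(sg j) *+ b j)%MM] :> {mpoly k[N]}.
    by rewrite /mmap1 -mprodXE; apply: eq_bigr => j _; rewrite mpolyXn.
  rewrite msuppX inE => /eqP ->; rewrite mnm_sumE big1 // => j _.
  by rewrite mulmnE mnm1E (negbTE (hi j)) mul0n.
exists (mdeg (mlead f)).+1 => m st; apply: contrapT => h.
have [] : standard (mlead f); last by exists f.
apply: (standard_divisor _ st); apply/mnm_lepP => i.
case: (pselect (exists j, sg j = i)) => [[j <-]|n].
  have hj : (mdeg (mlead f) < m (sg j))%N.
    by rewrite ltnNge -ltnS; apply/negP => hj; apply: h; exists j.
  by apply: leq_trans (ltnW hj); rewrite mdegE (bigD1 (sg j)) //= leq_addr.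
by rewrite out // => j; apply/eqP => e; apply: n; exists j.
Qed.

End StandardMonomials.

Lemma eq_seq_sumn (s t : seq nat) n : size s = size t -> (size s <= n.+1)%N ->
  (forall i, (i < n)%N -> nth 0%N s i = nth 0%N t i) -> sumn s = sumn t -> s = t.
Proof.
elim: n s t => [|n IH] [|a s] [|b t] //=.
  by case: s t => [|? ?] [|? ?] //= _ _ _; rewrite !addn0 => ->.
move=> [e] hs h; have -> : a = b by apply: (h 0%N).
by move=> /addnI e2; congr cons; apply: IH => // i hi; apply: (h i.+1).
Qed.

(* A monomial of degree M with at most d+1 exponents >= D is determined by the
   positions of these, by its other exponents, and by the first d of the large ones. *)
Lemma count_few_large N D d M (P : pred 'X_{1..N < M.+1}) :
  (forall b, P b -> mdeg (val b) = M /\ (#|[set i | D <= val b i]| <= d.+1)%N) ->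
  (#|{: {b | P b}}| <= 2 ^ N * D.+1 ^ N * M.+1 ^ d)%N.
Proof.
move=> hP; pose S (b : {b | P b}) := [set i | (D <= val (val b) i)%N].
pose big (b : {b | P b}) := [seq val (val b) i | i <- enum (S b)].
pose code (b : {b | P b}) : {set 'I_N} * {ffun 'I_N -> 'I_D.+1} * {ffun 'I_d -> 'I_M.+1} :=
  (S b, [ffun i => inord (minn (val (val b) i) D)], [ffun t : 'I_d => inord (nth 0%N (big b) t)]).
have inj : injective code.
  move=> b c [eS eT eB]; apply/val_inj/val_inj/mnmP => i.
  have [degb sb] := hP _ (valP b); have [degc sc] := hP _ (valP c).
  have low j : j \notin S b -> val (val b) j = val (val c) j.
    move=> hj; have hj' : j \notin S c by rewrite -eS.
    move: hj hj'; rewrite !inE -!ltnNge => h1 h2.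
    have := congr1 (fun F : {ffun 'I_N -> 'I_D.+1} => val (F j)) eT; rewrite !ffunE /=.
    by rewrite !inordK ?ltnS ?geq_minr // (minn_idPl (ltnW h1)) (minn_idPl (ltnW h2)).
  have bnd (u : {b | P b}) t : (nth 0%N (big u) t < M.+1)%N.
    case: (ltnP t (size (big u))) => ht; last by rewrite nth_default.
    have /mapP [j _ ->] := mem_nth 0%N ht; apply: leq_ltn_trans (bmdeg (val u)).
    by rewrite mdegE (bigD1 j) //= leq_addr.
  have ebig : big b = big c.
    apply: (@eq_seq_sumn _ _ d); rewrite ?size_map -?cardE //; first by rewrite eS.
      move=> t ht; have := congr1 (fun F : {ffun 'I_d -> 'I_M.+1} => val (F (Ordinal ht))) eB.
      by rewrite !ffunE /= !inordK //; exact: bnd.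
    have hsum (u : {b | P b}) : (sumn (big u) + \sum_(j | j \notin S u) val (val u) j = mdeg (val (val u)))%N.
      by rewrite mdegE [RHS](bigID (mem (S u))) /= /big sumnE big_map big_enum.
    have e : (\sum_(j | j \notin S b) val (val b) j = \sum_(j | j \notin S c) val (val c) j)%N.
      by rewrite -eS; apply: eq_bigr => j; apply: low.
    by apply/eqP; rewrite -(eqn_add2r (\sum_(j | j \notin S b) val (val b) j)) {2}e !hsum degb degc.
  case: (boolP (i \in S b)) => hi; last exact: low.
  have := congr1 (fun s => nth 0%N s (index i (enum (S b)))) ebig.
  rewrite /big -eS !(nth_map i) ?index_mem ?mem_enum // nth_index ?mem_enum //.
rewrite -(card_codom inj); apply: leq_trans (max_card _) _.
have e2 : #|{: {set 'I_N}}| = (2 ^ N)%N by rewrite -cardsT -powersetT card_powerset cardsT card_ord.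
by rewrite !card_prod !card_ffun !card_ord e2.
Qed.

(** If any d + 2 variables were dependent modulo [J], a standard monomial would have at most d + 1
    large exponents, and the number of such monomials would grow only like m^d. This converts growth
    into algebraic independence over a field that need not be algebraically closed. *)
Lemma growth_alg_indep_vars N (k : fieldType) (J : {mpoly k[N]} -> Prop) d :
  homogeneous_ideal J -> growth_ge J d.+1 ->
  exists sg : 'I_d.+2 -> 'I_N, alg_indep_mod J (fun j => 'X_(sg j)).
Proof.
move=> hJ gr; apply: contrapT => nind.
have hD (sg : {ffun 'I_d.+2 -> 'I_N}) : exists D, injective sg ->
    forall m, standard J m -> exists j, (m (sg j) < D)%N.
  case: (pselect (injective sg)) => [inj|]; last by exists 0%N.
  have [|D hD] := dependent_vars_bound hJ inj; last by exists D.
  by move=> h; apply: nind; exists sg.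
have [D0 hD0] := choice hD.
pose D := (\sum_sg D0 sg)%N.
have few m : standard J m -> (#|[set i | D <= m i]| <= d.+1)%N.
  move=> st; rewrite leqNgt; apply/negP => hlt.
  pose sg : {ffun 'I_d.+2 -> 'I_N} := [ffun j => enum_val (widen_ord hlt j)].
  have inj : injective sg.
    by move=> i j; rewrite !ffunE => /enum_val_inj /(congr1 val) /= e; apply: val_inj.
  have [j] := hD0 sg inj m st; rewrite ltnNge => /negP; apply.
  have : sg j \in [set i | (D <= m i)%N] by rewrite ffunE enum_valP.
  by rewrite inE; apply: leq_trans; rewrite /D (bigD1 sg) //= leq_addr.
(* The factor 2^d absorbs the passage from (m + 1)^d to m^d for m >= 1. *)
pose C := (2 ^ N * D.+1 ^ N * 2 ^ d)%N.
have : (d.+1 <= d)%N.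
  apply: (growth_ge_bound (A := C) (B := 0) gr) => m m0 s hs; rewrite addn0.
  apply: leq_trans (standard_bound hJ hs) _.
  apply: (@leq_trans (2 ^ N * D.+1 ^ N * m.+1 ^ d)).
    apply: count_few_large => b /andP [/asboolP st /eqP hm]; split => //; exact: few.
  rewrite /C -[X in (_ <= X)%N]mulnA -(expnMn 2 m d) leq_mul2l; apply/orP; right.
  clear -m0; case: d => // d; rewrite leq_exp2r //; lia.
by rewrite ltnn.
Qed.

(** * Hilbert polynomials *)

Lemma eventually_ge0_lead (R : {poly rat}) m0 :
  (forall m : nat, (m0 <= m)%N -> 0 <= R.[m%:R]) -> 0 <= lead_coef R.
Proof.
move=> h; rewrite leNgt; apply/negP => hl.
have R0 : R != 0 by rewrite -lead_coef_eq0 lt_eqF.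
case sz : (size R) => [|n]; first by move/eqP: sz; rewrite size_poly_eq0 (negbTE R0).
have lE : lead_coef R = R`_n by rewrite lead_coefE sz.
pose B := \sum_(i < n) `|R`_i|.
pose m := maxn m0 (Num.bound (B / - lead_coef R)).+1.
have := h m (leq_maxl _ _); rewrite leNgt => /negP; apply.
have x1 : 1 <= m%:R :> rat by rewrite ler1n leq_max orbT.
have hb : B < - lead_coef R * m%:R.
  rewrite mulrC -ltr_pdivrMr ?oppr_gt0 //; apply: lt_le_trans (archi_boundP _) _.
    by apply: divr_ge0; [apply: sumr_ge0|rewrite oppr_ge0 ltW].
  by rewrite ler_nat leq_max leqnSn orbT.
rewrite horner_coef sz big_ord_recr /= -lE.
case: n sz lE @B @m x1 hb => [|n] sz lE B m x1 hb; first by rewrite big_ord0 add0r expr0 mulr1.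
have : \sum_(i < n.+1) R`_i * m%:R ^+ i <= B * m%:R ^+ n.
  rewrite mulr_suml; apply: ler_sum => i _.
  apply: (@le_trans _ _ (`|R`_i| * m%:R ^+ i)).
    by rewrite ler_wpM2r ?ler_norm // exprn_ge0.
  by rewrite ler_wpM2l // ler_weXn2l // -ltnS.
move=> hs; apply: (@le_lt_trans _ _ ((B + lead_coef R * m%:R) * m%:R ^+ n)).
  by rewrite mulrDl -mulrA -exprS lerD2r.
rewrite pmulr_llt0; first by rewrite -ltrBrDr sub0r -mulNr.
by rewrite exprn_gt0 // (lt_le_trans ltr01).
Qed.

(** The upper bound serves to limit the degree of [P] to d. Then d! P - Delta (X - e)^d has degree
    at most d and is nonnegative at large integers, so its coefficient of degree d is
    nonnegative. *)
Lemma lead_coef_lower_bound (P : {poly rat}) (d A B Delta e m0 : nat) :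
  (forall m : nat, (m0 <= m)%N -> [/\ 0 <= P.[m%:R], P.[m%:R] <= A%:R * m%:R ^+ d + B%:R &
     Delta%:R * (m%:R - e%:R) ^+ d <= d`!%:R * P.[m%:R]]) ->
  Delta%:R <= d`!%:R * P`_d.
Proof.
move=> h.
have szP : (size P <= d.+1)%N.
  rewrite leqNgt; apply/negP => hlt.
  have P0 : P != 0 by rewrite -size_poly_eq0 -lt0n (leq_trans _ hlt).
  have lP : 0 <= lead_coef P by apply: (@eventually_ge0_lead _ m0) => m /h [].
  pose U : {poly rat} := A%:R *: 'X^d + B%:R%:P.
  have szU : (size U < size (- P))%N.
    rewrite size_polyN; apply: leq_ltn_trans hlt; apply: leq_trans (size_polyD _ _) _.
    rewrite geq_max (leq_trans (size_scale_leq _ _)) ?size_polyXn //.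
    by rewrite (leq_trans (size_polyC_leq1 _)).
  have : 0 <= lead_coef (U - P).
    apply: (@eventually_ge0_lead _ m0) => m /h [_ h2 _].
    by rewrite hornerD hornerN /U hornerD hornerZ hornerXn hornerC subr_ge0.
  rewrite lead_coefDr // lead_coefN oppr_ge0 => h2.
  by case/eqP: P0; apply/eqP; rewrite -lead_coef_eq0 eq_le h2 lP.
pose V := d`!%:R *: P - Delta%:R *: ('X - e%:R%:P) ^+ d.
have szX : size (('X - e%:R%:P : {poly rat}) ^+ d) = d.+1 by rewrite size_exp_XsubC.
have szV : (size V <= d.+1)%N.
  rewrite /V -scaleNr; apply: leq_trans (size_polyD _ _) _; rewrite geq_max.
  by rewrite !(leq_trans (size_scale_leq _ _)) // szX.
have lV : 0 <= lead_coef V.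
  apply: (@eventually_ge0_lead _ m0) => m /h [_ _ h3].
  by rewrite hornerD hornerN !hornerZ horner_exp hornerXsubC subr_ge0.
have Xd : (('X - e%:R%:P : {poly rat}) ^+ d)`_d = 1.
  by have := monic_exp d (monicXsubC (e%:R : rat)); rewrite monicE lead_coefE szX => /eqP.
have : 0 <= V`_d.
  move: szV; rewrite leq_eqVlt => /orP [/eqP e1|h1]; last by rewrite nth_default.
  by move: lV; rewrite lead_coefE e1.
by rewrite coefB !coefZ Xd mulr1 subr_ge0.
Qed.

(** * Hilbert functions over the two fields *)

Section Transfer.
Context {k : fieldType} {K : closedFieldType} (iota : {rmorphism k -> K}) {N : nat}.
Local Notation mapi := (map_mpoly (n := N) iota).
Implicit Types (I : {mpoly k[N]} -> Prop) (J : {mpoly K[N]} -> Prop).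

Lemma basis_spans_extension I J m v (B : 'I_v -> {mpoly k[N]}) : is_ideal I -> is_ideal J ->
  (forall f, I f -> J (mapi f)) ->
  (forall f, f \is m.-homog -> exists c : 'I_v -> k, I (f - \sum_t c t *: B t)) ->
  forall f, f \is m.-homog -> exists c : 'I_v -> K, J (f - \sum_t c t *: mapi (B t)).
Proof.
move=> hI hJ sub span f hf.
have h (b : 'X_{1..N}) : exists c : 'I_v -> k, b \in msupp f -> I ('X_[b] - \sum_t c t *: B t).
  case: (boolP (b \in msupp f)) => hb; last by exists (fun=> 0).
  have [|c hc] := span 'X_[b]; last by exists c.
  by rewrite dhomogX /=; apply/eqP; move/dhomogP: hf => /(_ _ hb).
have [c hc] := choice h.
exists (fun t => \sum_(b <- msupp f) f@_b * iota (c b t)).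
have -> : f - \sum_t (\sum_(b <- msupp f) f@_b * iota (c b t)) *: mapi (B t) =
    \sum_(b <- msupp f) f@_b *: mapi ('X_[b] - \sum_t c b t *: B t).
  under eq_bigr do rewrite scaler_suml.
  rewrite {1}[f]mpolyE exchange_big -sumrB; apply: eq_bigr => b _ /=.
  rewrite rmorphB /= scalerBr map_mpolyX; congr (_ - _); rewrite rmorph_sum scaler_sumr.
  by apply: eq_bigr => t _; rewrite /= map_mpolyZ scalerA.
rewrite big_seq; apply: ideal_sum => // b hb.
by apply: idealZ => //; apply/sub/hc.
Qed.

(** A basis over [k] of the quotient by [I] in degree m still spans the quotient by [J] over [K]. *)
Lemma hilbert_ge_descend I J m v : is_ideal I -> is_ideal J -> (forall f, I f -> J (mapi f)) ->
  hilbert_ge J m v -> hilbert_ge I m v.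
Proof.
move=> hI hJ sub hv; have [w hw] := hilbert_value_exists m hI.
have [B [_ _ span]] := hilbert_basis hI hw.
have hle : hilbert_le J m w.
  move=> s hs; rewrite -(card_ord w).
  exact: (spanning_bound hJ (basis_spans_extension hI hJ sub span) hs).
by apply: (hilbert_ge_leq (hilbert_ge_le hv hle)); case: hw.
Qed.

Lemma extended_sub I J : is_ideal J -> (forall f, I f -> J (mapi f)) ->
  forall f, extended iota I f -> J f.
Proof.
move=> hJ sub _ [T [c [g [hg ->]]]]; apply: ideal_sum => // t _.
by apply: idealZ => //; apply/sub/hg.
Qed.

Lemma extended_mono I I' : (forall f, I f -> I' f) -> forall f, extended iota I f -> extended iota I' f.
Proof. by move=> sub f [T [c [g [hg e]]]]; exists T, c, g; split => // t; apply: sub. Qed.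

Section Radical.
Variable I : {mpoly k[N]} -> Prop.
Hypotheses (perf : perfect_field k) (hI : homogeneous_ideal I) (radI : radical_ideal I).
Local Notation X := (proj_zero_set iota I).

Lemma proj_zero_set_eq : X = vanishing_set (extended iota I).
Proof. by apply: funext => x; apply: propext; apply: proj_zero_setE; case: hI. Qed.

Lemma map_vI f : I f -> vI X (mapi f).
Proof. by move=> If x [_]; apply. Qed.

Lemma hilbert_ge_vI m v : (0 < m)%N -> hilbert_ge I m v -> hilbert_ge (vI X) m v.
Proof.
move=> m0 /hilbert_ge_elim [g [hg ind]]; rewrite -(card_ord v).
apply: (hilbert_ge_family (g := fun t => mapi (g t))) => [t|c].
  exact: map_homog.
by rewrite proj_zero_set_eq; apply: (perfect_independence perf hI radI m0 hg ind).
Qed.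

(** In each positive degree a basis modulo [I] stays independent on the zero set, so the extended
    ideal already contains every form vanishing there. The condition at 0 excludes constants, which
    vanish on an empty set. *)
Lemma vI_extended f : f.@[fun=> 0] = 0 -> vI X f -> extended iota I f.
Proof.
move=> f0 hf; have hE := extended_homog iota hI.1 hI.
apply: homogeneous_ideal_parts => // -[|e].
  suff -> : homog_part 0 f = 0 by apply: ideal0 hE.1.
  apply: contrapT => /eqP /mpoly_nonroot [x]; have [q [hq <-]] := meval_line f x.
  rewrite -horner_coef0 hq (meval_eq (v2 := fun=> 0)) ?f0 ?eqxx // => i.
  by rewrite mul0r.
have cX : cone X by apply: closed_cone; apply: proj_zero_set_closed.
have hfe : vI X (homog_part e.+1 f) by apply: (vI_homog cX).2.
have [w hw] := hilbert_value_exists e.+1 hI.1.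
have [B [hB ind span]] := hilbert_basis hI.1 hw.
have [c hc] := basis_spans_extension hI.1 hE.1 (extended_base iota (I := I)) span (homog_part_homog e.+1 f).
have hs : vI X (\sum_t c t *: mapi (B t)).
  apply: (idealBl (vI_ideal X) _ hfe); apply: (extended_sub (vI_ideal X) map_vI hc).
rewrite proj_zero_set_eq in hs.
have c0 := perfect_independence perf hI radI (ltn0Sn e) hB ind hs.
move: hc; rewrite big1 ?subr0 // => t _; by rewrite c0 scale0r.
Qed.

End Radical.
End Transfer.

(** * Components *)

Section Components.
Context {k : fieldType} {K : closedFieldType} (iota : {rmorphism k -> K}) {N : nat}.
Local Notation mapi := (map_mpoly (n := N) iota).
Variables (I : {mpoly k[N]} -> Prop) (d r : nat) (Cs : nat -> @pset N K).
Hypotheses (perf : perfect_field k) (hI : homogeneous_ideal I) (radI : radical_ideal I).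
Hypothesis unm : unmixed iota I.
Local Notation X := (proj_zero_set iota I).
Hypothesis dimX : top_dim X d.
Hypothesis compC : forall i, (i < r)%N -> irr_component X (Cs i).
Hypothesis injC : forall i j, (i < r)%N -> (j < r)%N ->
  psubset (Cs i) (Cs j) -> psubset (Cs j) (Cs i) -> i = j.
Hypothesis allC : forall C, irr_component X C ->
  exists i, (i < r)%N /\ psubset C (Cs i) /\ psubset (Cs i) C.

Lemma component_closed i : (i < r)%N -> proj_closed (Cs i).
Proof. by move=> /compC [[h _] _]. Qed.

Lemma component_prime i : (i < r)%N -> prime_ideal (vI (Cs i)).
Proof. by move=> hi; exact: vI_prime (compC hi).1. Qed.

Lemma component_homog i : (i < r)%N -> homogeneous_ideal (vI (Cs i)).
Proof. by move=> hi; exact: vI_homog (closed_cone (component_closed hi)). Qed.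

Lemma component_nonirrelevant i : (i < r)%N -> exists a, ~ vI (Cs i) 'X_a.
Proof.
by move=> hi; have [[h1 [h2 _]] _] := compC hi; apply: vI_nonirrelevant.
Qed.

Lemma vI_components f : vI X f <-> forall i, (i < r)%N -> vI (Cs i) f.
Proof.
split => [h i /compC [_ [sX _]] x /sX /h //|h x Xx].
have [C [hC Cx]] := point_in_component (proj_zero_set_closed iota hI) dimX.2 Xx.
by have [i [ir [CCi _]]] := allC hC; apply: (h i ir); apply: CCi.
Qed.

(** No other component contains [Cs j], so each provides a form outside the prime ideal of [Cs j];
    their product is still outside. *)
Lemma separating_form j : (j < r)%N -> exists F e, [/\ F \is e.+1.-homog, ~ vI (Cs j) F &
  forall i, (i < r)%N -> i != j -> vI (Cs i) F].
Proof.
move=> hj; have pj := component_prime hj; have [idj [nj1 prj]] := pj.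
have [a ha] := component_nonirrelevant hj.
suff h s : exists F e, [/\ F \is e.-homog, ~ vI (Cs j) F &
    forall i, (i < s)%N -> (i < r)%N -> i != j -> vI (Cs i) F].
  (* The factor X_a makes the degree positive, so that multiples of F vanish at the origin. *)
  have [F [e [hF nF allF]]] := h r; exists ('X_a * F), e; split.
  - by rewrite -add1n; apply: dhomogM => //; rewrite dhomogX /= mdeg1.
  - by move=> /prj [].
  - by move=> i ir ne; apply: (idealMl (vI_ideal _)); apply: allF.
elim: s => [|s [F [e [hF nF allF]]]].
  by exists 1, 0%N; split => //; exact: dhomog1.
case: (boolP ((s < r)%N && (s != j))) => [/andP [sr sj]|nsj]; last first.
  exists F, e; split => // i; rewrite ltnS leq_eqVlt => /orP [/eqP -> sr sj|]; last exact: allF.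
  by rewrite sr sj in nsj.
have [g [g1 g2]] : exists g, vI (Cs s) g /\ ~ vI (Cs j) g.
  apply: contrapT => h; case/eqP: sj.
  have sub : psubset (Cs j) (Cs s).
    apply: (closed_sub_vI (component_closed hj) (component_closed sr)) => f hf.
    by apply: contrapT => nf; apply: h; exists f.
  have [irs [sX _]] := compC sr; have [_ [_ maxj]] := compC hj.
  exact: injC sr hj (maxj _ irs sub sX) sub.
have [e' he'] : exists e', ~ vI (Cs j) (homog_part e' g).
  apply: contrapT => h; apply: g2; apply: homogeneous_ideal_parts (component_homog hj) _ => e'.
  by apply: contrapT => nf; apply: h; exists e'.
have hg' := (component_homog sr).2 g e' g1.
exists (homog_part e' g * F), (e' + e)%N; split.
- by apply: dhomogM => //; apply: homog_part_homog.
- by move=> /prj [].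
- move=> i; rewrite ltnS leq_eqVlt => /orP [/eqP -> _ _|hi ir ne].
    exact: (idealMr (vI_ideal _)).
  by apply: (idealMl (vI_ideal _)); apply: allF.
Qed.

Definition contraction j : {mpoly k[N]} -> Prop := fun f => vI (Cs j) (mapi f).

Lemma contraction_prime j : (j < r)%N -> prime_ideal (contraction j).
Proof.
move=> hj; have [idj [nj1 prj]] := component_prime hj; split; last split.
- split; [|split => f g]; rewrite /contraction; first by rewrite rmorph0; exact: (ideal0 idj).
    by move=> hf hg; rewrite rmorphD; apply: (idealD idj).
  by move=> hg; rewrite rmorphM; apply: (idealMl idj).
- by rewrite /contraction rmorph1.
- by move=> f g; rewrite /contraction rmorphM => /prj.
Qed.

Lemma contraction_homog j : (j < r)%N -> homogeneous_ideal (contraction j).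
Proof.
move=> hj; split; first by case: (contraction_prime hj).
by move=> f e hf; rewrite /contraction -map_homog_part; apply: (component_homog hj).2.
Qed.

Lemma sub_contraction j f : (j < r)%N -> I f -> contraction j f.
Proof. by move=> /compC [_ [sX _]] If x /sX [_]; apply. Qed.

(** g F vanishes on every component, hence on the whole zero set, and at the origin. *)
Lemma component_colon j F e g : (j < r)%N -> F \is e.+1.-homog ->
  (forall i, (i < r)%N -> i != j -> vI (Cs i) F) -> vI (Cs j) g -> extended iota I (g * F).
Proof.
move=> hj hF allF hg; apply: (vI_extended perf hI radI).
  rewrite mevalM (_ : F.@[_] = 0) ?mulr0 //.
  by have := meval_scale (fun=> 0) 0 hF; rewrite expr0n /= !mul0r.
apply/vI_components => i hi; case: (eqVneq i j) => [->|ne].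
  exact: (idealMr (vI_ideal _)).
by apply: (idealMl (vI_ideal _)); apply: allF.
Qed.

(** With F written along a family free over [k], the contraction is the intersection of the finitely
    many ideals (I : G_t). A prime that is a finite intersection of ideals equals one of them. *)
Lemma contraction_associated j : (j < r)%N -> associated_prime I (contraction j).
Proof.
move=> hj; have pP := contraction_prime hj; split => //; have [idP [_ prP]] := pP.
have [F [e [hF nF allF]]] := separating_form hj.
have [idj [nj1 prj]] := component_prime hj.
have [u [G [hu eG _]]] := kfree_decompose iota F.
have char g : contraction j g <-> forall t, (t < size u)%N -> I (g * G t).
  have eg : mapi g * F = \sum_(t < size u) u`_t *: mapi (g * G t).
    rewrite {1}eG mulr_sumr; apply: eq_bigr => t _.
    by rewrite rmorphM /= -scalerAr.
  split => [hg|h].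
    by apply: (extended_descend (h := fun t => g * G t) hI.1 hu); rewrite -eg; apply: (component_colon hj hF allF).
  have /prj [] // : vI (Cs j) (mapi g * F).
  rewrite eg; apply: (ideal_sum idj) => t _; apply: (idealZ idj).
  exact: sub_contraction (h t (ltn_ord t)).
apply: contrapT => nex.
have h t : exists h0, (t < size u)%N -> I (h0 * G t) /\ ~ contraction j h0.
  case: (pselect (t < size u)%N) => ht; last by exists 0.
  apply: contrapT => n0; apply: nex; exists (G t) => g; split => [/char|hg]; first exact.
  by apply: contrapT => ng; apply: n0; exists g.
have [h0 hh0] := choice h.
have : contraction j (\prod_(t < size u) h0 t).
  apply/char => t ht; rewrite (bigD1 (Ordinal ht)) //= mulrAC.
  by apply: (idealMr hI.1); case: (hh0 t ht).
suff : forall s : seq 'I_(size u), ~ contraction j (\prod_(t <- s) h0 t) by move=> hs; apply: hs.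
elim=> [|t s IH]; first by rewrite big_nil; case: (pP) => _ [].
by rewrite big_cons => /prP []; [case: (hh0 t (ltn_ord t))|exact: IH].
Qed.

Lemma irr_chain_sub (Y Y' : @pset N K) (Z : nat -> @pset N K) s :
  psubset Y Y' -> irr_chain Y Z s -> irr_chain Y' Z s.
Proof.
by move=> sub [h1 h2]; split => // i /h1 [? h]; split => // x /h /sub.
Qed.

Lemma contraction_zero_set j : (j < r)%N ->
  psubset (Cs j) (proj_zero_set iota (contraction j)) /\
  psubset (proj_zero_set iota (contraction j)) X.
Proof.
move=> hj; split => [x Cx|x [nx hx]]; split => //.
- exact: closed_nonzero (component_closed hj) Cx.
- by move=> f; apply.
- by move=> f If; apply/hx/sub_contraction.
Qed.

Lemma contraction_dim_exists j : (j < r)%N ->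
  exists2 e, top_dim (proj_zero_set iota (contraction j)) e & (e <= d)%N.
Proof.
move=> hj; have [s1 s2] := contraction_zero_set hj.
pose P e := `[< exists Z, irr_chain (proj_zero_set iota (contraction j)) Z e >].
have bound e : P e -> (e <= d)%N.
  by move=> /asboolP [Z hZ]; apply: (dimX.2 Z); apply: irr_chain_sub hZ.
have P0 : exists e, P e.
  exists 0%N; apply/asboolP; exists (fun=> Cs j); split => // i _.
  by have [h _] := compC hj.
case: (ex_maxnP P0 bound) => e he hmax; exists e; last exact: bound.
move/asboolP: he => [Z hZ]; split; first by exists Z.
by move=> Z' e' h'; apply: hmax; apply/asboolP; exists Z'.
Qed.

Lemma exists_full_component : exists2 j0, (j0 < r)%N &
  top_dim (proj_zero_set iota (contraction j0)) d.
Proof.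
have [[Z hZ] _] := dimX; have [hZ1 _] := hZ; have [irr sub] := hZ1 d (leqnn d).
have [C [hC ZC]] := component_exists dimX.2 irr sub.
have [j0 [hj0 [CC _]]] := allC hC; exists j0 => //.
have [s1 s2] := contraction_zero_set hj0.
split; last by move=> Z' e' h'; apply: (dimX.2 Z'); apply: irr_chain_sub h'.
exists Z; split; last by case: hZ.
have [_ lt] := hZ.
have mono i : (i <= d)%N -> psubset (Z i) (Z d).
  move=> hi; rewrite -(subKn hi); elim: (d - i)%N {hi} (leq_subr i d) => [|s IH] hs.
    by rewrite subn0.
  have e : (d - s = (d - s.+1).+1)%N by lia.
  have [h1 _] := lt (d - s.+1)%N ltac:(lia).
  by move=> x /h1; rewrite -e; apply: IH; lia.
move=> i hi; have [h1 _] := hZ1 i hi; split => // x /(mono i hi) /ZC /CC; exact: s1.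
Qed.

(** All contractions are associated primes, so unmixedness gives them the dimension of the one whose
    component contains the top of a longest chain. *)
Lemma contraction_dim j : (j < r)%N -> top_dim (proj_zero_set iota (contraction j)) d.
Proof.
move=> hj; have [j0 hj0 top0] := exists_full_component.
have [e tope _] := contraction_dim_exists hj.
have := unm (contraction_associated hj) (contraction_associated hj0)
  (e1 := e%:Z) (e2 := d%:Z).
move=> h; have [] : e%:Z = d%:Z; last by move=> <-.
by apply: h; right; [exists e|exists d].
Qed.

(** With e + 1 parameters, a chain inside the component shows e <= d. Conversely, the zero set of
    the contraction has dimension d but may contain other components, so its chains do not bound e
    directly. They give growth of order d over [k], hence d + 1 independent variables, which stay
    independent modulo the component. *)
Theorem component_noether_params j : (j < r)%N ->
  exists y : 'I_d.+1 -> {mpoly K[N]}, noether_params (vI (Cs j)) y.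
Proof.
move=> hj; have pj := component_prime hj; have hoj := component_homog hj.
have [e [y hy]] := noether_params_pos hoj pj (component_nonirrelevant hj).
suff ed : e = d by subst e; exists y.
apply/eqP; rewrite eqn_leq; apply/andP; split.
  have [Z hZ] := exists_chain hoj pj hy; apply: (dimX.2 Z); apply: irr_chain_sub hZ => x Vx.
  have [_ [sX _]] := compC hj; apply: sX; exact: closed_vanishing (component_closed hj) Vx.
case ed : d => [|d'] //; rewrite -ed.
have [delta [D [hup _]]] := prime_hilbert_bounds hoj pj hy.
have [[Z hZ] _] := contraction_dim hj.
have grK := chain_growth hZ; have [hZ1 _] := hZ; have [_ subZ] := hZ1 d (leqnn d).
have gr : growth_ge (contraction j) d'.+1.
  rewrite -ed; have [c [e0 hc]] := grK; exists c, e0 => M.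
  apply: (hilbert_ge_descend (contraction_prime hj).1 (vI_ideal _) _ (hc M)) => f hf x /subZ [_]; exact.
have [sg hsg] := growth_alg_indep_vars (contraction_homog hj) gr.
have [F [e1 [hF nF allF]]] := separating_form hj.
have ind : alg_indep_mod (vI (Cs j)) (fun i => mapi 'X_(sg i)).
  apply: (extended_alg_indep (contraction_prime hj) hsg (F := F)).
    move=> g hg; apply: (extended_mono (I := I)); first by move=> f; apply: sub_contraction.
    exact: component_colon hj hF allF hg.
  by move=> /(extended_sub (vI_ideal _) (J := vI (Cs j))) h; apply: nF; apply: h.
have grC : growth_ge (vI (Cs j)) d.
  by rewrite ed; apply: (alg_indep_growth _ ind) => i; rewrite map_mpolyX dhomogX /= mdeg1.
exact: growth_ge_bound grC hup.
Qed.

Lemma vI_hilbert_le m (w : nat -> nat) :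
  (forall j, (j < r)%N -> hilbert_le (vI (Cs j)) m (w j)) ->
  hilbert_le (vI X) m (\sum_(j < r) w j).
Proof.
move=> hw.
pose J s (f : {mpoly K[N]}) := forall i, (i < s)%N -> vI (Cs i) f.
have idJ s : is_ideal (J s).
  split; [|split] => [i _|f g hf hg i hi|f g hg i hi]; first exact: (ideal0 (vI_ideal _)).
    by apply: (idealD (vI_ideal _)); [exact: hf|exact: hg].
  by apply: (idealMl (vI_ideal _)); exact: hg.
have -> : vI X = J r by apply: funext => f; apply: propext; exact: vI_components.
suff main s : (s <= r)%N -> hilbert_le (J s) m (\sum_(j < s) w j) by exact: main.
elim: s => [_|s IH hs].
  rewrite big_ord0 => s hs; rewrite leqn0; apply/eqP; case: s hs => // f s [_ hs].
  by have /eqP := hs (fun=> 1) (fun i h => match notF h with end) 0%N isT; rewrite oner_eq0.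
have -> : J s.+1 = (fun f => J s f /\ vI (Cs s) f).
  apply: funext => f; apply: propext; split => [h|[h1 h2] i].
    by split; [move=> i hi; apply: h; apply: ltnW|apply: h].
  by rewrite ltnS leq_eqVlt => /orP [/eqP ->|]; [exact: h2|exact: h1].
rewrite big_ord_recr /=; apply: hilbert_le_setI; [exact: idJ|exact: vI_ideal|exact/IH/ltnW|exact: hw].
Qed.

Lemma vI_hilbert_ge (v : nat -> nat -> nat) (D : nat -> nat) :
  (forall j, (j < r)%N -> forall M, hilbert_ge (vI (Cs j)) (D j + M) (v j M)) ->
  (forall j M M', (M <= M')%N -> (v j M <= v j M')%N) ->
  exists E, forall M, hilbert_ge (vI X) (E + M) (\sum_(j < r) v j M).
Proof.
move=> hv mono.
have hF (j : 'I_r) : exists u : {mpoly K[N]} * nat, [/\ u.1 \is u.2.+1.-homog, ~ vI (Cs j) u.1 &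
    forall i, (i < r)%N -> i != j -> vI (Cs i) u.1].
  by have [F [e h]] := separating_form (ltn_ord j); exists (F, e).
have [F {}hF] := choice hF.
(* E exceeds every degree deg F_j + D_j, so each summand can be taken in degree E + M - deg F_j,
   where by monotonicity it has at least [v j M] independent elements. *)
pose E := (\sum_(j < r) ((F j).2.+1 + D j))%N; exists E => M.
have hE (j : 'I_r) : ((F j).2.+1 + D j <= E)%N by rewrite /E (bigD1 j) //= leq_addr.
pose e (j : 'I_r) := (E + M - (F j).2.+1)%N.
have hB (j : 'I_r) : exists g : 'I_(v j M) -> {mpoly K[N]}, (forall t, g t \is (e j).-homog) /\
    (forall c, vI (Cs j) (\sum_t c t *: g t) -> forall t, c t = 0).
  apply: hilbert_ge_elim; have -> : e j = (D j + (M + (E - ((F j).2.+1 + D j))))%N.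
    by rewrite /e; have := hE j; lia.
  by apply: (hilbert_ge_leq (mono _ _ _ _)) (hv j (ltn_ord j) _); apply: leq_addr.
pose B (j : 'I_r) := projT1 (cid (hB j)).
have hB' (j : 'I_r) : (forall t, B j t \is (e j).-homog) /\
    (forall c, vI (Cs j) (\sum_t c t *: B j t) -> forall t, c t = 0).
  exact: projT2 (cid (hB j)).
have -> : (\sum_(j < r) v j M = #|{: {j : 'I_r & 'I_(v j M)}}|)%N.
  by rewrite card_tagged sumnE big_map big_enum; apply: eq_bigr => j _; rewrite card_ord.
apply: (hilbert_ge_family (g := fun u : {j : 'I_r & 'I_(v j M)} => (F (tag u)).1 * B (tag u) (tagged u))).
  move=> [j t] /=; have -> : (E + M = (F j).2.+1 + e j)%N by rewrite /e; have := hE j; lia.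
  by apply: dhomogM; [case: (hF j)|case: (hB' j)].
move=> c hc [j t]; have [hFj nFj aF] := hF j; have [_ indj] := hB' j.
apply: (indj (fun t => c (Tagged (fun j : 'I_r => 'I_(v j M)) t))).
have [idj [_ prj]] := component_prime (ltn_ord j).
case: (prj (F j).1 (\sum_t c (Tagged (fun j : 'I_r => 'I_(v j M)) t) *: B j t)) => //.
(* Modulo the ideal of [Cs j] only the summand with index j survives. *)
have := (vI_components _).1 hc j (ltn_ord j).
pose T (i : 'I_r) (t : 'I_(v i M)) := c (Tagged (fun j : 'I_r => 'I_(v j M)) t) *: ((F i).1 * B i t).
rewrite (_ : (\sum_u _) = \sum_(i < r) \sum_(t < v i M) T i t); last first.
  by rewrite (sig_big_dep _ _ T) /=; apply: eq_bigr => [[i t']] _.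
rewrite (bigD1 j) //= => h.
have -> : (F j).1 * (\sum_t c (Tagged (fun j : 'I_r => 'I_(v j M)) t) *: B j t) = \sum_t T j t.
  by rewrite mulr_sumr; apply: eq_bigr => t' _; rewrite -scalerAr.
rewrite -[X in vI _ X](addrK (\sum_(i < r | i != j) \sum_(t < v i M) T i t)).
apply: (idealB idj) => //; apply: (ideal_sum idj) => i ne; apply: (ideal_sum idj) => t' _.
apply: (idealZ idj); apply: (idealMr idj); case: (hF i) => _ _; apply; first exact: ltn_ord.
by rewrite eq_sym.
Qed.

Theorem hilbert_bound (P : {poly rat}) : is_hilbert_poly I P ->
  forall m v : nat, (1 <= m)%N -> hilbert_value I m v ->
    (v%:R : rat) <= (d`!)%:R * P`_d * (m%:R) ^+ d + (r * d)%:R.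
Proof.
move=> [m0 hP] m v m1 hv.
have hdata j : exists u : nat * nat, (j < r)%N ->
    (forall m, 0 < m -> hilbert_le (vI (Cs j)) m (u.1 * m ^ d + d))%N /\
    forall M, hilbert_ge (vI (Cs j)) (u.2 + M) (u.1 * 'C(M + d, d)).
  case: (boolP (j < r)%N) => hj; last by exists (0%N, 0%N).
  have [y hy] := component_noether_params hj.
  have [delta [D h]] := prime_hilbert_bounds (component_homog hj) (component_prime hj) hy.
  by exists (delta, D).
have [u hu] := choice hdata.
pose Delta := (\sum_(j < r) (u j).1)%N.
have upper n w : (0 < n)%N -> hilbert_value I n w -> (w <= Delta * n ^ d + r * d)%N.
  move=> n0 hw; apply: (@hilbert_ge_le _ _ (vI X) n).
    by apply: hilbert_ge_vI => //; case: hw.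
  have -> : (Delta * n ^ d + r * d = \sum_(j < r) ((u j).1 * n ^ d + d))%N.
    by rewrite big_split /= sum_nat_const card_ord /Delta big_distrl.
  by apply: (@vI_hilbert_le _ (fun j => (u j).1 * n ^ d + d)%N) => j hj; case: (hu j hj) => h _; apply: h.
have [||E hE] := @vI_hilbert_ge (fun j M => (u j).1 * 'C(M + d, d))%N (fun j => (u j).2).
- by move=> j hj; case: (hu j hj).
- by move=> j M M' hM; rewrite leq_mul2l leq_bin2l ?orbT // leq_add2r.
have lower M w : hilbert_value I (E + M) w -> (Delta * M ^ d <= d`! * w)%N.
  move=> hw; have h : (Delta * 'C(M + d, d) <= w)%N.
    apply: (hilbert_value_ge hw); rewrite /Delta big_distrl /=.
    by apply: (hilbert_ge_descend hI.1 (vI_ideal X) (@map_vI _ _ iota _ I) (hE M)).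
  apply: (@leq_trans (Delta * (d`! * 'C(M + d, d)))).
    by rewrite leq_mul2l expn_le_fact_bin orbT.
  by rewrite mulnCA leq_mul2l h orbT.
(* For large n the value of [P] lies between Delta (n - E)^d / d! and Delta n^d + r d, so the sum of
   the ranks is at most the degree of [I]. *)
have key : Delta%:R <= d`!%:R * P`_d.
  apply: (@lead_coef_lower_bound P d Delta (r * d) Delta E (m0 + E).+1) => n hn.
  have [w hw] := hilbert_value_exists n hI.1.
  have n0 : (0 < n)%N by apply: leq_trans hn.
  have e : n = (E + (n - E))%N by lia.
  rewrite -(hP n w _ hw); last by lia.
  split; first exact: ler0n.
    by rewrite -natrX -natrM -natrD ler_nat; apply: upper.
  rewrite -natrB; last by lia.
  rewrite -natrX -!natrM ler_nat; apply: lower; by rewrite -e.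
apply: (@le_trans _ _ (Delta%:R * m%:R ^+ d + (r * d)%:R)).
  by rewrite -natrX -natrM -natrD ler_nat; apply: upper.
by rewrite lerD2r ler_wpM2r // exprn_ge0.
Qed.

End Components.

Theorem theorem2p1 (k : fieldType) (K : closedFieldType)
  (iota : {rmorphism k -> K}) (n : nat) (I : {mpoly k[n.+1]} -> Prop)
  (d : nat) (P : {poly rat}) (r : nat) :
  perfect_field k ->
  homogeneous_ideal I -> radical_ideal I -> unmixed iota I ->
  ideal_dim iota I d%:Z ->
  is_hilbert_poly I P ->
  irr_num iota I r ->
  forall m v : nat, (1 <= m)%N -> hilbert_value I m v ->
    (v%:R : rat) <= (d`!)%:R * P`_d * (m%:R) ^+ d + (r * d)%:R.
Proof.
move=> perf hI radI unm [[] //|[_ [[<-] dimX]]] hP [Cs [compC [injC allC]]].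
exact: hilbert_bound perf hI radI unm dimX compC injC allC P hP.
Qed.
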